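(* Let $E$ and $F$ be Banach spaces. (a) Let $\mathfrak A=\{\mathfrak A_k\}_k$ be an $AB$-closed multiplicative sequence of polynomial ideals such that, for all $k$, finite type polynomials are dense in $\mathfrak A_k(E'')$. Then $H_{b\mathfrak A}(E)$ and $H_{b\mathfrak A}(F)$ are topologically isomorphic algebras if and only if $E'$ and $F'$ are isomorphic. (b) Let $\mathfrak A=\{\mathfrak A_k\}_k$ and $\mathfrak B=\{\mathfrak B_k\}_k$ be multiplicative sequences of polynomial ideals, with $\mathfrak B$ also $AB$-closed. Suppose that, for all $k$, finite type polynomials are dense in $\mathfrak A_k(E)$ and in $\mathfrak B_k(E'')$. If $H_{b\mathfrak A}(E)$ and $H_{b\mathfrak B}(F)$ are topologically isomorphic algebras, then $E'$ is isomorphic to $F'$.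
   Context: All Banach spaces are complex; isomorphism of Banach spaces means linear homeomorphism; a topological algebra isomorphism is a linear multiplicative bijection that is a homeomorphism. $\mathcal P^k(E)$ is the Banach space of continuous $k$-homogeneous polynomials $E\to\mathbb C$; $\check P$ is the symmetric $k$-linear form of $P\in\mathcal P^k(E)$, and for $a\in E$, $P_a(x)=\check P(a,x,\dots,x)$. A finite type $k$-homogeneous polynomial is a finite linear combination of $\gamma^k$, $\gamma\in E'$. A Banach ideal of (scalar valued continuous) $k$-homogeneous polynomials is a pair $(\mathfrak A_k,\|\cdot\|_{\mathfrak A_k})$ such that: (i) for every Banach space $E$, $\mathfrak A_k(E)=\mathfrak A_k\cap\mathcal P^k(E)$ is a linear subspace of $\mathcal P^k(E)$ and $(\mathfrak A_k(E),\|\cdot\|_{\mathfrak A_k(E)})$ is a Banach space; (ii) if $T\in\mathcal L(E_1,E)$ and $P\in\mathfrak A_k(E)$ then $P\circ T\in\mathfrak A_k(E_1)$ and $\|P\circ T\|_{\mathfrak A_k(E_1)}\le\|P\|_{\mathfrak A_k(E)}\|T\|^k$; (iii) $z\mapsto z^k$ belongs to $\mathfrak A_k(\mathbb C)$ and has norm 1. A sequence $\mathfrak A=\{\mathfrak A_k\}_{k\ge1}$ of such ideals is coherent if there are constants $C,D>0$ such that for every Banach space $E$ and $k\in\mathbb N$: $P\in\mathfrak A_{k+1}(E)$, $a\in E$ imply $P_a\in\mathfrak A_k(E)$ and $\|P_a\|_{\mathfrak A_k(E)}\le C\|P\|_{\mathfrak A_{k+1}(E)}\|a\|$; and $P\in\mathfrak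 A_k(E)$, $\gamma\in E'$ imply $\gamma P\in\mathfrak A_{k+1}(E)$ and $\|\gamma P\|_{\mathfrak A_{k+1}(E)}\le D\|\gamma\|\|P\|_{\mathfrak A_k(E)}$. It is multiplicative if it is coherent and there is a constant $M$ such that for all $k,l$, every Banach space $E$, $P\in\mathfrak A_k(E)$, $Q\in\mathfrak A_l(E)$, one has $PQ\in\mathfrak A_{k+l}(E)$ and $\|PQ\|_{\mathfrak A_{k+l}(E)}\le M^{k+l}\|P\|_{\mathfrak A_k(E)}\|Q\|_{\mathfrak A_l(E)}$. $H_{b\mathfrak A}(E)$ is the space of entire functions $f$ on $E$ with $\frac{d^kf(0)}{k!}\in\mathfrak A_k(E)$ for all $k$ and $\lim_k\|\frac{d^kf(0)}{k!}\|_{\mathfrak A_k(E)}^{1/k}=0$; it is a Fréchet space with the seminorms $p_R(f)=\sum_{k\ge0}\|\frac{d^kf(0)}{k!}\|_{\mathfrak A_k(E)}R^k$, $R>0$ (the $k=0$ term is the constant $f(0)$ with its absolute value), and an algebra under pointwise multiplication when $\mathfrak A$ is multiplicative. Aron-Berner extension: for $P\in\mathcal P^k(E)$, extend $\check P$ to $E''\times\dots\times E''$ by weak-star continuity one variable at a time and restrict to the diagonal; this gives $AB(P)\in\mathcal P^k(E'')$. $\mathfrak A$ is $AB$-closed if there is $\alpha>0$ such that for every Banach space $E$, every $k$ and $P\in\mathfrak A_k(E)$, $AB(P)\in\mathfrak A_k(E'')$ and $\|AB(P)\|_{\mathfrak A_k(E'')}\le\alpha^k\|P\|_{\mathfrak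 A_k(E)}$. *)

(* Defs.v *)
From HB Require Import structures.
From mathcomp Require Import all_boot all_order all_fingroup all_algebra.
From mathcomp Require Import complex.
From mathcomp Require Import all_classical all_reals all_analysis.

Set Implicit Arguments.
Unset Strict Implicit.
Unset Printing Implicit Defensive.

Import Order.TTheory GRing.Theory Num.Theory.
Import numFieldNormedType.Exports.

Local Open Scope classical_set_scope.
Local Open Scope complex_scope.
Local Open Scope ring_scope.

(* On [R[i]] rather than [R[i]^o]: the completeness instance of the library for
   [R^o] already occupies the key [GRing.regular]. *)
HB.instance Definition _ (R : realType) := NormedModule.copy R[i] R[i]^o.

Section real_norm.
Context {R : realType}.

(* The norm of a [normedModType R[i]] takes its values in [R[i]]. *)
Definition rnorm (V : normedModType R[i]) (x : V) : R := complex.Re `|x|.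

Lemma rnormE (V : normedModType R[i]) (x : V) : `|x| = (rnorm x)%:C.
Proof.
have := normr_ge0 x; rewrite /rnorm; case: `|x| => a b.
by rewrite lecE/= => /andP[/eqP -> _].
Qed.

Lemma gt0_real_complex (e : R[i]) : 0 < e -> e = (complex.Re e)%:C.
Proof. by case: e => a b; rewrite ltcE/= => /andP[/eqP -> _]. Qed.

Lemma rnorm_ge0 (V : normedModType R[i]) (x : V) : 0 <= rnorm x.
Proof. by rewrite -ler0c -rnormE. Qed.

Lemma rnormD (V : normedModType R[i]) (x y : V) :
  rnorm (x + y) <= rnorm x + rnorm y.
Proof. by rewrite -lecR rmorphD/= -!rnormE ler_normD. Qed.

Lemma rnormZ (V : normedModType R[i]) (a : R[i]) (x : V) :
  rnorm (a *: x) = rnorm a * rnorm x.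
Proof. by apply: complexI; rewrite rmorphM/= -!rnormE normrZ. Qed.

Lemma rnorm0_eq0 (V : normedModType R[i]) (x : V) : rnorm x = 0 -> x = 0.
Proof.
by move=> x0; apply/eqP; rewrite -normr_eq0 rnormE x0.
Qed.

Lemma rnorm0 (V : normedModType R[i]) : rnorm (0 : V) = 0.
Proof. by rewrite /rnorm normr0. Qed.

Lemma rnormN (V : normedModType R[i]) (x : V) : rnorm (- x) = rnorm x.
Proof. by rewrite /rnorm normrN. Qed.

Lemma rnormM (a b : R[i]) : rnorm (a * b) = rnorm a * rnorm b.
Proof. exact: rnormZ. Qed.

Lemma rnorm_real (a : R) : 0 <= a -> rnorm a%:C = a.
Proof. by move=> a0; rewrite /rnorm ger0_norm ?ler0c. Qed.

Lemma ball_rnorm (V : normedModType R[i]) (x y : V) (e : R) :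
  ball x e%:C y <-> rnorm (x - y) < e.
Proof. by rewrite -ball_normE /ball_/= rnormE ltcR. Qed.

Lemma rnorm_Re (z : R[i]) : `|complex.Re z| <= rnorm z.
Proof.
case: z => a b; rewrite /rnorm normc_def/=.
by rewrite -sqrtr_sqr ler_wsqrtr// lerDl sqr_ge0.
Qed.

Lemma rnorm_Im (z : R[i]) : `|complex.Im z| <= rnorm z.
Proof.
case: z => a b; rewrite /rnorm normc_def/=.
by rewrite -sqrtr_sqr ler_wsqrtr// lerDr sqr_ge0.
Qed.

Lemma rnorm_ReIm (z : R[i]) :
  rnorm z <= `|complex.Re z| + `|complex.Im z|.
Proof.
case: z => a b; rewrite /rnorm normc_def/=.
rewrite -(@ler_pXn2r _ 2%N)// ?nnegrE ?sqrtr_ge0 ?addr_ge0//.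
rewrite sqr_sqrtr ?addr_ge0 ?sqr_ge0//.
rewrite sqrrD !real_normK ?num_real// -addrA lerD2l lerDr.
by rewrite mulrn_wge0// mulr_ge0.
Qed.

End real_norm.

Lemma complex_complete (R : realType) (F : set_system R[i]) :
  ProperFilter F -> cauchy F -> cvg F.
Proof.
move=> FF /cauchyP Fc.
have cR (p : R[i] -> R) : (forall z w, p z - p w = p (z - w)) ->
    (forall z, `|p z| <= rnorm z) -> cvg (p @ F).
  move=> pB pn; apply/cauchy_cvgP/cauchy_exP => e e0.
  have [|x Fx] := Fc e%:C; first by rewrite ltcR.
  exists (p x); change (F (p @^-1` ball (p x) e)).
  apply: filterS Fx => y /ball_rnorm xy.
  by rewrite /preimage/= -ball_normE /ball_/= pB (le_lt_trans (pn _)).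
have /cvg_ex[a Ra] : cvg ((@complex.Re R : R[i] -> R) @ F).
  by apply: cR => [[? ?] [? ?]//|]; exact: rnorm_Re.
have /cvg_ex[b Ib] : cvg ((@complex.Im R : R[i] -> R) @ F).
  by apply: cR => [[? ?] [? ?]//|]; exact: rnorm_Im.
apply/cvg_ex; exists (a +i* b : R[i]); apply/cvgrPdist_lt => e e0.
rewrite (gt0_real_complex e0).
have e0' : 0 < complex.Re e / 2.
  by rewrite divr_gt0//; move: e0; rewrite ltcE => /andP[].
move/cvgrPdist_lt: Ra => /(_ _ e0') Ra'.
move/cvgrPdist_lt: Ib => /(_ _ e0') Ib'.
near=> z.
have near_ab (w : R[i]) : `|a - complex.Re w| < complex.Re e / 2 ->
    `|b - complex.Im w| < complex.Re e / 2 ->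
    `|(a +i* b : R[i]) - w| < (complex.Re e)%:C.
  case: w => c d /= ac bd.
  rewrite rnormE ltcR (le_lt_trans (rnorm_ReIm _))//.
  by rewrite (splitr (complex.Re e)) ltrD.
by apply: near_ab; near: z.
Unshelve. all: by end_near. Qed.

HB.instance Definition _ (R : realType) :=
  Uniform_isComplete.Build R[i] (@complex_complete R).

Section operator_norm.
Context {R : realType} {V W : normedModType R[i]}.

Definition opnorm (T : V -> W) : R :=
  sup [set rnorm (T x) | x in [set x | rnorm x <= 1]].

Lemma opnorm_has_sup (T : {linear V -> W}) : continuous T ->
  has_sup [set rnorm (T x) | x in [set x | rnorm x <= 1]].
Proof.
move=> /linear_bounded_continuous/linear_boundedP/pinfty_ex_gt0[M M0 MT].
split; first by exists (rnorm (T 0)); exists 0 => //=; rewrite rnorm0.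
exists (complex.Re M) => _ [x /= x1 <-]; move: (MT x).
rewrite !rnormE (gt0_real_complex M0) -rmorphM/= lecR => /le_trans; apply.
by rewrite ger_pMr//; move: M0; rewrite ltcE => /andP[].
Qed.

Lemma opnorm_ge0 (T : {linear V -> W}) : continuous T -> 0 <= opnorm T.
Proof.
move=> /opnorm_has_sup/sup_upper_bound/(_ (rnorm (T 0))).
rewrite linear0 rnorm0; apply; exists 0; rewrite /= ?rnorm0//.
by rewrite linear0 rnorm0.
Qed.

Lemma le_opnorm (T : {linear V -> W}) (x : V) : continuous T ->
  rnorm (T x) <= opnorm T * rnorm x.
Proof.
move=> Tc; have [x0|x0] := eqVneq (rnorm x) 0.
  by rewrite (rnorm0_eq0 x0) linear0 !rnorm0 mulr0.
have xgt0 : 0 < rnorm x by rewrite lt_def x0 rnorm_ge0.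
rewrite -ler_pdivrMr//.
have xi : rnorm (((rnorm x)^-1%:C : R[i])) = (rnorm x)^-1.
  by rewrite rnorm_real// invr_ge0 rnorm_ge0.
have := sup_upper_bound (opnorm_has_sup Tc) => /(_ (rnorm (T x) / rnorm x)).
apply; exists ((rnorm x)^-1%:C *: x) => /=.
  by rewrite rnormZ xi mulVf.
by rewrite linearZ/= rnormZ xi mulrC.
Qed.

Lemma opnorm_le (T : {linear V -> W}) (M : R) :
  (forall x, rnorm x <= 1 -> rnorm (T x) <= M) -> opnorm T <= M.
Proof.
move=> TM; apply: ge_sup.
  by exists (rnorm (T 0)); exists 0 => //=; rewrite rnorm0.
by move=> _ [x /= x1 <-]; exact: TM.
Qed.

Lemma bounded_linear (T : {linear V -> W}) (M : R) :
  (forall x, rnorm (T x) <= M * rnorm x) -> continuous T.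
Proof.
move=> TM; apply/linear_bounded_continuous/linear_boundedP.
near=> r => x; have r0 : (0 : R[i]) < r by near: r; exact: nbhs_pinfty_gt.
have Mr : M%:C <= r.
  by near: r; apply: nbhs_pinfty_ge; rewrite complex_real.
move: Mr; rewrite (gt0_real_complex r0) !rnormE -rmorphM/= !lecR => Mr.
by rewrite (le_trans (TM x))// ler_wpM2r// rnorm_ge0.
Unshelve. all: by end_near. Qed.

End operator_norm.

Section dual.
Context {R : realType} (E : normedModType R[i]).

Definition continuous_functional : {pred E -> R[i]} :=
  fun f : E -> R[i] => `[< linear f /\ continuous f >].

Lemma continuous_functionalP (f : E -> R[i]) :
  reflect (linear f /\ continuous f) (f \in continuous_functional).
Proof. exact: asboolP. Qed.

Lemma continuous_functional_submod : submod_closed continuous_functional.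
Proof.
split=> [|a f g /continuous_functionalP[fl fc] /continuous_functionalP[gl gc]].
  apply/continuous_functionalP; split=> [a x y|x].
    by rewrite /GRing.zero/= scaler0 addr0.
  exact: cst_continuous.
apply/continuous_functionalP; split=> [b x y|x].
  rewrite !addrfctE !scalrfctE fl gl !scalerDr !scalerA [b * a]mulrC.
  by rewrite addrACA.
by apply: cvgD; [exact: cvgZl_tmp (fc x)|exact: gc].
Qed.

HB.instance Definition _ := GRing.isSubmodClosed.Build _ _
  continuous_functional continuous_functional_submod.

Record dual : Type := Dual {
  dual_fun :> E -> R[i] ;
  dual_funP : dual_fun \in continuous_functional }.

HB.instance Definition _ := [isSub for dual_fun].
HB.instance Definition _ := [Choice of dual by <:].
HB.instance Definition _ := [SubChoice_isSubLmodule of dual by <:].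

Lemma dual_linear (f : dual) : linear f.
Proof. by have /continuous_functionalP[] := dual_funP f. Qed.

HB.instance Definition _ (f : dual) :=
  GRing.isLinear.Build R[i] E R[i] _ (dual_fun f) (dual_linear f).

Lemma dual_continuous (f : dual) : continuous f.
Proof. by have /continuous_functionalP[] := dual_funP f. Qed.

Lemma dualP (f g : dual) : f =1 g -> f = g.
Proof. by move=> fg; apply/val_inj/funext. Qed.

Lemma dualD (f g : dual) x : (f + g) x = f x + g x. Proof. by []. Qed.

Lemma dualB (f g : dual) x : (f - g) x = f x - g x. Proof. by []. Qed.

Lemma dualZ a (f : dual) x : (a *: f) x = a *: f x. Proof. by []. Qed.

Definition dual_norm (f : dual) : R[i] := (opnorm f)%:C.

Lemma dual_normD f g : dual_norm (f + g) <= dual_norm f + dual_norm g.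
Proof.
rewrite /dual_norm -rmorphD/= lecR; apply: (@opnorm_le _ _ _ (f + g)) => x x1.
rewrite -[X in rnorm X]/(f x + g x) (le_trans (rnormD _ _))// lerD//.
  rewrite (le_trans (le_opnorm x (@dual_continuous f)))//.
  by rewrite ler_piMr// opnorm_ge0//; exact: dual_continuous.
rewrite (le_trans (le_opnorm x (@dual_continuous g)))//.
by rewrite ler_piMr// opnorm_ge0//; exact: dual_continuous.
Qed.

Lemma dual_normZ_le a f : dual_norm (a *: f) <= `|a| * dual_norm f.
Proof.
rewrite (_ : `|a| = (rnorm (a : R[i]))%:C); last exact: (@rnormE R R[i] a).
rewrite /dual_norm -rmorphM/= lecR; apply: (@opnorm_le _ _ _ (a *: f)) => x x1.
rewrite -[X in rnorm X]/(a *: f x) rnormZ ler_wpM2l ?rnorm_ge0//.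
rewrite (le_trans (le_opnorm x (@dual_continuous f)))//.
by rewrite ler_piMr// opnorm_ge0//; exact: dual_continuous.
Qed.

Lemma dual_normr0_eq0 f : dual_norm f = 0 -> f = 0.
Proof.
move=> /complexI f0; apply/dualP => x; apply: rnorm0_eq0.
apply/eqP; rewrite eq_le rnorm_ge0 andbT.
by rewrite (le_trans (le_opnorm x (@dual_continuous f)))// f0 mul0r.
Qed.

Lemma dual_normZ a f : dual_norm (a *: f) = `|a| * dual_norm f.
Proof.
apply/eqP; rewrite eq_le dual_normZ_le/=.
have [->|a0] := eqVneq a 0.
  rewrite normr0 mul0r ler0c opnorm_ge0//; exact: dual_continuous.
rewrite -ler_pdivlMl ?normr_gt0// -normfV.
by rewrite -{1}[f]scale1r -(mulVf a0) -scalerA dual_normZ_le.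
Qed.

HB.instance Definition _ :=
  Lmodule_isNormed.Build R[i] dual dual_normD dual_normZ dual_normr0_eq0.

Lemma rnorm_dual (f : dual) : rnorm f = opnorm f.
Proof. by []. Qed.

Lemma le_rnorm_dual (f : dual) (x : E) : rnorm (f x) <= rnorm f * rnorm x.
Proof. by rewrite rnorm_dual; apply: le_opnorm; exact: dual_continuous. Qed.

Lemma dual_complete (F : set_system dual) :
  ProperFilter F -> cauchy F -> cvg F.
Proof.
move=> FF /cauchyP Fc.
have Fev x : cvg ((fun f : dual => f x) @ F).
  apply/cauchy_cvgP/cauchy_exP => e e0.
  have x1 : 0 < rnorm x + 1 by rewrite ltr_wpDl ?rnorm_ge0.
  have ee : 0 < complex.Re e by move: e0; rewrite ltcE => /andP[].
  have [|f Ff] := Fc (complex.Re e / (rnorm x + 1))%:C.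
    by rewrite ltcR divr_gt0.
  exists (f x); change (F ((fun g : dual => g x) @^-1` ball (f x) e)).
  apply: filterS Ff => g /ball_rnorm fg.
  rewrite /preimage/= (gt0_real_complex e0); apply/ball_rnorm.
  rewrite -dualB (le_lt_trans (le_rnorm_dual _ _))//.
  apply: (@le_lt_trans _ _ (rnorm (f - g) * (rnorm x + 1))).
    by rewrite ler_wpM2l ?rnorm_ge0// lerDl.
  by rewrite -ltr_pdivlMr.
pose l x : R[i] := lim ((fun f : dual => f x) @ F).
have ll : linear l.
  move=> a x y; apply/cvg_lim; first exact: norm_hausdorff.
  rewrite (_ : (fun f : dual => _) = fun f : dual => a *: f x + f y).
    by apply: cvgD; [apply: cvgZl_tmp; exact: Fev|exact: Fev].
  by apply/funext => f; rewrite linearP.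
have fl (f : dual) (e : R) x : F (ball f e%:C) ->
    rnorm (f x - l x) <= e * rnorm x.
  move=> Ff; apply/ler_addgt0Pr => d d0.
  have : F [set g : dual | rnorm (g x - l x) < d].
    have := Fev x => /cvgr_dist_lt/(_ d%:C); rewrite ltcR => /(_ d0).
    by apply: filterS => g; rewrite /= distrC rnormE ltcR.
  move=> /(filterI Ff)/filter_ex[g [/ball_rnorm fg gl]].
  rewrite -(subrKA (g x)) (le_trans (rnormD _ _))// lerD//; last exact: ltW.
  rewrite -dualB (le_trans (le_rnorm_dual _ _))//.
  by rewrite ler_wpM2r ?rnorm_ge0// ltW.
have lc : continuous l.
  have [|f Ff] := Fc 1%:C; first by rewrite ltcR.
  pose L := HB.pack_for {linear E -> R[i]} l (GRing.isLinear.Build _ _ _ _ l ll).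
  apply: (@bounded_linear _ _ _ L (rnorm f + 1)) => x /=.
  rewrite -[l x](subKr (f x)) (le_trans (rnormD _ _))// mulrDl lerD//.
    exact: le_rnorm_dual.
  by rewrite rnormN; exact: fl Ff.
have lP : l \in continuous_functional by apply/continuous_functionalP.
apply/cvg_ex; exists (Dual lP); apply/cvgrPdist_lt => e e0.
have ee : 0 < complex.Re e / 2.
  by rewrite divr_gt0//; move: e0; rewrite ltcE => /andP[].
have [|f Ff] := Fc (complex.Re e / 2)%:C; first by rewrite ltcR.
have flL : rnorm (f - Dual lP) <= complex.Re e / 2.
  rewrite rnorm_dual; apply: (@opnorm_le _ _ _ (f - Dual lP)) => x x1.
  rewrite -[X in rnorm X]/(f x - l x) (le_trans (fl _ _ _ Ff))//.
  by rewrite ler_piMr// ltW.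
apply: filterS Ff => g /ball_rnorm fg.
rewrite (gt0_real_complex e0) rnormE ltcR -(subrKA f) (splitr (complex.Re e)).
rewrite (le_lt_trans (rnormD _ _))// ler_ltD//.
by rewrite /rnorm distrC.
Qed.

HB.instance Definition _ := Uniform_isComplete.Build dual dual_complete.

End dual.

Section canonical_embedding.
Context {R : realType} {E : normedModType R[i]}.

Lemma bidual_embedding_subproof (x : E) :
  (fun f : dual E => f x) \in @continuous_functional R (dual E).
Proof.
have evl : linear (fun f : dual E => f x) by [].
apply/continuous_functionalP; split => //.
pose ev := HB.pack_for {linear dual E -> R[i]} (fun f : dual E => f x)
  (GRing.isLinear.Build _ _ _ _ (fun f : dual E => f x) evl).
apply: (@bounded_linear _ _ _ ev (rnorm x)) => f.
by rewrite mulrC; exact: le_rnorm_dual.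
Qed.

Definition bidual_embedding (x : E) : dual (dual E) :=
  Dual (bidual_embedding_subproof x).

End canonical_embedding.

Definition isomorphic (R : realType) (V W : normedModType R[i]) : Prop :=
  exists (f : {linear V -> W}) (g : {linear W -> V}),
    [/\ cancel f g, cancel g f, continuous f & continuous g].

Definition weak_star (R : realType) (G : normedModType R[i]) : Type :=
  initial_topology (@dual_fun R G : dual G -> {ptws G -> R[i]}).

HB.instance Definition _ (R : realType) (G : normedModType R[i]) :=
  Topological.copy (weak_star G)
    (initial_topology (@dual_fun R G : dual G -> {ptws G -> R[i]})).

Section homogeneous_polynomials.
Context {R : realType} {E : normedModType R[i]}.

Definition multilinear k (A : ('I_k -> E) -> R[i]) : Prop :=
  forall (x : 'I_k -> E) (i : 'I_k), linear (fun y : E => A (dfwith x i y)).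

Definition symmetric_form k (A : ('I_k -> E) -> R[i]) : Prop :=
  forall (s : 'S_k) (x : 'I_k -> E), A (x \o s) = A x.

Definition is_polar k (P : E -> R[i]) (A : ('I_k -> E) -> R[i]) : Prop :=
  [/\ multilinear A, symmetric_form A & forall x, P x = A (fun=> x)].

(* No continuity is asked of the multilinear form: by the polarization formula
   it is continuous as soon as [P] is. *)
Definition hpolynomial k : set (E -> R[i]) :=
  [set P | continuous P /\ exists A, @is_polar k P A].

(* The form is unique when it exists. *)
Definition polar k (P : E -> R[i]) : ('I_k -> E) -> R[i] :=
  xget (fun=> 0) [set A | is_polar P A].

Definition polar_slice k (P : E -> R[i]) (a : E) : E -> R[i] :=
  fun x => polar P (fun i : 'I_k.+1 => if i == ord0 then a else x).

Definition finite_type k : set (E -> R[i]) :=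
  [set P | exists n (c : 'I_n -> R[i]) (g : 'I_n -> dual E),
    P = fun x => \sum_(i < n) c i * g i x ^+ k].

End homogeneous_polynomials.

Section aron_berner.
Context {R : realType} {E : normedModType R[i]}.

(* [B] is obtained from [A] by extending first the last variable, then the one
   before, and so on: when the [i]-th variable is extended, the previous ones
   still range over [E] and the following ones already range over [E'']. *)
Definition is_aron_berner k (A : ('I_k -> E) -> R[i])
    (B : ('I_k -> dual (dual E)) -> R[i]) : Prop :=
  [/\ multilinear B,
      forall x : 'I_k -> E, B (bidual_embedding \o x) = A x
    & forall (z : 'I_k -> dual (dual E)) (i : 'I_k),
        (forall j : 'I_k, (j < i)%N -> range bidual_embedding (z j)) ->
        continuous (fun w : weak_star (dual E) => B (dfwith z i w))].

Definition aron_berner k (P : E -> R[i]) : dual (dual E) -> R[i] :=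
  fun z => xget (fun=> 0) [set B | is_aron_berner (@polar R E k P) B]
    (fun=> z).

End aron_berner.

Section entire_functions.
Context {R : realType} {E : normedModType R[i]}.

(* Holomorphy in the sense of local expansions, around every point, in series
   of continuous homogeneous polynomials converging uniformly on a ball. *)
Definition entire (f : E -> R[i]) : Prop :=
  forall a, exists P : nat -> E -> R[i],
    (forall m, hpolynomial m (P m)) /\
    exists2 r : R, 0 < r & forall e : R, 0 < e -> \forall n \near \oo,
      forall x, rnorm (x - a) < r ->
        rnorm (f x - \sum_(m < n) P m (x - a)) < e.

(* [d^k f(0) / k!], as a [k]-homogeneous polynomial: the value at [x] of
   [d^k f(0)] is the [k]-fold derivative of [f] at [0] in the direction [x]. *)
Definition taylor_coef k (f : E -> R[i]) : E -> R[i] :=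
  fun x => (k`!%:R)^-1 * iter k (fun g : E -> R[i] => 'D_x g) f 0.

End entire_functions.

Definition banach_subspace (R : realType) (V : lmodType R[i])
    (S : set V) (N : V -> R) : Prop :=
  [/\ S 0 /\ (forall a u v, S u -> S v -> S (a *: u + v)),
      forall u, S u -> N u = 0 -> u = 0,
      forall a u, S u -> N (a *: u) = rnorm a * N u,
      forall u v, S u -> S v -> N (u + v) <= N u + N v
    & forall u : nat -> V, (forall n, S (u n)) ->
        (forall e, 0 < e -> \forall m & n \near \oo, N (u m - u n) < e) ->
        exists2 l, S l & (N (u n - l) @[n --> \oo] --> 0)].

(* Candidate sequences of ideals. The degree [0] is never used. *)
Record polynomial_classes (R : realType) := PolynomialClasses {
  pmem : forall (k : nat) (E : completeNormedModType R[i]), set (E -> R[i]) ;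
  pnorm : forall (k : nat) (E : completeNormedModType R[i]), (E -> R[i]) -> R }.

Arguments pmem {R} _ k E.
Arguments pnorm {R} _ k E.

Section polynomial_ideals.
Context {R : realType}.
Local Notation banachType := (completeNormedModType R[i]).
Implicit Types A B : polynomial_classes R.

Record banach_ideal A (k : nat) : Prop := BanachIdeal {
  ideal_hpolynomial : forall E : banachType, pmem A k E `<=` hpolynomial k ;
  ideal_banach : forall E : banachType,
    banach_subspace (pmem A k E) (pnorm A k E) ;
  ideal_comp : forall (E1 E : banachType) (T : {linear E1 -> E})
      (P : E -> R[i]), continuous T -> pmem A k E P ->
    pmem A k E1 (P \o T) /\
    pnorm A k E1 (P \o T) <= pnorm A k E P * opnorm T ^+ k ;
  ideal_power : pmem A k R[i] (fun z => z ^+ k) /\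
    pnorm A k R[i] (fun z => z ^+ k) = 1 }.

Definition ideal_sequence A : Prop :=
  forall k, (0 < k)%N -> banach_ideal A k.

Definition coherent A : Prop :=
  exists C D : R, [/\ 0 < C, 0 < D
  & forall (E : banachType) k, (0 < k)%N ->
      (forall (P : E -> R[i]) (a : E), pmem A k.+1 E P ->
        pmem A k E (polar_slice k P a) /\
        pnorm A k E (polar_slice k P a) <= C * pnorm A k.+1 E P * rnorm a) /\
      (forall (P : E -> R[i]) (g : dual E), pmem A k E P ->
        pmem A k.+1 E (fun x => g x * P x) /\
        pnorm A k.+1 E (fun x => g x * P x) <= D * rnorm g * pnorm A k E P)].

Definition multiplicative_sequence A : Prop :=
  [/\ ideal_sequence A, coherent A
  & exists M : R, forall k l, (0 < k)%N -> (0 < l)%N ->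
      forall (E : banachType) (P Q : E -> R[i]),
        pmem A k E P -> pmem A l E Q ->
        pmem A (k + l) E (fun x => P x * Q x) /\
        pnorm A (k + l) E (fun x => P x * Q x) <=
          M ^+ (k + l) * pnorm A k E P * pnorm A l E Q].

Definition AB_closed A : Prop :=
  exists2 alpha : R, 0 < alpha &
    forall (E : banachType) k, (0 < k)%N -> forall P : E -> R[i],
      pmem A k E P ->
      pmem A k (dual (dual E)) (aron_berner k P) /\
      pnorm A k (dual (dual E)) (aron_berner k P) <=
        alpha ^+ k * pnorm A k E P.

Definition finite_type_dense A (k : nat) (E : banachType) : Prop :=
  forall P, pmem A k E P -> forall e : R, 0 < e ->
    exists Q, [/\ finite_type k Q, pmem A k E Q & pnorm A k E (P - Q) < e].

Section bounded_type.
Variables (A : polynomial_classes R) (E : banachType).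

Definition Hb : set (E -> R[i]) :=
  [set f | [/\ entire f,
     forall k, (0 < k)%N -> pmem A k E (taylor_coef k f)
   & (pnorm A k E (taylor_coef k f) `^ k%:R^-1) @[k --> \oo] --> (0 : R)]].

Definition Hb_seminorm (r : R) (f : E -> R[i]) : R :=
  limn (series (fun k => (if k is 0 then rnorm (f 0)
    else pnorm A k E (taylor_coef k f)) * r ^+ k)).

(* The sets below form a base because [Hb_seminorm r] increases with [r]. *)
Definition Hb_nbhs (f : E -> R[i]) : set_system (E -> R[i]) :=
  filter_from [set p : R * R | 0 < p.1 /\ 0 < p.2]
    (fun p => [set g | Hb g /\ Hb_seminorm p.1 (g - f) < p.2]).

End bounded_type.

Definition Hb_isomorphic A (E : banachType) B (F : banachType) : Prop :=
  exists (phi : (E -> R[i]) -> (F -> R[i])) (psi : (F -> R[i]) -> (E -> R[i])),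
    [/\ (forall f, Hb A f -> Hb B (phi f) /\ psi (phi f) = f) /\
        (forall g, Hb B g -> Hb A (psi g) /\ phi (psi g) = g),
        forall a f g, Hb A f -> Hb A g -> phi (a *: f + g) = a *: phi f + phi g,
        forall f g, Hb A f -> Hb A g -> phi (f * g) = phi f * phi g,
        forall f, Hb A f -> phi @ Hb_nbhs A f --> Hb_nbhs B (phi f)
      & forall g, Hb B g -> psi @ Hb_nbhs B g --> Hb_nbhs A (psi g)].

End polynomial_ideals.

(* Main.v *)
From HB Require Import structures.
From mathcomp Require Import all_boot all_order all_fingroup all_algebra.
From mathcomp Require Import complex ring lra zify.
From mathcomp Require Import all_classical all_reals all_analysis.

Require Import Defs.

(** The proof compares tangent spaces of the two algebras at one character,
    and never describes their spectra.

    Write [Hb A E] for the algebra of entire functions attached to [A] and let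
    [phi : Hb A E -> Hb B F] be an isomorphism with inverse [psi]. The
    functional [chi : f |-> phi f 0] is a continuous character of [Hb A E]. A
    direction [x] of [E] gives the point derivation [f |-> chi ('D_x f)] at
    [chi]; as a function of [x] it is linear and bounded, so that every [f] has
    a differential [cotangent phi f] in [E'] at [chi]. On the other side, a
    function [h] in [Hb B F] has a differential in [F'] at the origin, its
    Taylor coefficient of degree one. Two maps between the duals result:
    [S g], the differential at the origin of [phi g], for [g] in [E'], and
    [T g = cotangent phi (psi g)] for [g] in [F'].

    A point derivation at a character takes [g ^+ n] to a multiple of its value
    at [g], so that a continuous one is determined by its values on the dual as
    soon as the powers [g ^+ n] span a dense subspace of each homogeneous
    component ([Hb_density]). Applied to the derivation [f |-> (phi f)'(0)] of
    [Hb A E] this gives [S (cotangent phi f) = (phi f)'(0)]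
    ([lin_image_cotangent]), hence [S (T g) = g], using density in [A_k(E)]
    alone. Applied to the derivations [h |-> chi ('D_x (psi h))] of [Hb B F],
    which sit at the origin, it gives that they only depend on the Taylor
    coefficient of degree one of [h] ([chi_derive_taylor1]), hence [T (S g) = g],
    using density in [B_k(F)].

    The second density comes from the first half. Since [S (T g) = g], the
    canonical embedding of [F] into [F''] is the restriction [F -> E''] of the
    transpose of [S] followed by the transpose [E'' -> F''] of [T]. A
    polynomial of [B_k(F)] extends to [F''] by Aron and Berner, is pulled back
    to [E''], approximated there by finite type polynomials, and restricted to
    [F] again ([finite_type_dense_bidual]). With [S] and [T] the identity the
    same argument takes density in [A_k(E'')] to density in [A_k(E)].

    Conversely, an isomorphism [S : E' -> F'] restricts by transposition to
    [U : F -> E''], and [P |-> AB(P) \o U] maps [A_k(E)] to [A_k(F)] with norm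
    at most [c ^+ k]. It sends [g ^+ k] to [(S g) ^+ k], so by density these
    maps are inverse to those of [S^-1], and multiplicative: comparing the
    coefficients of the polynomials in [t] obtained from [(g + t h) ^+ n] gives
    their values on the products [g ^+ k * h ^+ l].

    Everything rests on one description of [Hb A E]: its elements are the sums
    of series of homogeneous polynomials whose ideal norms decrease faster than
    every geometric sequence ([HbP]). That such sums are entire follows from
    the binomial expansion of each term around an arbitrary point, the ideal
    norms of the slices being controlled by coherence ([psum_expansion]); that
    all elements are of this kind is the identity theorem along half lines
    ([entire_eq0]). *)

Set Implicit Arguments.
Unset Strict Implicit.
Unset Printing Implicit Defensive.

Import Order.TTheory GRing.Theory Num.Theory.
Import numFieldNormedType.Exports.

Local Open Scope classical_set_scope.
Local Open Scope complex_scope.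
Local Open Scope ring_scope.

(** * Symmetric multilinear forms *)

Section cons_tuple.
Context {T : Type} {k : nat}.

Definition fcons (a : T) (x : 'I_k -> T) : 'I_k.+1 -> T :=
  fun i => if unlift ord0 i is Some j then x j else a.

Lemma fcons0 a x : fcons a x ord0 = a.
Proof. by rewrite /fcons unlift_none. Qed.

Lemma fconsS a x j : fcons a x (lift ord0 j) = x j.
Proof. by rewrite /fcons liftK. Qed.

Lemma fcons_eta (z : 'I_k.+1 -> T) : fcons (z ord0) (z \o lift ord0) = z.
Proof.
by apply/funext => i; case: (unliftP ord0 i) => [j ->|->];
  rewrite ?fconsS ?fcons0.
Qed.

Lemma fcons_cst a (x : T) :
  fcons a (fun=> x) = fun i => if i == ord0 then a else x.
Proof.
apply/funext => i; case: (unliftP ord0 i) => [j ->|->].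
  by rewrite fconsS eq_sym (negbTE (neq_lift _ _)).
by rewrite fcons0 eqxx.
Qed.

Lemma fcons_cst_diag (x : T) : fcons x (fun=> x) = fun=> x.
Proof. by rewrite fcons_cst; apply/funext => i; case: ifP. Qed.

Lemma dfwith_fcons0 a x b : dfwith (fcons a x) ord0 b = fcons b x.
Proof.
apply/funext => i; case: (unliftP ord0 i) => [j ->|->].
  by rewrite dfwithout ?neq_lift// !fconsS.
by rewrite dfwithin fcons0.
Qed.

Lemma dfwith_fconsS a x j b :
  dfwith (fcons a x) (lift ord0 j) b = fcons a (dfwith x j b).
Proof.
apply/funext => i; case: (unliftP ord0 i) => [l ->|->].
  rewrite fconsS; have [->|jl] := eqVneq j l; first by rewrite !dfwithin.
  by rewrite !dfwithout ?fconsS//; apply: contra_neq jl; apply: lift_inj.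
by rewrite dfwithout ?fcons0// eq_sym neq_lift.
Qed.

End cons_tuple.

Section forms.
Context {R : realType} {E : normedModType R[i]}.

Lemma form_cons k (A : ('I_k.+1 -> E) -> R[i]) a :
  multilinear A -> multilinear (fun x => A (fcons a x)).
Proof.
by move=> mA x i; have := mA (fcons a x) (lift ord0 i);
  under eq_fun do rewrite dfwith_fconsS.
Qed.

Lemma form_linear0 k (A : ('I_k.+1 -> E) -> R[i]) (x : 'I_k -> E) :
  multilinear A -> linear (fun a => A (fcons a x)).
Proof.
by move=> mA; have := mA (fcons 0 x) ord0;
  under eq_fun do rewrite dfwith_fcons0.
Qed.

Lemma symmetric_cons k (A : ('I_k.+1 -> E) -> R[i]) a :
  symmetric_form A -> symmetric_form (fun x => A (fcons a x)).
Proof.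
move=> sA s x; rewrite -(sA (lift_perm ord0 ord0 s) (fcons a x)).
congr A; apply/funext => i; case: (unliftP ord0 i) => [j ->|->].
  by rewrite /= lift_perm_lift !fconsS.
by rewrite /= lift_perm_id !fcons0.
Qed.

Lemma symmetric_swap k (A : ('I_k.+2 -> E) -> R[i]) a b x :
  symmetric_form A -> A (fcons a (fcons b x)) = A (fcons b (fcons a x)).
Proof.
move=> sA; rewrite -(sA (tperm ord0 (lift ord0 ord0))).
congr A; apply/funext => i; rewrite /=.
case: (unliftP ord0 i) => [j ->|->]; last by rewrite tpermL !(fcons0, fconsS).
rewrite fconsS; case: (unliftP ord0 j) => [l ->|->].
  by rewrite tpermD ?neq_lift ?(inj_eq lift_inj) ?neq_lift// !fconsS.
by rewrite tpermR !(fcons0, fconsS).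
Qed.

(** Along a line a symmetric form restricts, on the diagonal, to a polynomial
    whose linear coefficient is the form with one argument moved off the
    diagonal. This is all of the polarization formula that uniqueness needs. *)
Lemma form_line k (A : ('I_k.+1 -> E) -> R[i]) x y :
  multilinear A -> symmetric_form A ->
  exists p : {poly R[i]}, (forall t, A (fun=> x + t *: y) = p.[t]) /\
    p`_1 = k.+1%:R * A (fcons y (fun=> x)).
Proof.
elim: k A => [|k IHk] A mA sA.
  have cE z : (fun=> z) = fcons z (fun=> z) :> ('I_1 -> E).
    by rewrite fcons_cst_diag.
  have c1 z w : fcons z (fun=> w) = (fun=> z) :> ('I_1 -> E).
    by rewrite cE; apply/funext => i; rewrite (ord1 i) !fcons0.
  exists ((A (fun=> x))%:P + (A (fun=> y)) *: 'X); split=> [t|].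
    have -> : A (fun=> x + t *: y) = A (fcons (t *: y + x) (fun=> 0)).
      by rewrite c1 addrC.
    by rewrite (form_linear0 _ mA) !c1 !hornerE addrC mulrC.
  by rewrite coefD coefC coefZ coefX/= add0r mulr1 mul1r c1.
have [p [pE p1]] := IHk _ (form_cons x mA) (symmetric_cons x sA).
have [q [qE q1]] := IHk _ (form_cons y mA) (symmetric_cons y sA).
exists (p + 'X * q); split=> [t|].
  rewrite hornerD hornerM hornerX -pE -qE -[in LHS]fcons_cst_diag.
  by rewrite [x + t *: y in X in fcons X _]addrC (form_linear0 _ mA) addrC.
rewrite coefD p1 coefXM/= -horner_coef0 -qE scale0r addr0.
rewrite symmetric_swap// fcons_cst_diag.
by rewrite -[X in _ + X]mul1r -mulrDl natr1.
Qed.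

(** The points [0, 1, 2, ...] already are more roots than the degree allows. *)
Lemma poly_fun0 (p : {poly R[i]}) : (forall t, p.[t] = 0) -> p = 0.
Proof.
move=> p0; apply/eqP/negPn/negP => pn0.
pose s := [seq i%:R : R[i] | i <- iota 0 (size p)].
have us : uniq s.
  by rewrite map_inj_uniq ?iota_uniq// => i j /eqP; rewrite eqr_nat => /eqP.
have rs : all (root p) s by apply/allP => t _; apply/rootP.
by have := max_poly_roots pn0 rs us; rewrite size_map size_iota ltnn.
Qed.

(** Induction on the number of variables: the linear coefficient of the zero
    polynomial of [form_line] shows that every form obtained by freezing the
    first variable vanishes on the diagonal too. *)
Lemma form_diag0 k (A : ('I_k -> E) -> R[i]) :
  multilinear A -> symmetric_form A -> (forall x, A (fun=> x) = 0) ->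
  forall x, A x = 0.
Proof.
elim: k A => [|k IHk] A mA sA A0 x.
  by rewrite -[RHS](A0 0); congr A; apply/funext => -[].
rewrite -(fcons_eta x).
apply: (IHk _ (form_cons _ mA) (symmetric_cons _ sA)) => y.
have [p [pE p1]] := form_line y (x ord0) mA sA.
have p0 : p = 0 by apply: poly_fun0 => t; rewrite -pE A0.
move/esym/eqP: p1; rewrite p0 coef0 mulf_eq0 pnatr_eq0/=.
by move/eqP.
Qed.

Lemma is_polarD k (P Q : E -> R[i]) A B c :
  is_polar P A -> is_polar Q B ->
  @is_polar R E k (c *: P + Q) (fun x => c * A x + B x).
Proof.
move=> [mA sA PA] [mB sB QB]; split.
- move=> x i a u v /=; rewrite (mA x i) (mB x i).
  rewrite /GRing.scale/= !mulrDr !mulrA [c * a]mulrC.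
  by rewrite addrACA.
- by move=> s x; rewrite sA sB.
- by move=> x; rewrite -PA -QB.
Qed.

Lemma is_polar_unique k (P : E -> R[i]) A B :
  @is_polar R E k P A -> is_polar P B -> A = B.
Proof.
move=> PA PB; apply/funext => x; have [mC sC CE] := is_polarD (-1) PA PB.
apply/esym/eqP; rewrite -subr_eq0; apply/eqP; rewrite addrC -mulN1r.
apply: (form_diag0 mC sC) => y.
by rewrite -CE /= !addrfctE !scalrfctE scaleN1r addNr.
Qed.

Lemma polarE k (P : E -> R[i]) A : @is_polar R E k P A -> polar P = A.
Proof.
by move=> PA; rewrite /polar; case: xgetP => [B _ PB|/(_ A)//];
  exact: is_polar_unique PB PA.
Qed.

Lemma polarP k (P : E -> R[i]) : hpolynomial k P -> is_polar P (@polar R E k P).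
Proof. by move=> [_ [A PA]]; rewrite (polarE PA). Qed.

Lemma polar_sliceE k (P : E -> R[i]) a x :
  polar_slice k P a x = polar P (fcons a (fun=> x) : 'I_k.+1 -> E).
Proof. by rewrite /polar_slice fcons_cst. Qed.

Lemma is_polar_slice k (P : E -> R[i]) a : hpolynomial k.+1 P ->
  is_polar (polar_slice k P a) (fun x : 'I_k -> E => polar P (fcons a x)).
Proof.
move=> /polarP[mA sA PA]; split.
- exact: form_cons.
- exact: symmetric_cons.
- by move=> x; rewrite polar_sliceE.
Qed.

Lemma polar_sliceP k (P : E -> R[i]) a : hpolynomial k.+1 P ->
  polar (polar_slice k P a) = fun x : 'I_k -> E => polar P (fcons a x).
Proof. by move=> /(is_polar_slice a)/polarE. Qed.

Lemma polar_slice_diag k (P : E -> R[i]) x : hpolynomial k.+1 P ->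
  polar_slice k P x x = P x.
Proof. by move=> /polarP[_ _ PA]; rewrite polar_sliceE fcons_cst_diag PA. Qed.

Lemma polar_sliceC k (P : E -> R[i]) a b : hpolynomial k.+2 P ->
  polar_slice k (polar_slice k.+1 P a) b =
  polar_slice k (polar_slice k.+1 P b) a.
Proof.
move=> hP; apply/funext => x; rewrite !(polar_sliceE, polar_sliceP _ hP).
by rewrite symmetric_swap//; have [] := polarP hP.
Qed.

Lemma polar_slice_linear k (P : E -> R[i]) c a b : hpolynomial k.+1 P ->
  polar_slice k P (c *: a + b) = c *: polar_slice k P a + polar_slice k P b.
Proof.
move=> /polarP[mA _ _]; apply/funext => x.
by rewrite addrfctE scalrfctE !polar_sliceE form_linear0.
Qed.

Lemma polarD k (P Q : E -> R[i]) c : hpolynomial k P -> hpolynomial k Q ->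
  @polar R E k (c *: P + Q) = fun x => c * polar P x + polar Q x.
Proof.
by move=> hP hQ; apply: polarE; apply: is_polarD; exact: polarP.
Qed.

Lemma polar_sliceD k (P Q : E -> R[i]) c a :
  hpolynomial k.+1 P -> hpolynomial k.+1 Q ->
  polar_slice k (c *: P + Q) a = c *: polar_slice k P a + polar_slice k Q a.
Proof.
move=> hP hQ; apply/funext => x.
rewrite polar_sliceE polarD//.
by rewrite -[RHS]/(c * polar_slice k P a x + polar_slice k Q a x) !polar_sliceE.
Qed.

Lemma dual_power_polar k (g : dual E) :
  is_polar (fun x => g x ^+ k) (fun x : 'I_k -> E => \prod_(i < k) g (x i)).
Proof.
split.
- move=> x i a u v /=.
  have gE w : \prod_(j < k) g (dfwith x i w j) =
      g w * \prod_(j < k | j != i) g (x j).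
    rewrite (bigD1 i)//= dfwithin; congr (_ * _); apply: eq_bigr => j ji.
    by rewrite dfwithout// eq_sym.
  by rewrite !gE linearP /GRing.scale/= mulrDl mulrA.
- by move=> s x; rewrite [RHS](reindex_inj (@perm_inj _ s)).
- by move=> x; rewrite prodr_const card_ord.
Qed.

Lemma hpolynomialZ k (P : E -> R[i]) t x : hpolynomial k P ->
  P (t *: x) = t ^+ k * P x.
Proof.
move=> /polarP[mA _ PA]; rewrite !PA; move: (polar P) mA => A.
elim: k A {P PA} => [|k IHk] A mA.
  by rewrite expr0 mul1r; congr A; apply/funext => -[].
rewrite -[in LHS]fcons_cst_diag (IHk _ (form_cons _ mA)).
have := form_linear0 (fun=> x) mA t x 0; rewrite addr0.
have := form_linear0 (fun=> x) mA 0 0 0; rewrite scale0r addr0 scale0r add0r.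
move=> A0; have := form_linear0 (fun=> x) mA 1 0 0.
rewrite scale1r scale1r addr0 => /eqP; rewrite -subr_eq subrr eq_sym => /eqP.
move=> -> ->; rewrite addr0 fcons_cst_diag.
by rewrite exprSr mulrA.
Qed.

End forms.

(** * Homogeneous components of an ideal sequence *)

Section real_norm_extra.
Context {R : realType}.

Lemma rnorm1 : rnorm (1 : R[i]) = 1.
Proof. by rewrite (_ : 1 = 1%:C) ?rnorm_real. Qed.

Lemma rnormX (z : R[i]) n : rnorm (z ^+ n) = rnorm z ^+ n.
Proof.
by elim: n => [|n IHn]; rewrite ?expr0 ?rnorm1// !exprS rnormM IHn.
Qed.

Lemma rnorm_nat n : rnorm (n%:R : R[i]) = n%:R.
Proof. by rewrite -(rmorph_nat (real_complex R)) rnorm_real. Qed.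

Lemma rnormB (V : normedModType R[i]) (x y : V) :
  rnorm (x - y) <= rnorm x + rnorm y.
Proof. by rewrite (le_trans (rnormD _ _))// rnormN. Qed.

Lemma rnormC (V : normedModType R[i]) (x y : V) :
  rnorm (x - y) = rnorm (y - x).
Proof. by rewrite -opprB rnormN. Qed.

Lemma rnorm_sum (V : normedModType R[i]) I (r : seq I) (P : pred I)
    (f : I -> V) :
  rnorm (\sum_(i <- r | P i) f i) <= \sum_(i <- r | P i) rnorm (f i).
Proof.
elim/big_rec2: _ => [|i y1 y2 _ le12]; first by rewrite rnorm0.
by rewrite (le_trans (rnormD _ _))// lerD2l.
Qed.

Lemma cvg_rnormP (V : normedModType R[i]) T (F : set_system T)
    {FF : Filter F} (f : T -> V) l :
  f @ F --> l <->
  (forall e : R, 0 < e -> \forall t \near F, rnorm (f t - l) < e).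
Proof.
split=> [/cvgrPdist_lt fl e e0|fl].
  have /fl : (0 : R[i]) < e%:C by rewrite ltcR.
  by apply: filterS => t; rewrite rnormE ltcR rnormC.
apply/cvgrPdist_lt => e e0; have := e0; rewrite (gt0_real_complex e0) ltcR.
by move=> /fl; apply: filterS => t; rewrite rnormE ltcR rnormC.
Qed.

Definition mklinear (V W : lmodType R[i]) (f : V -> W) (fl : linear f) :
    {linear V -> W} :=
  HB.pack_for {linear V -> W} f (GRing.isLinear.Build R[i] V W _ f fl).

Lemma opnorm_bound (V W : normedModType R[i]) (T : {linear V -> W}) (M : R) :
  0 <= M -> (forall x, rnorm (T x) <= M * rnorm x) -> opnorm T <= M.
Proof.
move=> M0 TM; apply: opnorm_le => x x1; rewrite (le_trans (TM x))//.
by rewrite ler_piMr.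
Qed.

Lemma dual_of_bounded (V : normedModType R[i]) (f : V -> R[i]) (M : R) :
  linear f -> (forall x, rnorm (f x) <= M * rnorm x) ->
  f \in @continuous_functional R V.
Proof.
move=> fl fM; apply/continuous_functionalP; split => //.
exact: (@bounded_linear _ _ _ (mklinear fl) M).
Qed.

Lemma rnorm_dual_le (V : normedModType R[i]) (f : dual V) (M : R) :
  0 <= M -> (forall x, rnorm (f x) <= M * rnorm x) -> rnorm f <= M.
Proof. by move=> M0 fM; rewrite rnorm_dual; exact: (@opnorm_bound _ _ f). Qed.

End real_norm_extra.

Section banach_subspace_theory.
Context {R : realType} {V : lmodType R[i]} {S : set V} {N : V -> R}.
Hypothesis SN : banach_subspace S N.

Lemma bs_mem0 : S 0. Proof. by case: SN => -[]. Qed.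

Lemma bs_memDZ a u v : S u -> S v -> S (a *: u + v).
Proof. by case: SN => -[_ h] _ _ _ _; exact: h. Qed.

Lemma bs_memD u v : S u -> S v -> S (u + v).
Proof. by move=> Su Sv; rewrite -[u]scale1r; exact: bs_memDZ. Qed.

Lemma bs_memZ a u : S u -> S (a *: u).
Proof.
by move=> Su; rewrite -[_ *: _]addr0; apply: bs_memDZ => //; exact: bs_mem0.
Qed.

Lemma bs_memB u v : S u -> S v -> S (u - v).
Proof. by move=> Su Sv; rewrite addrC -scaleN1r; exact: bs_memDZ. Qed.

Lemma bs_mem_sum I (r : seq I) (P : pred I) (f : I -> V) :
  (forall i, P i -> S (f i)) -> S (\sum_(i <- r | P i) f i).
Proof. by move=> Sf; apply: big_ind => //; [exact: bs_mem0|exact: bs_memD]. Qed.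

Lemma bs_normZ a u : S u -> N (a *: u) = rnorm a * N u.
Proof. by case: SN => _ _ h _ _; exact: h. Qed.

Lemma bs_normD u v : S u -> S v -> N (u + v) <= N u + N v.
Proof. by case: SN => _ _ _ h _; exact: h. Qed.

Lemma bs_norm0 : N 0 = 0.
Proof. by rewrite -[X in N X](scale0r (0 : V)) bs_normZ ?rnorm0 ?mul0r//; exact: bs_mem0. Qed.

Lemma bs_normN u : S u -> N (- u) = N u.
Proof. by move=> Su; rewrite -scaleN1r bs_normZ// rnormN rnorm1 mul1r. Qed.

Lemma bs_norm_ge0 u : S u -> 0 <= N u.
Proof.
move=> Su; have := bs_normD Su (bs_memZ (-1) Su).
rewrite scaleN1r subrr bs_norm0 bs_normN// -mulr2n.
by rewrite pmulrn_lge0.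
Qed.

Lemma bs_norm_sum I (r : seq I) (P : pred I) (f : I -> V) :
  (forall i, P i -> S (f i)) ->
  N (\sum_(i <- r | P i) f i) <= \sum_(i <- r | P i) N (f i).
Proof.
move=> Sf.
have [] // : S (\sum_(i <- r | P i) f i) /\
    N (\sum_(i <- r | P i) f i) <= \sum_(i <- r | P i) N (f i).
apply: (big_ind2 (fun x y => S x /\ N x <= y)) => //.
- by rewrite bs_norm0; split=> //; exact: bs_mem0.
- move=> x1 x2 y1 y2 [Sx xy] [Sy yy]; split; first exact: bs_memD.
  by rewrite (le_trans (bs_normD _ _))// lerD.
- by move=> i Pi; split=> //; exact: Sf.
Qed.

End banach_subspace_theory.

(** ** Linear functionals on a subspace *)

Section linear_on.
Context {R : realType} {V : lmodType R[i]}.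

Definition linear_on (S : set V) (L : V -> R[i]) : Prop :=
  forall c u v, S u -> S v -> L (c *: u + v) = c * L u + L v.

Context (S : set V) (S0 : S 0) (SP : forall a u v, S u -> S v -> S (a *: u + v)).
Context (L : V -> R[i]) (linL : linear_on S L).

Lemma linear_on0 : L 0 = 0.
Proof.
have := linL (-1) S0 S0; rewrite scaleN1r addNr => h.
by rewrite h mulN1r addNr.
Qed.

Lemma linear_onZ c u : S u -> L (c *: u) = c * L u.
Proof.
by move=> Su; have := linL c Su S0; rewrite addr0 linear_on0 addr0.
Qed.

Lemma linear_onB u v : S u -> S v -> L (u - v) = L u - L v.
Proof. by move=> Su Sv; rewrite addrC -scaleN1r linL// mulN1r addrC. Qed.

Lemma linear_on_sum n (u : 'I_n -> V) : (forall k, S (u k)) ->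
  L (\sum_(k < n) u k) = \sum_(k < n) L (u k).
Proof.
elim: n u => [|n IHn] u Su; first by rewrite !big_ord0 linear_on0.
rewrite !big_ord_recr/= -IHn// -[X in X + u _]scale1r linL ?mul1r//.
apply: big_ind => // v w Sv Sw; rewrite -[v]scale1r; exact: SP.
Qed.

End linear_on.

Section graded.
Context {R : realType}.
Local Notation banachType := (completeNormedModType R[i]).
Implicit Types (A : polynomial_classes R) (E : banachType).

(** The homogeneous components of [Hb A], with the constants in degree zero, where
    [polynomial_classes] says nothing. *)
Definition gmem A E k : set (E -> R[i]) :=
  if k is 0 then [set P | exists c, P = fun=> c] else pmem A k E.

Definition gnorm A E k (P : E -> R[i]) : R :=
  if k is 0 then rnorm (P 0) else pnorm A k E P.

Lemma gmem_hpolynomial A E k P : ideal_sequence A ->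
  gmem A k P -> @hpolynomial R E k P.
Proof.
move=> iA; case: k => [[c ->]|k]; last exact: (ideal_hpolynomial (iA k.+1 _)).
split; first by move=> x; exact: cst_continuous.
by exists (fun=> c); split=> // x [].
Qed.

Lemma gbanach A E k : ideal_sequence A ->
  banach_subspace (@gmem A E k) (gnorm A k).
Proof.
move=> iA; case: k => [|k]; last exact: (ideal_banach (iA k.+1 _)).
split.
- split; first by exists 0.
  by move=> a u v [c ->] [d ->]; exists (a * c + d); exact/funext.
- by move=> u [c ->] /= /rnorm0_eq0 ->.
- by move=> a u [c ->]; rewrite /= -rnormM.
- by move=> u v [c ->] [d ->]; exact: rnormD.
move=> u uc cau.
have [l ul] : exists l : R[i], (fun n => u n 0) @ \oo --> l.
  apply/cvg_ex/cauchy_cvgP/cauchyP => e e0.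
  have e0' : 0 < complex.Re e by move: e0; rewrite ltcE => /andP[].
  have [[B C] [[N _ BN] [M _ CM]] BC] := cau _ e0'.
  exists (u (maxn N M) 0).
  rewrite (gt0_real_complex e0); exists M => // n /= Mn.
  apply/ball_rnorm; have /BC// : (B `*` C) (maxn N M, n).
  by split; [apply: BN => /=; exact: leq_maxl|exact: CM].
exists (fun=> l); first by exists l.
apply/cvgrPdist_lt => e e0; move/cvg_rnormP: ul => /(_ _ e0).
apply: filterS => n; rewrite sub0r normrN ger0_norm//.
exact: rnorm_ge0.
Qed.

Lemma gmem_comp A E1 E k (T : {linear E1 -> E}) P : ideal_sequence A ->
  continuous T -> gmem A k P ->
  gmem A k (P \o T) /\ gnorm A k (P \o T) <= gnorm A k P * opnorm T ^+ k.
Proof.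
move=> iA Tc; case: k => [[c ->]|k]; last exact: (ideal_comp (iA k.+1 _)).
by split; [exists c|rewrite /= mulr1].
Qed.

Lemma gpow A k : ideal_sequence A ->
  gmem A k (fun z : R[i] => z ^+ k) /\ gnorm A k (fun z : R[i] => z ^+ k) = 1.
Proof.
move=> iA; case: k => [|k]; last exact: (ideal_power (iA k.+1 _)).
by split; [exists 1; apply/funext => z; rewrite expr0|rewrite /= expr0 rnorm1].
Qed.

Lemma gmem_dual_power A E k (g : dual E) : ideal_sequence A ->
  gmem A k (fun x => g x ^+ k) /\ gnorm A k (fun x => g x ^+ k) <= rnorm g ^+ k.
Proof.
move=> iA; have [p1 p2] := gpow k iA.
have [h1 h2] := gmem_comp iA (@dual_continuous _ _ g) p1.
by split=> //; move: h2; rewrite p2 mul1r rnorm_dual.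
Qed.

(** A polynomial restricted to the line through [x] is [P x] times the power
    map, whose norm is one. *)
Lemma geval A E k P x : ideal_sequence A -> @gmem A E k P ->
  rnorm (P x) <= gnorm A k P * rnorm x ^+ k.
Proof.
move=> iA kP; pose f (t : R[i]) := t *: x.
have fl : linear f by move=> a u v; rewrite /f scalerDl scalerA.
have fb t : rnorm (mklinear fl t) <= rnorm x * rnorm t.
  by rewrite /= /f rnormZ mulrC.
have [h1 h2] := gmem_comp iA (bounded_linear fb) kP.
have [p1 p2] := gpow k iA.
have PE : P \o mklinear fl = P x *: (fun z : R[i] => z ^+ k).
  apply/funext => t; rewrite /= /f (hpolynomialZ _ _ (gmem_hpolynomial iA kP)).
  by rewrite mulrC.
move: h2; rewrite PE (bs_normZ (gbanach _ _ iA))// p2 mulr1 => /le_trans; apply.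
rewrite ler_wpM2l ?(bs_norm_ge0 (gbanach _ _ iA))//.
rewrite lerXn2r ?nnegrE ?rnorm_ge0 ?opnorm_ge0//; first exact: bounded_linear fb.
exact: opnorm_bound (rnorm_ge0 _) fb.
Qed.

(** A functional on polynomials of degree [k], bounded by the ideal norm and
    killing powers of functionals, vanishes when those powers span a dense
    subspace; in degree zero the only power is the constant one. *)
Lemma graded_density A E k (L : (E -> R[i]) -> R[i]) (K : R) :
  ideal_sequence A -> ((0 < k)%N -> finite_type_dense A k E) ->
  linear_on (@gmem A E k) L -> 0 <= K ->
  (forall p, gmem A k p -> rnorm (L p) <= K * gnorm A k p) ->
  (forall g : dual E, L (fun x => g x ^+ k) = 0) ->
  forall p, gmem A k p -> L p = 0.
Proof.
move=> iA dA linL K0 LK Lpow p kp.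
have bs := gbanach E k iA; have m0 := bs_mem0 bs; have mP := @bs_memDZ _ _ _ _ bs.
case: k dA linL LK Lpow kp bs m0 mP => [|k] dA linL LK Lpow kp bs m0 mP.
  have [c ->] := kp.
  have -> : (fun _ : E => c) = c *: (fun x : E => (0 : dual E) x ^+ 0).
    by apply/funext => x; rewrite -[RHS]/(c * (0 : dual E) x ^+ 0) expr0 mulr1.
  rewrite (linear_onZ m0 linL) ?Lpow ?mulr0//.
  by have [] := gmem_dual_power 0 (0 : dual E) iA.
apply/rnorm0_eq0/eqP; rewrite eq_le rnorm_ge0 andbT.
apply/ler_addgt0Pr => e e0; rewrite add0r.
have K1 : 0 < K + 1 by rewrite ltr_wpDl.
have [|Q [fQ gQ pQ]] := dA isT p kp (e / (K + 1)); first by rewrite divr_gt0.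
have LQ : L Q = 0.
  have [m [c [g ->]]] := fQ.
  have -> : (fun x => \sum_(i < m) c i * g i x ^+ k.+1) =
      \sum_(i < m) (c i *: (fun x => g i x ^+ k.+1)).
    by apply/funext => x; rewrite fct_sumE.
  have gm i : gmem A k.+1 (fun x => g i x ^+ k.+1).
    by have [] := gmem_dual_power k.+1 (g i) iA.
  rewrite (linear_on_sum m0 mP linL) => [|i]; last exact: (bs_memZ bs).
  by rewrite big1// => i _; rewrite (linear_onZ m0 linL)// Lpow mulr0.
have kpQ : gmem A k.+1 (p - Q) by exact: (bs_memB bs).
have -> : L p = L (p - Q) by rewrite (linear_onB linL)// LQ subr0.
rewrite (le_trans (LK _ kpQ))//.
apply: (@le_trans _ _ ((K + 1) * gnorm A k.+1 (p - Q))).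
  by rewrite ler_wpM2r ?(bs_norm_ge0 bs)// lerDl.
by rewrite -ler_pdivlMl// mulrC ltW.
Qed.

(** Half of coherence, extended to degree one, where slices are constants. *)
Definition slice_bounded A (C : R) : Prop :=
  forall E k (P : E -> R[i]) a, gmem A k.+1 P ->
    gmem A k (polar_slice k P a) /\
    gnorm A k (polar_slice k P a) <= C * gnorm A k.+1 P * rnorm a.

(** In degree one the slice is the value at [a], bounded by the norm; this is
    why the constant is taken to be at least one. *)
Lemma coherent_slice A : ideal_sequence A -> coherent A ->
  exists2 C : R, 1 <= C & slice_bounded A C.
Proof.
move=> iA [C [D [C0 _ cA]]]; exists (Num.max 1 C); first by rewrite le_max lexx.
move=> E k P a kP.
have N0 := bs_norm_ge0 (gbanach _ _ iA) kP.
have CM (x : R) : 0 <= x -> x <= C * gnorm A k.+1 P * rnorm a ->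
    x <= Num.max 1 C * gnorm A k.+1 P * rnorm a.
  move=> x0 /le_trans; apply; rewrite ler_wpM2r ?rnorm_ge0// ler_wpM2r//.
  by rewrite le_max lexx orbT.
case: k kP N0 CM => [|k] kP N0 CM.
  have hP := gmem_hpolynomial iA kP.
  have sE x : polar_slice 0 P a x = P a.
    rewrite polar_sliceE; have [_ _ ->] := polarP hP.
    congr polar; apply/funext => i; rewrite (ord1 i) fcons0//.
  split; first by exists (P a); apply/funext.
  rewrite /= sE (le_trans (geval _ iA kP))// expr1 ler_wpM2r ?rnorm_ge0//.
  by rewrite ler_peMl// le_max lexx.
have [h _] := cA E k.+1 isT; have [h1 h2] := h _ a kP; split=> //.
by apply: CM => //; exact: (bs_norm_ge0 (gbanach E k.+1 iA) h1).
Qed.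

Definition mul_bounded A (M : R) : Prop :=
  forall E k l (P Q : E -> R[i]), gmem A k P -> gmem A l Q ->
    gmem A (k + l) (P * Q) /\
    gnorm A (k + l) (P * Q) <= M ^+ (k + l) * gnorm A k P * gnorm A l Q.

Lemma multiplicative_mul A : multiplicative_sequence A ->
  exists2 M : R, 1 <= M & mul_bounded A M.
Proof.
move=> [iA _ [M0 hM]]; pose M := Num.max 1 `|M0|; exists M.
  by rewrite le_max lexx.
have M1 : 1 <= M by rewrite le_max lexx.
move=> E k l P Q kP lQ.
have P0 := bs_norm_ge0 (gbanach _ _ iA) kP.
have Q0 := bs_norm_ge0 (gbanach _ _ iA) lQ.
case: k kP P0 => [[c ->]|k] kP.
  have -> : (fun=> c) * Q = c *: Q by [].
  rewrite add0n (bs_normZ (gbanach _ _ iA))//; split.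
    exact: (bs_memZ (gbanach _ _ iA)).
  rewrite -[gnorm A 0 (fun=> c)]/(rnorm c).
  by rewrite -mulrA ler_peMl ?mulr_ge0 ?rnorm_ge0// exprn_ege1.
case: l lQ Q0 => [[c ->]|l] lQ Q0.
  have -> : P * (fun=> c) = c *: P by apply/funext => x; exact: mulrC.
  rewrite addn0 (bs_normZ (gbanach _ _ iA))//; split.
    exact: (bs_memZ (gbanach _ _ iA)).
  rewrite -[gnorm A 0 (fun=> c)]/(rnorm c).
  by rewrite [leRHS]mulrC ler_wpM2l ?rnorm_ge0// ler_peMl// exprn_ege1.
have [h1 h2] := hM k.+1 l.+1 isT isT E P Q kP lQ; split=> //.
apply: (le_trans h2); rewrite ler_wpM2r// ler_wpM2r//.
rewrite (le_trans (ler_norm _))// normrX lerXn2r ?nnegrE//.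
  by rewrite (le_trans _ M1).
by rewrite le_max lexx orbT.
Qed.

End graded.

(** * Series of complex numbers and power series on lines *)

Section series.
Context {R : realType}.

Lemma geo_sum_le (q : R) n : 0 <= q < 1 -> \sum_(0 <= k < n) q ^+ k <= (1 - q)^-1.
Proof.
move=> /andP[q0 q1]; have q1' : 0 < 1 - q by rewrite subr_gt0.
rewrite -[leRHS]mul1r ler_pdivlMr// mulrC.
have -> : (1 - q) * \sum_(0 <= k < n) q ^+ k = 1 - q ^+ n.
  by rewrite big_mkord -opprB mulNr -subrX1 opprB.
by rewrite gerBl exprn_ge0.
Qed.

Lemma nneg_series_cvg (b : nat -> R) M : (forall k, 0 <= b k) ->
  (forall n, \sum_(0 <= k < n) b k <= M) -> cvgn (series b).
Proof.
move=> b0 bM; apply: nondecreasing_is_cvgn.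
  by apply/nondecreasing_seqP => n; rewrite /series/= big_nat_recr//= lerDl.
by exists M => _ [n _ <-]; exact: bM.
Qed.

Lemma nneg_series_le_lim (b : nat -> R) n : (forall k, 0 <= b k) ->
  cvgn (series b) -> \sum_(0 <= k < n) b k <= limn (series b).
Proof.
move=> b0 cb; apply: (@nondecreasing_cvgn_le _ (series b)) => //.
by apply/nondecreasing_seqP => m; rewrite /series/= big_nat_recr//= lerDl.
Qed.

Lemma nneg_lim_series_le (b : nat -> R) M : cvgn (series b) ->
  (forall n, \sum_(0 <= k < n) b k <= M) -> limn (series b) <= M.
Proof. by move=> cb bM; apply: limr_le => //; apply: nearW. Qed.

Lemma series_comparison (c : nat -> R[i]) (b : nat -> R) :
  (forall k, rnorm (c k) <= b k) -> cvgn (series b) -> cvgn (series c).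
Proof.
move=> cb /cauchy_cvgP/cauchy_seriesP cau; apply/cauchy_cvgP/cauchy_seriesP.
move=> e e0; have e0' : 0 < complex.Re e by move: e0; rewrite ltcE => /andP[].
apply: filterS (cau _ e0') => -[m n] /= h.
rewrite (gt0_real_complex e0) rnormE ltcR (le_lt_trans (rnorm_sum _ _ _))//.
apply: le_lt_trans h; rewrite (le_trans _ (ler_norm _))//.
by apply: ler_sum.
Qed.

Lemma cvgn_rnormP (u : nat -> R[i]) (l : R[i]) : u @ \oo --> l <->
  (forall e : R, 0 < e -> \forall n \near \oo, rnorm (u n - l) < e).
Proof. exact: cvg_rnormP. Qed.

Lemma rnorm_lim_le (u : nat -> R[i]) (l : R[i]) (M : R) :
  u @ \oo --> l -> (\forall n \near \oo, rnorm (u n) <= M) -> rnorm l <= M.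
Proof.
move=> /cvgn_rnormP ul uM; apply/ler_addgt0Pr => e e0.
have [n [un nM]] := filter_ex (filterI (ul _ e0) uM).
rewrite -[l](subrK (u n)) (le_trans (rnormD _ _))// addrC lerD//.
by rewrite rnormC ltW.
Qed.

Lemma cvgn_unique (u : nat -> R[i]) (l l' : R[i]) : u @ \oo --> l -> u @ \oo --> l' ->
  l = l'.
Proof. by move=> h h'; apply: (cvg_unique _ h h'); exact: norm_hausdorff. Qed.

Lemma series_rnorm_le (c : nat -> R[i]) (l : R[i]) (M : R) : series c @ \oo --> l ->
  (forall n, \sum_(0 <= k < n) rnorm (c k) <= M) -> rnorm l <= M.
Proof.
move=> cl cM; apply: (rnorm_lim_le cl); apply: nearW => n.
by rewrite (le_trans (rnorm_sum _ _ _)).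
Qed.

Lemma cvgnD (u v : nat -> R[i]) (l m : R[i]) : u @ \oo --> l ->
  v @ \oo --> m -> (fun n => u n + v n) @ \oo --> l + m.
Proof. by move=> ul vm; exact: (cvgD ul vm). Qed.

Lemma cvgnMl (u : nat -> R[i]) (a l : R[i]) : u @ \oo --> l ->
  (fun n => a * u n) @ \oo --> a * l.
Proof. by move=> ul; apply: (@cvgZl_tmp _ R[i]); exact: ul. Qed.

Lemma cvgnM (u v : nat -> R[i]) (s t : R[i]) : u @ \oo --> s ->
  v @ \oo --> t -> (fun n => u n * v n) @ \oo --> s * t.
Proof.
move=> /cvgn_rnormP us /cvgn_rnormP vt; apply/cvgn_rnormP => e e0.
pose B := rnorm s + rnorm t + 1; pose d := Num.min 1 (e / B).
have B0 : 0 < B by rewrite ltr_wpDl// addr_ge0 ?rnorm_ge0.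
have d0 : 0 < d by rewrite lt_min ltr01 divr_gt0.
have d1 : d <= 1 by rewrite ge_min lexx.
have dB : d * B <= e by rewrite -ler_pdivlMr// ge_min lexx orbT.
apply: filterS2 (us _ d0) (vt _ d0) => n un vn.
have -> : u n * v n - s * t =
    (u n - s) * (v n - t) + ((u n - s) * t + s * (v n - t)) by ring.
apply: lt_le_trans dB; rewrite (le_lt_trans (rnormD _ _))//.
rewrite (_ : d * B = d * 1 + (d * rnorm t + rnorm s * d)); last by rewrite /B; ring.
apply: ltr_leD; first by rewrite rnormM ltr_pM ?rnorm_ge0// (lt_le_trans vn).
rewrite (le_trans (rnormD _ _))// !rnormM lerD//.
  by rewrite ler_wpM2r ?rnorm_ge0// ltW.
by rewrite ler_wpM2l ?rnorm_ge0// ltW.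
Qed.

Lemma cvgn_cst (a : R[i]) : (fun _ : nat => a) @ \oo --> a.
Proof. exact: cvg_cst. Qed.

Lemma cvgnS (u : nat -> R[i]) (l : R[i]) :
  (fun n => u n.+1) @ \oo --> l <-> u @ \oo --> l.
Proof. by split; rewrite (cvg_shiftS u). Qed.

Lemma series_shift (c : nat -> R[i]) (l : R[i]) : series c @ \oo --> l <->
  series (fun k => c k.+1) @ \oo --> l - c 0%N.
Proof.
have sE n : series (fun k => c k.+1) n = series c n.+1 - c 0%N.
  by rewrite /series/= [in RHS]big_nat_recl//= addrC addKr.
split=> cl.
  rewrite (_ : series _ = fun n => series c n.+1 - c 0%N); last exact/funext.
  exact: (cvgnD ((cvgnS _ _).2 cl) (@cvgn_cst (- c 0%N))).
apply/cvgnS.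
rewrite (_ : (fun n => _) = fun n => series (fun k => c k.+1) n + c 0%N).
  by have := cvgnD cl (@cvgn_cst (c 0%N)); rewrite subrK.
by apply/funext => n; rewrite sE subrK.
Qed.

Lemma seriesZ (c : nat -> R[i]) (a l : R[i]) : series c @ \oo --> l ->
  series (fun k => a * c k) @ \oo --> a * l.
Proof.
move=> cl; rewrite (_ : series _ = fun n => a * series c n).
  exact: cvgnMl.
by apply/funext => n; rewrite /series/= mulr_sumr.
Qed.

#[local] Arguments seriesZ {c} a {l}.

Lemma seriesD (c d : nat -> R[i]) (l m : R[i]) : series c @ \oo --> l ->
  series d @ \oo --> m -> series (fun k => c k + d k) @ \oo --> l + m.
Proof.
move=> cl dm; rewrite (_ : series _ = fun n => series c n + series d n).
  exact: (cvgnD cl dm).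
by apply/funext => n; rewrite /series/= big_split.
Qed.

Lemma series_terms_bounded (c : nat -> R[i]) : cvgn (series c) ->
  exists2 K : R, 0 < K & forall k, rnorm (c k) <= K.
Proof.
move=> /cvg_series_cvg_0/cvgn_rnormP/(_ _ ltr01)[N _ cN].
exists (1 + \sum_(0 <= k < N) rnorm (c k)).
  by rewrite ltr_pwDl// sumr_ge0// => k _; exact: rnorm_ge0.
move=> k; have [Nk|kN] := leqP N k.
  have := cN _ Nk; rewrite /= subr0 => /ltW/le_trans; apply.
  by rewrite lerDl sumr_ge0// => j _; exact: rnorm_ge0.
rewrite (@le_trans _ _ (\sum_(0 <= k < N) rnorm (c k)))// ?lerDr//.
rewrite big_mkord (bigD1 (Ordinal kN))//= lerDl sumr_ge0// => j _.
exact: rnorm_ge0.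
Qed.

(** The terms of degree at least one sum to [O(s)] by comparison with the
    geometric series at the point [d / 2]. *)
Lemma power_series_coef0 (d : R) (c : nat -> R[i]) : 0 < d ->
  (forall s : R, 0 < s < d ->
    series (fun k => c k * (- s%:C) ^+ k) @ \oo --> (0 : R[i])) ->
  c 0%N = 0.
Proof.
move=> d0 cs.
have d2 : 0 < d / 2 by rewrite divr_gt0.
have [|K K0 cK] := @series_terms_bounded (fun k => c k * (- (d / 2)%:C) ^+ k).
  by apply/cvg_ex; exists 0; apply: cs; rewrite d2 ltr_pdivrMr// ltr_pMr// ltr1n.
have rN (s : R) : 0 <= s -> rnorm (- s%:C : R[i]) = s.
  by move=> s0; rewrite rnormN rnorm_real.
have c0s (s : R) : 0 < s -> s < d / 4 -> rnorm (c 0%N) <= s * (4 * K / d).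
  move=> s0 sd; have s' : 0 < s < d.
    rewrite s0 (lt_trans sd)// ltr_pdivrMr// ltr_pMr//.
    by rewrite ltr1n.
  pose q := s / (d / 2).
  have q0 : 0 <= q by rewrite divr_ge0// ltW.
  have q2 : q <= 2^-1.
    rewrite ler_pdivrMr//; apply: ltW; apply: (lt_le_trans sd).
    by rewrite le_eqVlt; apply/orP; left; apply/eqP; field.
  have sq : s * (4 * K / d) = K * q * 2.
    by rewrite /q; field; exact: lt0r_neq0.
  have /series_shift := cs _ s' => /series_rnorm_le.
  rewrite expr0 mulr1 sub0r rnormN; apply => n.
  rewrite sq; apply: (@le_trans _ _ (K * q * \sum_(0 <= k < n) q ^+ k)).
    rewrite mulr_sumr; apply: ler_sum => k _.
    rewrite rnormM rnormX rN ?(ltW s0)// -mulrA -exprS.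
    have := ler_wpM2r (exprn_ge0 k.+1 q0) (cK k.+1).
    rewrite /= rnormM rnormX rN ?(ltW d2)// -mulrA -exprMn.
    by rewrite /q [d / 2 * _]mulrC divfK ?lt0r_neq0.
  have Kq : 0 <= K * q by rewrite mulr_ge0// ltW.
  rewrite ler_wpM2l//.
  apply: (le_trans (geo_sum_le _ _)).
    by rewrite q0 (le_lt_trans q2)// invf_lt1 ?ltr1n.
  rewrite -[leRHS]invrK lef_pV2 ?posrE ?invr_gt0//.
    by lra.
  by rewrite subr_gt0 (le_lt_trans q2)// invf_lt1 ?ltr1n.
apply/rnorm0_eq0/eqP; rewrite eq_le rnorm_ge0 andbT.
apply/ler_addgt0Pr => e e0; rewrite add0r.
pose s := Num.min (d / 8) (e / (4 * K / d)).
have Kd : 0 < 4 * K / d by rewrite divr_gt0// mulr_gt0.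
have s0 : 0 < s by rewrite lt_min divr_gt0//= divr_gt0.
apply: (le_trans (c0s s s0 _)).
  have : s <= d / 8 by rewrite ge_min lexx.
  by move: d0; clear; lra.
by rewrite -ler_pdivlMr// ge_min lexx orbT.
Qed.

(** A power series vanishing at small negative numbers has no coefficient:
    the first one is the limit at the origin, and the others follow after
    division by the variable. *)
Lemma power_series_eq0 (d : R) (c : nat -> R[i]) : 0 < d ->
  (forall s : R, 0 < s < d ->
    series (fun k => c k * (- s%:C) ^+ k) @ \oo --> (0 : R[i])) ->
  forall k, c k = 0.
Proof.
move=> d0 + k; elim: k c => [|k IHk] c c0; first exact: (power_series_coef0 d0).
have c00 := power_series_coef0 d0 c0.
apply: (IHk (fun k => c k.+1)) => s sd; have s0 : - s%:C != 0 :> R[i].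
  by rewrite oppr_eq0; apply/negP => /eqP/complexI s0; move: sd; rewrite s0 ltxx.
have /series_shift/(seriesZ (- s%:C)^-1) := c0 _ sd.
rewrite c00 mul0r subr0 mulr0.
rewrite (_ : (fun k => _) = fun k => c k.+1 * (- s%:C) ^+ k)//.
by apply/funext => j; rewrite exprS mulrCA mulKf.
Qed.

End series.

Arguments seriesZ {R c} a {l}.

(** ** Power series on a complex line *)

Section line_derivative.
Context {R : realType}.

(** Divided by [h], this is the error made in replacing the difference quotient
    of [z ^+ k] by its derivative. The recursion [binom_remS] has nonnegative
    coefficients, so the remainder at complex arguments is dominated by the
    remainder at their moduli. *)
Definition binom_rem (T : comNzRingType) (z h : T) (k : nat) : T :=
  (z + h) ^+ k - z ^+ k - k%:R * z ^+ k.-1 * h.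

Lemma binom_rem0 (T : comNzRingType) (z h : T) : binom_rem z h 0 = 0.
Proof. by rewrite /binom_rem !expr0 subrr !mul0r subrr. Qed.

Lemma binom_remS (T : comNzRingType) (z h : T) k :
  binom_rem z h k.+1 =
  (z + h) * binom_rem z h k + k%:R * z ^+ k.-1 * h ^+ 2.
Proof.
rewrite /binom_rem; case: k => [|k] /=.
  by rewrite !expr0 !expr1; ring.
by rewrite -!natr1 !exprS; ring.
Qed.

Lemma binom_rem_ge0 (x e : R) k : 0 <= x -> 0 <= e -> 0 <= binom_rem x e k.
Proof.
move=> x0 e0; elim: k => [|k IHk]; first by rewrite binom_rem0.
rewrite binom_remS; apply: addr_ge0; first by rewrite mulr_ge0// addr_ge0.
by rewrite !mulr_ge0// exprn_ge0.
Qed.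

Lemma binom_rem_le (x e : R) k : 0 <= x -> 0 <= e ->
  binom_rem x e k <= (x + e) ^+ k.
Proof.
move=> x0 e0; rewrite /binom_rem -addrA gerDl subr_le0.
rewrite (@le_trans _ _ 0)// ?mulr_ge0 ?exprn_ge0// oppr_le0.
exact: exprn_ge0.
Qed.

Lemma binom_linear_le (x e : R) k : 0 <= x -> 0 <= e ->
  k%:R * x ^+ k.-1 * e <= (x + e) ^+ k.
Proof.
move=> x0 e0; have := binom_rem_ge0 k x0 e0; rewrite /binom_rem subr_ge0.
by move=> /le_trans; apply; rewrite gerBl exprn_ge0.
Qed.

Lemma rnorm_binom_rem (z h : R[i]) (e : R) k : 0 < e -> rnorm h <= e ->
  rnorm (binom_rem z h k) <= (rnorm h / e) ^+ 2 * (rnorm z + e) ^+ k.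
Proof.
move=> e0 he.
apply: (@le_trans _ _ ((rnorm h / e) ^+ 2 * binom_rem (rnorm z) e k)); last first.
  by rewrite ler_wpM2l ?sqr_ge0// binom_rem_le ?rnorm_ge0// ltW.
elim: k => [|k IHk]; first by rewrite !binom_rem0 rnorm0 mulr0.
rewrite !binom_remS [leRHS]mulrDr (le_trans (rnormD _ _))// lerD//.
  rewrite rnormM mulrCA ler_pM ?rnorm_ge0//.
  by rewrite (le_trans (rnormD _ _))// lerD2l.
rewrite !rnormM !rnormX rnorm_nat le_eqVlt; apply/orP; left; apply/eqP.
by field; exact: lt0r_neq0.
Qed.

Context {E : normedModType R[i]}.
Implicit Types (f : E -> R[i]) (c : nat -> R[i]).

(** [f] is given on a disc of the complex line through [a] in the direction
    [x] by the power series of coefficients [c]. *)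
Definition line_series f (a x : E) c (rho : R) : Prop :=
  forall t : R[i], rnorm t < rho ->
    series (fun k => c k * t ^+ k) @ \oo --> (f (a + t *: x) : R[i]).

(** With [s] between [rnorm t] and [rho] the coefficients are [O(s ^- k)], and
    [rnorm_binom_rem] bounds the error in the difference quotient by [rnorm h]
    times a convergent geometric series. *)
Lemma line_series_derive f a x c rho (t : R[i]) : line_series f a x c rho ->
  rnorm t < rho ->
  derivable f (a + t *: x) x /\
  series (fun k => k.+1%:R * c k.+1 * t ^+ k) @ \oo -->
    ('D_x f (a + t *: x) : R[i]).
Proof.
move=> fc tr; have t0 := rnorm_ge0 t.
pose s := (rnorm t + rho) / 2; pose e := (s - rnorm t) / 2.
have ts : rnorm t < s by rewrite /s; lra.
have sr : s < rho by rewrite /s; lra.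
have e0 : 0 < e by rewrite /e; lra.
have ses : rnorm t + e < s by rewrite /e; lra.
have s0 : 0 < s by lra.
have er : rnorm t + e < rho by lra.
have rs : rnorm (s%:C : R[i]) = s by rewrite rnorm_real// ltW.
have [|K K0 cK] := @series_terms_bounded R (fun k => c k * s%:C ^+ k).
  by apply/cvg_ex; eexists; apply: fc; rewrite rs.
pose q := (rnorm t + e) / s.
have q01 : 0 <= q < 1.
  by rewrite divr_ge0 ?addr_ge0 ?(ltW e0) ?(ltW s0)//= ltr_pdivrMr// mul1r.
have q0 : 0 <= q by case/andP: q01.
have ck k : rnorm (c k) * (rnorm t + e) ^+ k <= K * q ^+ k.
  have := ler_wpM2r (exprn_ge0 k q0) (cK k).
  by rewrite /= rnormM rnormX rs -mulrA -exprMn /q mulrCA divff ?mulr1// lt0r_neq0.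
have geo : cvgn (series (fun k => K * q ^+ k)).
  apply: (@nneg_series_cvg _ _ (K * (1 - q)^-1)) => [k|n].
    by rewrite mulr_ge0 ?exprn_ge0// ltW.
  by rewrite -mulr_sumr ler_wpM2l ?(ltW K0)// geo_sum_le.
pose d k := k.+1%:R * c k.+1 * t ^+ k.
have dle k : rnorm (d k) <= e^-1 * K * q ^+ k.+1.
  rewrite /d !rnormM rnormX rnorm_nat -[leRHS]mulrA ler_pdivlMl//.
  apply: le_trans (ck k.+1).
  rewrite (_ : e * _ = rnorm (c k.+1) * (k.+1%:R * rnorm t ^+ k * e)); last by ring.
  by rewrite ler_wpM2l ?rnorm_ge0//; exact: (binom_linear_le k.+1 t0 (ltW e0)).
have [D dD] : exists D : R[i], series d @ \oo --> D.
  apply/cvg_ex; apply: (series_comparison dle).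
  apply: (@nneg_series_cvg _ _ (e^-1 * K * (1 - q)^-1)) => [k|n].
    by rewrite !mulr_ge0 ?exprn_ge0 ?invr_ge0// ltW.
  rewrite -mulr_sumr ler_wpM2l ?mulr_ge0 ?invr_ge0 ?(ltW e0) ?(ltW K0)//.
  rewrite (le_trans _ (geo_sum_le n.+1 q01))// [leRHS]big_nat_recl//=.
  by rewrite lerDr expr0.
suff fD : (fun h : R[i] => h^-1 *: (f (h *: x + (a + t *: x)) - f (a + t *: x)))
    @ 0^' --> D.
  split; first by apply/cvg_ex; exists D.
  rewrite (_ : 'D_x f (a + t *: x) = D)//.
  by apply: cvg_lim => //; exact: norm_hausdorff.
(* the constant in the [O(h)] bound on the error of the difference quotient *)
pose L := e^-2 * K * (1 - q)^-1.
have L0 : 0 < L.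
  rewrite !mulr_gt0 ?invr_gt0 ?exprn_gt0// subr_gt0.
  by case/andP: q01.
have main (h : R[i]) : h != 0 -> rnorm h < e ->
    rnorm (h^-1 *: (f (h *: x + (a + t *: x)) - f (a + t *: x)) - D) <=
    rnorm h * L.
  move=> hn0 he.
  have thr : rnorm (t + h) < rho by rewrite (le_lt_trans (rnormD _ _))//; lra.
  have dD' : series (fun k => c k * (k%:R * t ^+ k.-1)) @ \oo --> D.
    apply/series_shift; rewrite mul0r mulr0 subr0.
    rewrite (_ : (fun k => _) = d)//.
    by apply/funext => k; rewrite /d /= mulrCA mulrA.
  have := seriesD (seriesZ h^-1 (seriesD (fc _ thr) (seriesZ (-1) (fc _ tr))))
    (seriesZ (-1) dD').
  rewrite !mulN1r => /series_rnorm_le.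
  have -> : h *: x + (a + t *: x) = a + (t + h) *: x.
    by rewrite addrCA scalerDl [t *: x + _]addrC.
  apply => n.
  have termE k : rnorm (h^-1 * (c k * (t + h) ^+ k + -1 * (c k * t ^+ k)) +
      -1 * (c k * (k%:R * t ^+ k.-1))) <= rnorm h * (e^-2 * (K * q ^+ k)).
    have -> : h^-1 * (c k * (t + h) ^+ k + -1 * (c k * t ^+ k)) +
      -1 * (c k * (k%:R * t ^+ k.-1)) = h^-1 * (c k * binom_rem t h k).
      by rewrite /binom_rem; field.
    rewrite !rnormM; apply: (@le_trans _ _ (rnorm h^-1 *
        ((rnorm h / e) ^+ 2 * (rnorm (c k) * (rnorm t + e) ^+ k)))).
      rewrite ler_wpM2l ?rnorm_ge0// mulrCA ler_wpM2l ?rnorm_ge0//.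
      by rewrite rnorm_binom_rem// ltW.
    rewrite mulrA; have -> : rnorm h^-1 * (rnorm h / e) ^+ 2 = rnorm h * e^-2.
      have nh : rnorm h != 0 by apply: contra_neq hn0 => /rnorm0_eq0.
      have -> : rnorm h^-1 = (rnorm h)^-1.
        by apply: (mulIf nh); rewrite -rnormM mulVf// rnorm1 mulVf.
      by field; rewrite nh lt0r_neq0.
    rewrite -mulrA ler_wpM2l ?rnorm_ge0// ler_wpM2l//.
    by rewrite invr_ge0 exprn_ge0// ltW.
  apply: (le_trans (ler_sum _ (fun k _ => termE k))).
  rewrite -!mulr_sumr ler_wpM2l ?rnorm_ge0// /L -mulrA ler_wpM2l//.
    by rewrite invr_ge0 exprn_ge0// ltW.
  by rewrite ler_wpM2l ?(ltW K0)// geo_sum_le.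
apply/cvg_rnormP => z z0.
have m0 : 0 < Num.min e (z / L) by rewrite lt_min e0 divr_gt0.
have m0c : (0 : R[i]) < (Num.min e (z / L))%:C by rewrite ltcR.
exists (Num.min e (z / L))%:C => //= h.
rewrite /ball_/= sub0r normrN rnormE ltcR lt_min => /andP[he hz] hn0.
apply: (le_lt_trans (main h hn0 he)).
by rewrite -ltr_pdivlMr.
Qed.

Lemma line_series_iter_derive f a x c rho n (t : R[i]) : line_series f a x c rho ->
  rnorm t < rho ->
  series (fun k => ((n + k) ^_ n)%:R * c (n + k)%N * t ^+ k) @ \oo -->
    (iter n (fun g : E -> R[i] => 'D_x g) f (a + t *: x) : R[i]).
Proof.
move=> fc; elim: n t => [|n IHn] t tr.
  have := fc _ tr; rewrite (_ : (fun k => _) =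
    fun k => ((0 + k) ^_ 0)%:R * c (0 + k)%N * t ^+ k)//.
  by apply/funext => k; rewrite ffactn0 mul1r.
have [_] := line_series_derive IHn tr.
rewrite (_ : (fun k => _) =
  fun k => ((n.+1 + k) ^_ n.+1)%:R * c (n.+1 + k)%N * t ^+ k)//.
apply/funext => k; rewrite addSnnS; congr (_ * _); rewrite mulrA -natrM.
by rewrite ffactnSr addKn mulnC.
Qed.

Lemma line_series_taylor f x c rho n : 0 < rho -> line_series f 0 x c rho ->
  taylor_coef n f x = c n.
Proof.
move=> r0 fc; rewrite /taylor_coef.
have := @line_series_iter_derive _ _ _ _ _ n 0 fc.
rewrite rnorm0 scale0r addr0 => /(_ r0)/series_shift.
rewrite expr0 addn0 mulr1 ffactnn => h.
have : series (fun k => ((n + k.+1) ^_ n)%:R * c (n + k.+1)%N * 0 ^+ k.+1)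
    @ \oo --> (0 : R[i]).
  rewrite (_ : series _ = fun=> 0); first exact: cvgn_cst.
  apply/funext => m; rewrite /series/= big1// => k _.
  by rewrite exprS mul0r mulr0.
move=> /(cvgn_unique h)/eqP; rewrite subr_eq0 => /eqP ->.
by rewrite mulKf// pnatr_eq0 -lt0n fact_gt0.
Qed.

Lemma entire_line f a : entire f -> exists P : nat -> E -> R[i],
  (forall m, hpolynomial m (P m)) /\ exists2 r : R, 0 < r &
    forall x, rnorm x < r -> series (fun k => P k x) @ \oo --> (f (a + x) : R[i]).
Proof.
move=> /(_ a)[P [hP [r r0 fP]]]; exists P; split=> //; exists r => // x xr.
apply/cvgn_rnormP => e e0; apply: filterS (fP e e0) => n /(_ (a + x)).
rewrite (_ : a + x - a = x); last by rewrite addrAC subrr add0r.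
by rewrite rnormC /series/= big_mkord; apply.
Qed.

(** Identity theorem: on a half line issued from the origin, the expansion at
    the last point before which [f] vanishes must be zero. *)
Lemma entire_eq0 f rho : entire f -> 0 < rho ->
  (forall x, rnorm x < rho -> f x = 0) -> forall x, f x = 0.
Proof.
move=> ef r0 f0 x; apply/eqP/negPn/negP => /eqP fx.
have x1 : 0 < rnorm x + 1 by rewrite ltr_wpDl ?rnorm_ge0.
have scx (s r : R) : 0 <= s -> s < r / (rnorm x + 1) -> rnorm (s%:C *: x) < r.
  move=> s0; rewrite ltr_pdivlMr// rnormZ rnorm_real// => h.
  by apply: le_lt_trans h; rewrite ler_wpM2l// lerDl.
(* the initial segments of the half line on which [f] vanishes *)
pose Z := [set t : R | 0 <= t /\ forall s, 0 <= s <= t -> f (s%:C *: x) = 0].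
have Zub t : Z t -> t <= 1.
  move=> [t0 Zt]; rewrite leNgt; apply/negP => t1; apply: fx.
  by have := Zt 1; rewrite ler01 (ltW t1) scale1r; apply.
have Zsup : has_sup Z.
  split; last by exists 1 => t; exact: Zub.
  by exists 0; split=> // s; rewrite -eq_le => /eqP <-; rewrite scale0r f0// rnorm0.
have Zlt s : 0 <= s -> s < sup Z -> f (s%:C *: x) = 0.
  move=> s0 sZ; have d0 : 0 < sup Z - s by rewrite subr_gt0.
  have [t [_ Zt]] := sup_adherent d0 Zsup.
  by rewrite subKr => st; apply: Zt; rewrite s0 ltW.
have Z0 : 0 < sup Z.
  have h : 0 < rho / (rnorm x + 1) / 2 by rewrite !divr_gt0.
  apply: (lt_le_trans h); apply: sup_upper_bound => //; split; first exact: ltW.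
  move=> s /andP[s0 sh]; apply: f0; apply: scx => //.
  by apply: (le_lt_trans sh); rewrite ltr_pdivrMr// ltr_pMr ?divr_gt0// ltr1n.
have [P [hP [r rr fP]]] := entire_line ((sup Z)%:C *: x) ef.
have P0 k : P k x = 0.
  pose d := Num.min (sup Z) (r / (rnorm x + 1)).
  have d0 : 0 < d by rewrite lt_min Z0 divr_gt0.
  apply: (@power_series_eq0 _ d (fun k => P k x) d0) => s /andP[s0]; rewrite lt_min => /andP[sZ sr].
  have := fP (- s%:C *: x); rewrite scaleNr rnormN => /(_ (scx _ _ (ltW s0) sr)).
  rewrite -scalerBl -rmorphB/= Zlt; last 2 first.
  - by rewrite subr_ge0 ltW.
  - by rewrite gtrBl.
  rewrite (_ : (fun k => _) = fun k => P k x * (- s%:C) ^+ k)//.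
  by apply/funext => m; rewrite -scaleNr (hpolynomialZ _ _ (hP m)) mulrC.
pose e := r / (rnorm x + 1) / 2.
have e0 : 0 < e by rewrite !divr_gt0.
have : Z (sup Z + e).
  split=> [|s /andP[s0 se]]; first by rewrite addr_ge0 ?ltW.
  have [/Zlt->//|Zs] := ltP s (sup Z).
  have sZ0 : 0 <= s - sup Z by rewrite subr_ge0.
  have := fP ((s - sup Z)%:C *: x); rewrite -scalerDl -rmorphD/= subrKC.
  have -> : series (fun k => P k ((s - sup Z)%:C *: x)) = fun=> 0.
    apply/funext => n; rewrite /series/= big1// => k _.
    by rewrite (hpolynomialZ _ _ (hP k)) P0 mulr0.
  move=> h; apply: (cvgn_unique (h _) (@cvgn_cst _ 0)); apply: scx => //.
  rewrite (@le_lt_trans _ _ e)// ?lerBlDl//.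
  by rewrite ltr_pdivrMr// ltr_pMr ?divr_gt0// ltr1n.
move=> /(sup_upper_bound Zsup).
by rewrite gerDl leNgt e0.
Qed.

End line_derivative.

(** * Rapidly decreasing sequences *)

Section rapid.
Context {R : realType}.
Implicit Types (a b : nat -> R).

(** For nonnegative sequences this says that the power series with
    coefficients [a] has infinite radius of convergence; see [rapid_root] for
    the link with the limit of the [k]-th roots. *)
Definition rapid a : Prop :=
  forall r : R, 0 < r -> exists K, forall k, a k * r ^+ k <= K.

Lemma eventually_bounded b (M : R) : (forall k, 0 <= b k) ->
  (\forall k \near \oo, b k <= M) -> exists K, forall k, b k <= K.
Proof.
move=> b0 [N _ bM]; exists (`|M| + \sum_(0 <= k < N) b k) => k.
have s0 : 0 <= \sum_(0 <= k < N) b k by rewrite sumr_ge0.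
have [Nk|kN] := leqP N k.
  rewrite (le_trans (bM _ Nk))// (le_trans (ler_norm _))//.
  by rewrite lerDl.
rewrite (@le_trans _ _ (\sum_(0 <= k < N) b k))// ?lerDr//.
by rewrite big_mkord (bigD1 (Ordinal kN))//= lerDl sumr_ge0.
Qed.

(** A bound on [a k * (2 * r) ^+ k] leaves a factor [2 ^- k] to sum. *)
Lemma rapid_series_cvg a r : (forall k, 0 <= a k) -> rapid a -> 0 < r ->
  cvgn (series (fun k => a k * r ^+ k)).
Proof.
move=> a0 ra r0; have r2 : 0 < 2 * r by rewrite mulr_gt0.
have [K aK] := ra _ r2.
have K0 : 0 <= K by have := aK 0%N; rewrite expr0 mulr1; exact: le_trans.
have h2 : 0 <= (2^-1 : R) < 1 by apply/andP; split; lra.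
apply: (@nneg_series_cvg _ _ (K * (1 - 2^-1)^-1)) => [k|n].
  by rewrite mulr_ge0// exprn_ge0// ltW.
apply: (@le_trans _ _ (\sum_(0 <= k < n) K * 2^-1 ^+ k)); last first.
  by rewrite -mulr_sumr ler_wpM2l// geo_sum_le.
apply: ler_sum => k _; rewrite exprVn ler_pdivlMr ?exprn_gt0//.
by rewrite -mulrA -exprMn mulrC [r * 2]mulrC mulrC.
Qed.

(** From right to left, a bound [K] on [a k * (4 / e) ^+ k] gives
    [a k <= (e / 2) ^+ k] as soon as [K < 2 ^+ k]. *)
Lemma rapid_root a : (forall k, 0 <= a k) ->
  ((a k `^ k%:R^-1) @[k --> \oo] --> (0 : R)) <-> rapid a.
Proof.
move=> a0; split=> [ra r r0|ra].
  apply: (@eventually_bounded _ 1) => [k|].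
    by rewrite mulr_ge0 ?exprn_ge0// ltW.
  have r1 : 0 < r^-1 by rewrite invr_gt0.
  move/cvgrPdist_lt: ra => /(_ _ r1); apply: filter_app.
  exists 1%N => // k /= k1; rewrite sub0r normrN ger0_norm ?powR_ge0// => h.
  rewrite -ler_pdivlMr ?exprn_gt0// mul1r -exprVn.
  have -> : a k = (a k `^ k%:R^-1) ^+ k.
    rewrite -powR_mulrn ?powR_ge0// -powRrM mulVf ?pnatr_eq0 -?lt0n//.
    by rewrite powRr1.
  by rewrite lerXn2r ?nnegrE ?powR_ge0 ?ltW.
apply/cvgrPdist_lt => e e0.
have e4 : 0 < 4 / e by rewrite divr_gt0.
have [K aK] := ra _ e4.
have : \forall k \near \oo, K < 2 ^+ k.
  have [N KN] : exists N : nat, K < N%:R.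
    by exists (Num.truncn `|K|).+1; rewrite (le_lt_trans (ler_norm _))// truncnS_gt.
  exists N => // k /= Nk; apply: (lt_le_trans KN).
  by rewrite -natrX ler_nat (leq_trans Nk)// ltnW// ltn_expl.
apply: filter_app; exists 1%N => // k /= k1 Kk.
rewrite sub0r normrN ger0_norm ?powR_ge0//.
apply: (@le_lt_trans _ _ (e / 2)); last by rewrite ltr_pdivrMr// ltr_pMr// ltr1n.
have -> : e / 2 = ((e / 2) ^+ k) `^ k%:R^-1.
  rewrite -powR_mulrn ?divr_ge0 ?(ltW e0)// -powRrM divff ?pnatr_eq0 -?lt0n//.
  by rewrite powRr1// divr_ge0// ltW.
apply: ge0_ler_powR; rewrite ?nnegrE ?invr_ge0 ?ler0n ?exprn_ge0 ?divr_ge0 ?(ltW e0)//.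
have -> : e / 2 = 2 / (4 / e) by field; exact: lt0r_neq0.
rewrite exprMn exprVn ler_pdivlMr ?exprn_gt0//.
by rewrite (le_trans (aK k))// ltW.
Qed.

Lemma rapid_le a b : (forall k, a k <= b k) -> rapid b -> rapid a.
Proof.
move=> ab rb r r0; have [K bK] := rb _ r0; exists K => k.
by rewrite (le_trans _ (bK k))// ler_wpM2r// exprn_ge0// ltW.
Qed.

Lemma rapidZ a (c : R) : (forall k, 0 <= a k) -> rapid a ->
  rapid (fun k => c * a k).
Proof.
move=> a0 ra r r0; have [K aK] := ra _ r0; exists (`|c| * K) => k.
rewrite -mulrA (@le_trans _ _ (`|c| * (a k * r ^+ k)))//.
  by rewrite ler_wpM2r ?ler_norm// mulr_ge0// exprn_ge0// ltW.
by rewrite ler_wpM2l.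
Qed.

Lemma rapidD a b : rapid a -> rapid b -> rapid (fun k => a k + b k).
Proof.
move=> ra rb r r0; have [K aK] := ra _ r0; have [L bL] := rb _ r0.
by exists (K + L) => k; rewrite mulrDl lerD.
Qed.

Lemma rapid_exp a (c : R) : 0 < c -> rapid a -> rapid (fun k => c ^+ k * a k).
Proof.
move=> c0 ra r r0; have cr : 0 < c * r by rewrite mulr_gt0.
by have [K aK] := ra _ cr; exists K => k; rewrite mulrAC -exprMn mulrC.
Qed.

(** The estimate behind differentiation term by term. *)
Lemma natS_exp_le (r : R) k : 0 <= r -> k.+1%:R * r ^+ k <= (r + 1) ^+ k.+1.
Proof.
move=> r0; have := @binom_linear_le _ r 1 k.+1 r0 ler01.
by rewrite mulr1.
Qed.

Lemma rapid_shift a : (forall k, 0 <= a k) -> rapid a ->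
  rapid (fun k => k.+1%:R * a k.+1).
Proof.
move=> a0 ra r r0; have r1 : 0 < r + 1 by rewrite ltr_wpDr.
have [K aK] := ra _ r1; exists K => k.
rewrite mulrAC mulrC (le_trans _ (aK k.+1))// ler_wpM2l//.
by rewrite natS_exp_le// ltW.
Qed.

(** The terms of the product of two series decay geometrically if those of the
    factors do: the number of terms in each convolution is only linear. *)
Lemma rapid_conv a b : (forall k, 0 <= a k) -> (forall k, 0 <= b k) ->
  rapid a -> rapid b -> rapid (fun n => \sum_(i < n.+1) a i * b (n - i)%N).
Proof.
move=> a0 b0 ra rb r r0; have r2 : 0 < 2 * r by rewrite mulr_gt0.
have [K aK] := ra _ r2; have [L bL] := rb _ r2; exists (2 * (K * L)) => n.
have K0 : 0 <= K by have := aK 0%N; rewrite expr0 mulr1; exact: le_trans.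
have L0 : 0 <= L by have := bL 0%N; rewrite expr0 mulr1; exact: le_trans.
have h : 2 ^+ n * (\sum_(i < n.+1) a i * b (n - i)%N * r ^+ n) <=
    n.+1%:R * (K * L).
  rewrite mulr_sumr; apply: (@le_trans _ _ (\sum_(i < n.+1) K * L)).
    apply: ler_sum => i _.
    have -> : 2 ^+ n * (a i * b (n - i)%N * r ^+ n) =
        (a i * (2 * r) ^+ i) * (b (n - i)%N * (2 * r) ^+ (n - i)).
      have iE : (2 * r) ^+ n = (2 * r) ^+ i * (2 * r) ^+ (n - i).
        by rewrite -exprD subnKC// -ltnS.
      transitivity (a i * b (n - i)%N * (2 * r) ^+ n); first by rewrite exprMn; ring.
      by rewrite iE; ring.
    by rewrite ler_pM// mulr_ge0// exprn_ge0// ltW.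
  by rewrite sumr_const card_ord mulr_natl.
rewrite mulr_suml -(@ler_pM2l _ (2 ^+ n)) ?exprn_gt0// (le_trans h)//.
rewrite [leRHS]mulrA ler_wpM2r ?mulr_ge0// -exprSr -natrX ler_nat.
by rewrite ltnW// ltn_expl.
Qed.

End rapid.

(** * Entire functions given by their Taylor series *)

Section taylor_series.
Context {R : realType}.
Local Notation banachType := (completeNormedModType R[i]).
Variables (A : polynomial_classes R) (iA : ideal_sequence A).
Variables (C : R) (C1 : 1 <= C) (slA : slice_bounded A C).
Variable E : banachType.
Implicit Types (P Q : nat -> E -> R[i]).

Let C0 : 0 <= C. Proof. exact: le_trans C1. Qed.

(** The sequences of Taylor coefficients of the elements of [Hb A]. *)
Definition gseq P : Prop :=
  (forall k, gmem A k (P k)) /\ rapid (fun k => gnorm A k (P k)).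

Definition psum P (x : E) : R[i] := limn (series (fun k => P k x)).

Lemma gnorm_ge0 k (p : E -> R[i]) : gmem A k p -> 0 <= gnorm A k p.
Proof. exact: (bs_norm_ge0 (gbanach _ _ iA)). Qed.

Lemma gseq_ge0 P k : gseq P -> 0 <= gnorm A k (P k).
Proof. by move=> [gP _]; exact: gnorm_ge0. Qed.

Lemma gseq_series_cvg P r : gseq P -> 0 < r ->
  cvgn (series (fun k => gnorm A k (P k) * r ^+ k)).
Proof. by move=> gP; apply: rapid_series_cvg => [k|]; [exact: gseq_ge0|case: gP]. Qed.

Lemma gseq_eval_le P k x (r : R) : gseq P -> rnorm x <= r ->
  rnorm (P k x) <= gnorm A k (P k) * r ^+ k.
Proof.
move=> gP xr; rewrite (le_trans (geval x iA (gP.1 k)))//.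
rewrite ler_wpM2l ?gseq_ge0// lerXn2r// nnegrE ?rnorm_ge0//.
by rewrite (le_trans _ xr)// rnorm_ge0.
Qed.

Lemma psum_cvg P x : gseq P ->
  series (fun k => P k x) @ \oo --> (psum P x : R[i]).
Proof.
move=> gP; have r0 : 0 < rnorm x + 1 by rewrite ltr_wpDl ?rnorm_ge0.
have : cvgn (series (fun k => P k x)).
  apply: (series_comparison _ (gseq_series_cvg gP r0)) => k.
  by apply: gseq_eval_le => //; rewrite lerDl.
by [].
Qed.

#[local] Arguments psum_cvg {P} x gP.

Lemma psumE P x (l : R[i]) : gseq P ->
  series (fun k => P k x) @ \oo --> l -> psum P x = l.
Proof. by move=> gP; apply: cvgn_unique; exact: psum_cvg. Qed.

Lemma gseqD c P Q : gseq P -> gseq Q -> gseq (fun k => c *: P k + Q k).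
Proof.
move=> gP gQ; split=> [k|].
  by apply: (bs_memDZ (gbanach _ _ iA)); [exact: gP.1|exact: gQ.1].
apply: (@rapid_le _ _ (fun k => rnorm c * gnorm A k (P k) + gnorm A k (Q k))).
  move=> k; have gPk := gP.1 k; have gQk := gQ.1 k.
  rewrite (le_trans (bs_normD (gbanach _ _ iA) _ gQk))//.
    exact: (bs_memZ (gbanach _ _ iA)).
  by rewrite (bs_normZ (gbanach _ _ iA)).
apply: rapidD; last exact: gQ.2.
by apply: rapidZ; [move=> k; exact: gseq_ge0|exact: gP.2].
Qed.

Lemma psumD c P Q : gseq P -> gseq Q ->
  psum (fun k => c *: P k + Q k) = c *: psum P + psum Q.
Proof.
move=> gP gQ; apply/funext => x; apply: psumE; first exact: gseqD.
change (series (fun k => c * P k x + Q k x) @ \oo -->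
  (c * psum P x + psum Q x : R[i])).
exact: (seriesD (seriesZ c (psum_cvg x gP)) (psum_cvg x gQ)).
Qed.

Definition single n (p : E -> R[i]) : nat -> E -> R[i] :=
  fun k => if k == n then p else 0.

Lemma single_gseq n p : gmem A n p -> gseq (single n p).
Proof.
move=> np; split=> [k|r r0].
  by rewrite /single; case: eqP => [->//|_]; exact: (bs_mem0 (gbanach _ _ iA)).
exists (gnorm A n p * r ^+ n) => k; rewrite /single.
case: eqP => [->//|_]; rewrite (bs_norm0 (gbanach _ _ iA)) mul0r.
by rewrite mulr_ge0 ?gnorm_ge0// exprn_ge0// ltW.
Qed.

Lemma psum_single n p : psum (single n p) = p.
Proof.
apply/funext => x; apply: cvg_lim; first exact: norm_hausdorff.
apply/cvgn_rnormP => e e0; exists n.+1 => // m /= nm.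
rewrite /series/= big_mkord (bigD1 (Ordinal nm))//= /single eqxx big1.
  by rewrite addr0 subrr rnorm0.
move=> k kn; case: eqP => // kE.
by move: kn; rewrite -(inj_eq val_inj)/= kE eqxx.
Qed.

(** ** Expansion around an arbitrary point *)

(** [nslice n k p a] has degree [k] when [p] has degree [n + k]. *)
Fixpoint nslice n k (p : E -> R[i]) (a : E) : E -> R[i] :=
  if n is m.+1 then nslice m k (polar_slice (m + k) p a) a else p.

Lemma nslice_bounded n k p a : gmem A (n + k) p ->
  gmem A k (nslice n k p a) /\
  gnorm A k (nslice n k p a) <= gnorm A (n + k) p * (C * rnorm a) ^+ n.
Proof.
elim: n p => [|n IHn] p np /=; first by rewrite expr0 mulr1.
have [h1 h2] := slA a np; have [h3 h4] := IHn _ h1; split=> //.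
rewrite (le_trans h4)// exprS mulrA ler_wpM2r//.
  by rewrite exprn_ge0// mulr_ge0// rnorm_ge0.
by rewrite (le_trans h2)// mulrA [C * _]mulrC.
Qed.

(** Slices commute because the polar form is symmetric. *)
Lemma nslice_slice n k p a b : gmem A (n + k).+1 p ->
  nslice n k (polar_slice (n + k) p b) a =
  polar_slice k (nslice n k.+1 p a) b.
Proof.
elim: n p => [//|n IHn] p np /=.
have hp := gmem_hpolynomial iA np.
rewrite polar_sliceC// addnS IHn//.
by have [] := slA a np.
Qed.

Lemma nslice_diag n p a x : gmem A n p -> nslice n 0 p a x = p a.
Proof.
elim: n p => [|n IHn] p np /=; first by case: np => c ->.
rewrite !addn0 in np *; have [h _] := slA a np.
by rewrite IHn// polar_slice_diag//; exact: gmem_hpolynomial np.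
Qed.

(** Induction on the degree, slicing once more [p (a + h)] as
    [polar_slice k p (a + h) (a + h)] and splitting the first [a + h]; the two
    sums recombine by Pascal's rule. *)
Lemma homogeneous_expansion k p a h : gmem A k p ->
  p (a + h) = \sum_(j < k.+1) 'C(k, j)%:R * nslice (k - j) j p a h.
Proof.
elim: k p => [|k IHk] p kp.
  by rewrite big_ord_recl big_ord0 bin0 mul1r addr0 /=; case: kp => c ->.
have hp := gmem_hpolynomial iA kp.
rewrite -(polar_slice_diag (a + h) hp).
have := polar_slice_linear 1 a h hp; rewrite !scale1r => ->.
rewrite [LHS]/(polar_slice k p a (a + h) + polar_slice k p h (a + h)).
have [ka _] := slA a kp; have [kh _] := slA h kp.
rewrite (IHk _ ka) (IHk _ kh).
pose X j := nslice (k.+1 - j) j p a h.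
have XE (j : 'I_k.+1) : nslice (k - j) j (polar_slice k p a) a h = X j.
  have jk : (j <= k)%N by rewrite -ltnS.
  by rewrite /X subSn//= subnK.
have XES (j : 'I_k.+1) : nslice (k - j) j (polar_slice k p h) a h = X j.+1.
  have jk : (j <= k)%N by rewrite -ltnS.
  have := @nslice_slice (k - j) j p a h; rewrite subnK// => ->//.
  rewrite polar_slice_diag//; apply: (gmem_hpolynomial iA).
  have := @nslice_bounded (k - j) j.+1 p a; rewrite addnS subnK// => -[]//.
transitivity (\sum_(j < k.+1) 'C(k, j)%:R * X j + \sum_(j < k.+1) 'C(k, j)%:R * X j.+1).
  by congr (_ + _); apply: eq_bigr => j _; rewrite ?XE ?XES.
transitivity (\sum_(j < k.+2) 'C(k.+1, j)%:R * X j); last by [].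
rewrite [RHS]big_ord_recl bin0.
have -> : \sum_(j < k.+1) 'C(k.+1, lift ord0 j)%:R * X (lift ord0 j) =
    \sum_(j < k.+1) 'C(k, j.+1)%:R * X j.+1 + \sum_(j < k.+1) 'C(k, j)%:R * X j.+1.
  by rewrite -big_split; apply: eq_bigr => j _; rewrite /= binS natrD mulrDl.
rewrite addrA; congr (_ + _); rewrite big_ord_recl bin0; congr (_ + _).
by rewrite [RHS]big_ord_recr/= bin_small// mul0r addr0.
Qed.

(** The contribution of the component of degree [k] to the component of
    degree [j] of the expansion around [a]. *)
Definition shifted P (a : E) (j k : nat) : E -> R[i] :=
  if (j <= k)%N then 'C(k, j)%:R *: nslice (k - j) j (P k) a else 0.

Lemma shifted_bounded P a j k : gseq P -> gmem A j (shifted P a j k) /\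
  gnorm A j (shifted P a j k) <=
    gnorm A k (P k) * ('C(k, j)%:R * (C * rnorm a) ^+ (k - j)).
Proof.
move=> gP; rewrite /shifted; have Ca : 0 <= C * rnorm a by rewrite mulr_ge0 ?rnorm_ge0.
case: leqP => jk; last first.
  split; first exact: (bs_mem0 (gbanach _ _ iA)).
  by rewrite (bs_norm0 (gbanach _ _ iA)) !mulr_ge0 ?gseq_ge0 ?exprn_ge0.
have := @nslice_bounded (k - j) j (P k) a; rewrite subnK// => /(_ (gP.1 k))[h1 h2].
split; first exact: (bs_memZ (gbanach _ _ iA)).
by rewrite (bs_normZ (gbanach _ _ iA))// rnorm_nat mulrCA ler_wpM2l.
Qed.

Lemma binomial_term_le (x y : R) k j : 0 <= x -> 0 <= y -> (j <= k)%N ->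
  'C(k, j)%:R * x ^+ (k - j) * y ^+ j <= (x + y) ^+ k.
Proof.
move=> x0 y0 jk; rewrite exprDn (bigD1 (Ordinal (jk : (j < k.+1)%N)))//=.
rewrite -mulrA mulr_natl lerDl sumr_ge0// => i _.
by rewrite mulrn_wge0// mulr_ge0// exprn_ge0.
Qed.

(** Completeness of the ideal norm, for normally convergent series. *)
Lemma banach_subspace_series (S : set (E -> R[i])) (N : (E -> R[i]) -> R)
    (u : nat -> E -> R[i]) (b : nat -> R) : banach_subspace S N ->
  (forall k, S (u k)) -> (forall k, N (u k) <= b k) -> cvgn (series b) ->
  exists2 l, S l & N (\sum_(k < n) u k - l) @[n --> \oo] --> 0.
Proof.
move=> SN Su Nu /cauchy_cvgP/cauchy_seriesP cau.
have [_ _ _ _ complete] := SN; apply: complete.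
  by move=> n; apply: (bs_mem_sum SN).
have NB m n : N (\sum_(k < m) u k - \sum_(k < n) u k) <=
    `|\sum_(m <= k < n) b k| + `|\sum_(n <= k < m) b k|.
  wlog mn : m n / (m <= n)%N => [hw|].
    have [/hw//|/ltnW/hw h] := leqP m n.
    have Sm p : S (\sum_(k < p) u k) by exact: (bs_mem_sum SN).
    rewrite -opprB (bs_normN SN); last exact: (bs_memB SN).
    by rewrite [leRHS]addrC.
  rewrite -(big_mkord xpredT u) -(big_mkord xpredT u).
  rewrite (big_cat_nat (n := m) (p := n))//= opprD addrA subrr sub0r.
  rewrite (bs_normN SN); last exact: (bs_mem_sum SN).
  rewrite (le_trans (bs_norm_sum SN _ _))// ler_wpDr//.
  by rewrite (le_trans (ler_sum _ (fun k _ => Nu k)))// ler_norm.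
move=> e e0; have e2 : 0 < e / 2 by rewrite divr_gt0.
have [[B D] [BN DN] BD] := cau _ e2.
exists (B `&` D, B `&` D); first by split; exact: filterI.
move=> [m n] [/= [Bm Dm] [Bn Dn]]; rewrite (le_lt_trans (NB m n))//.
by rewrite (splitr e) ltrD//; [exact: (BD (m, n))|exact: (BD (n, m))].
Qed.

Lemma gmem_sum_cvg j (u : nat -> E -> R[i]) l h : (forall k, gmem A j (u k)) ->
  gmem A j l -> gnorm A j (\sum_(k < n) u k - l) @[n --> \oo] --> 0 ->
  series (fun k => u k h) @ \oo --> (l h : R[i]).
Proof.
move=> gu gl ul; apply/cvgn_rnormP => e e0.
have h1 : 0 < rnorm h ^+ j + 1 by rewrite ltr_wpDl ?exprn_ge0 ?rnorm_ge0.
have e1 : 0 < e / (rnorm h ^+ j + 1) by rewrite divr_gt0.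
move/cvgrPdist_lt: ul => /(_ _ e1); apply: filterS => n.
rewrite sub0r normrN => hn.
have gS : gmem A j (\sum_(k < n) u k) by exact: (bs_mem_sum (gbanach _ _ iA)).
have -> : series (fun k => u k h) n - l h = (\sum_(k < n) u k - l) h.
  rewrite -[RHS]/((\sum_(k < n) u k) h - l h) /series/= big_mkord.
  by rewrite fct_sumE.
have gB := bs_memB (gbanach _ _ iA) gS gl.
rewrite (le_lt_trans (geval h iA gB))//.
apply: (@le_lt_trans _ _ (gnorm A j (\sum_(k < n) u k - l) * (rnorm h ^+ j + 1))).
  by rewrite ler_wpM2l ?gnorm_ge0// lerDl.
by rewrite -ltr_pdivlMr// (le_lt_trans (ler_norm _)).
Qed.

(** The components of the expansion around [a] converge in the ideal norms,
    because [nslice_bounded] and the binomial formula compare them with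
    [gnorm A k (P k) * (C * rnorm a + 1) ^+ k]. On the unit ball the part of
    degree at least [n] gains a factor [2 ^- n] when [1] is replaced by [2] in
    that bound; this holds for the partial sums over [k], where only finite sums
    are exchanged, and passes to the limit. *)
Lemma psum_expansion P a : gseq P -> exists Q, [/\ forall j, gmem A j (Q j),
  forall j h, series (fun k => shifted P a j k h) @ \oo --> (Q j h : R[i])
  & exists K : R, forall n h, rnorm h <= 1 ->
      rnorm (psum P (a + h) - \sum_(j < n) Q j h) <= K / 2 ^+ n].
Proof.
move=> gP; pose y := C * rnorm a.
have y0 : 0 <= y by rewrite mulr_ge0 ?rnorm_ge0.
have cvy r : 0 < r -> cvgn (series (fun k => gnorm A k (P k) * (y + r) ^+ k)).
  by move=> r0; apply: gseq_series_cvg => //; rewrite ltr_wpDl.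
have exQ j : exists q, gmem A j q /\
    gnorm A j (\sum_(k < n) shifted P a j k - q) @[n --> \oo] --> 0.
  have [|q q1 q2] := banach_subspace_series (gbanach E j iA)
    (fun k => (shifted_bounded a j k gP).1) _ (cvy _ ltr01); last by exists q.
  move=> k; have [_ /le_trans] := shifted_bounded a j k gP; apply.
  rewrite ler_wpM2l ?gseq_ge0//; have [jk|kj] := leqP j k.
    by have := @binomial_term_le y 1 k j y0 ler01 jk; rewrite expr1n mulr1.
  by rewrite bin_small// mul0r exprn_ge0// addr_ge0.
have [Q hQ] := choice exQ; exists Q; split=> [j|j h|]; first by case: (hQ j).
  case: (hQ j) => q1 q2; apply: gmem_sum_cvg q2 => // k.
  by case: (shifted_bounded a j k gP).
have Qcvg j h : series (fun k => shifted P a j k h) @ \oo --> (Q j h : R[i]).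
  case: (hQ j) => q1 q2; apply: gmem_sum_cvg q2 => // k.
  by case: (shifted_bounded a j k gP).
exists (limn (series (fun k => gnorm A k (P k) * (y + 2) ^+ k))) => n h h1.
pose d k := P k (a + h) + -1 * \sum_(j < n) shifted P a j k h.
have dcvg : series d @ \oo --> (psum P (a + h) + -1 * \sum_(j < n) Q j h : R[i]).
  apply: (seriesD (psum_cvg _ gP)); apply: seriesZ.
  elim: n {d} => [|n IHn].
    under eq_fun do rewrite big_ord0; rewrite big_ord0.
    rewrite (_ : series _ = fun=> 0); first exact: cvgn_cst.
    by apply/funext => m; rewrite /series/= big1.
  under eq_fun do rewrite big_ord_recr; rewrite big_ord_recr.
  exact: (seriesD IHn (Qcvg _ _)).
rewrite -mulN1r; apply: (series_rnorm_le dcvg) => N.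
apply: (@le_trans _ _ (\sum_(0 <= k < N) gnorm A k (P k) * (y + 2) ^+ k / 2 ^+ n)).
  apply: ler_sum => k _.
  have -> : d k = \sum_(n <= j < maxn n k.+1) shifted P a j k h.
    have PE : P k (a + h) = \sum_(0 <= j < maxn n k.+1) shifted P a j k h.
      rewrite (homogeneous_expansion a h (gP.1 k)).
      rewrite (big_cat_nat (n := k.+1))//= ?leq_maxr// [X in _ + X]big_nat [X in _ = _ + X]big1.
        rewrite addr0 big_mkord; apply: eq_bigr => j _.
        by rewrite /shifted -ltnS ltn_ord.
      by move=> j /andP[kj _]; rewrite /shifted leqNgt kj.
    rewrite /d PE (big_cat_nat (n := n))//= ?leq_maxl// big_mkord mulN1r.
    by rewrite addrAC subrr add0r.
  rewrite (le_trans (rnorm_sum _ _ _))// -mulrA.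
  apply: (@le_trans _ _ (\sum_(n <= j < maxn n k.+1) gnorm A k (P k) *
      ('C(k, j)%:R * y ^+ (k - j) * 2 ^+ j / 2 ^+ n))).
    apply: ler_sum_nat => j /andP[nj _].
    have [s1 s2] := shifted_bounded a j k gP.
    rewrite (le_trans (geval h iA s1))//.
    apply: (@le_trans _ _ (gnorm A j (shifted P a j k))).
      by rewrite ler_piMr ?gnorm_ge0// exprn_ile1// rnorm_ge0.
    rewrite (le_trans s2)// ler_wpM2l ?gseq_ge0// -[leRHS]mulrA ler_peMr//.
      by rewrite mulr_ge0// exprn_ge0.
    by rewrite ler_pdivlMr ?exprn_gt0// mul1r ler_weXn2l// ler1n.
  rewrite -mulr_sumr ler_wpM2l ?gseq_ge0// -mulr_suml ler_wpM2r ?invr_ge0 ?exprn_ge0//.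
  rewrite exprDn -(big_mkord xpredT (fun j => y ^+ (k - j) * 2 ^+ j *+ 'C(k, j))).
  have [kn|nk] := leqP k.+1 n.
    rewrite [leLHS]big_geq//; apply: sumr_ge0 => j _.
    by rewrite mulrn_wge0// mulr_ge0// exprn_ge0.
  have nk' : (n <= k.+1)%N := ltnW nk.
  rewrite [leRHS](big_cat_nat (n := n))//=.
  rewrite -[leLHS]add0r lerD//.
    by apply: sumr_ge0 => j _; rewrite mulrn_wge0// mulr_ge0// exprn_ge0.
  by apply: ler_sum => j _; rewrite -mulrA mulr_natl.
rewrite -mulr_suml ler_wpM2r ?invr_ge0 ?exprn_ge0//.
apply: nneg_series_le_lim; last exact: cvy.
by move=> k; rewrite mulr_ge0 ?gseq_ge0// exprn_ge0// addr_ge0.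
Qed.

Lemma half_exp_lt (K e : R) : 0 < e -> \forall n \near \oo, K / 2 ^+ n < e.
Proof.
move=> e0; have [N KN] : exists N : nat, K / e < N%:R.
  by exists (Num.truncn `|K / e|).+1; rewrite (le_lt_trans (ler_norm _))// truncnS_gt.
exists N => // n /= Nn; rewrite ltr_pdivrMr ?exprn_gt0// mulrC -ltr_pdivrMr//.
apply: (lt_le_trans KN); rewrite -natrX ler_nat (leq_trans Nn)//.
by rewrite ltnW// ltn_expl.
Qed.

Lemma psum_entire P : gseq P -> entire (psum P).
Proof.
move=> gP a; have [Q [gQ _ [K PQ]]] := psum_expansion a gP.
exists Q; split=> [j|]; first exact: gmem_hpolynomial (gQ j).
exists 1 => // e e0; apply: filterS (half_exp_lt K e0) => n Kn x xa.
have := PQ n (x - a) (ltW xa); rewrite subrKC => /le_lt_trans; exact.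
Qed.

Lemma psum_line0 P x (rho : R) : gseq P ->
  line_series (psum P) 0 x (fun k => P k x) rho.
Proof.
move=> gP t _; rewrite add0r; have := psum_cvg (t *: x) gP.
rewrite (_ : (fun k => _) = fun k => P k x * t ^+ k)//.
apply/funext => k; rewrite (hpolynomialZ _ _ (gmem_hpolynomial iA (gP.1 k))).
exact: mulrC.
Qed.

Lemma taylor_psum P k : gseq P -> taylor_coef k (psum P) = P k.
Proof.
move=> gP; apply/funext => x.
exact: (line_series_taylor k ltr01 (@psum_line0 P x 1 gP)).
Qed.

(** ** The derivative in a direction *)

Definition gderiv P (x : E) (k : nat) : E -> R[i] :=
  k.+1%:R *: polar_slice k (P k.+1) x.

Lemma gderiv_gnorm P x k : gseq P -> gmem A k (gderiv P x k) /\
  gnorm A k (gderiv P x k) <=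
    C * rnorm x * (k.+1%:R * gnorm A k.+1 (P k.+1)).
Proof.
move=> gP; have [h1 h2] := slA x (gP.1 k.+1).
split; first exact: (bs_memZ (gbanach _ _ iA)).
rewrite (bs_normZ (gbanach _ _ iA))// rnorm_nat mulrCA ler_wpM2l//.
by rewrite mulrAC.
Qed.

Lemma gderiv_gseq P x : gseq P -> gseq (gderiv P x).
Proof.
move=> gP; split=> [k|]; first by have [] := gderiv_gnorm x k gP.
apply: (@rapid_le _ _
  (fun k => C * rnorm x * (k.+1%:R * gnorm A k.+1 (P k.+1)))).
  by move=> k; have [] := gderiv_gnorm x k gP.
apply: rapidZ => [k|]; first by rewrite mulr_ge0 ?gseq_ge0.
by apply: (@rapid_shift _ (fun k => gnorm A k (P k))); [move=> k; exact: gseq_ge0|exact: gP.2].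
Qed.

(** Restricted to the line through [a] the expansion is a power series, whose
    linear coefficient is [psum (gderiv P x) a] by commutation of slices. *)
Lemma psum_derive P a x : gseq P -> derivable (psum P) a x /\
  'D_x (psum P) a = psum (gderiv P x) a.
Proof.
move=> gP; have [Q [gQ Qcvg [K PQ]]] := psum_expansion a gP.
pose rho := (rnorm x + 1)^-1.
have x1 : 0 < rnorm x + 1 by rewrite ltr_wpDl ?rnorm_ge0.
have rho0 : 0 < rho by rewrite invr_gt0.
have line : line_series (psum P) a x (fun j => Q j x) rho.
  move=> t tr; apply/cvgn_rnormP => e e0.
  apply: filterS (half_exp_lt K e0) => n Kn.
  have tx : rnorm (t *: x) <= 1.
    rewrite rnormZ; apply: (@le_trans _ _ (rho * (rnorm x + 1))).
      by rewrite ler_pM ?rnorm_ge0// ?(ltW tr)// lerDl.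
    by rewrite mulVf// lt0r_neq0.
  have := PQ n _ tx; rewrite rnormC /series/= big_mkord => /le_lt_trans; apply: _.
  move=> /(_ _ Kn); congr (rnorm (_ - _) < _); apply: eq_bigr => j _.
  rewrite (hpolynomialZ _ _ (gmem_hpolynomial iA (gQ j))); exact: mulrC.
have t0 : rnorm (0 : R[i]) < rho by rewrite rnorm0.
have [] := line_series_derive line t0; rewrite scale0r addr0 => d1 d2; split=> //.
have DQ : 'D_x (psum P) a = Q 1%N x.
  apply: (cvgn_unique d2); apply/series_shift.
  rewrite expr0 !mulr1 mul1r subrr.
  rewrite (_ : series _ = fun=> 0); first exact: cvgn_cst.
  apply/funext => m; rewrite /series/= big1// => k _.
  by rewrite exprS mul0r mulr0.
rewrite DQ; apply/esym/psumE; first exact: gderiv_gseq.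
have /series_shift := Qcvg 1%N x; rewrite {2}/shifted /= subr0.
rewrite (_ : (fun k => _) = fun k => gderiv P x k a)//.
apply/funext => k; rewrite /shifted /gderiv ltnS leq0n bin1 subSS subn0.
congr (_ * _).
have kP := gP.1 k.+1.
have := @nslice_slice k 0 (P k.+1) a x; rewrite addn0 => /(_ kP) => slE.
have [ks _] := slA x kP.
transitivity (nslice k 0 (polar_slice k (P k.+1) x) a x); last exact: nslice_diag.
rewrite slE; apply/esym/polar_slice_diag.
have := @nslice_bounded k 1 (P k.+1) a; rewrite addn1 => /(_ kP)[h _].
exact: gmem_hpolynomial h.
Qed.

(** ** Characterization of [Hb] *)

Lemma gnorm_taylor (f : E -> R[i]) k :
  (if k is 0 then rnorm (f 0) else pnorm A k E (taylor_coef k f)) =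
  gnorm A k (taylor_coef k f).
Proof. by case: k => [|k]//=; rewrite /taylor_coef/= invr1 mul1r. Qed.

Lemma taylor0 (f : E -> R[i]) : taylor_coef 0 f = fun=> f 0.
Proof. by apply/funext => x; rewrite /taylor_coef/= invr1 mul1r. Qed.

Lemma root_gnorm (P : nat -> E -> R[i]) :
  ((pnorm A k E (P k) `^ k%:R^-1) @[k --> \oo] --> (0 : R)) <->
  ((gnorm A k (P k) `^ k%:R^-1) @[k --> \oo] --> (0 : R)).
Proof.
split; apply: cvg_trans; apply: near_eq_cvg; exists 1%N => // -[]//.
Qed.

Lemma Hb_psum P : gseq P -> Hb A (psum P).
Proof.
move=> gP; split; first exact: psum_entire.
  by move=> [//|k] _; rewrite taylor_psum//; exact: (gP.1 k.+1).
under eq_fun do rewrite taylor_psum//.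
apply/root_gnorm/rapid_root; last exact: gP.2.
by move=> k; exact: gseq_ge0.
Qed.

Lemma Hb_taylor (f : E -> R[i]) : Hb A f -> gseq (fun k => taylor_coef k f).
Proof.
move=> [_ fm fr].
have gf k : gmem A k (taylor_coef k f).
  by case: k => [|k]; [rewrite taylor0; exists (f 0)|exact: fm].
split=> //; apply/rapid_root; last exact/root_gnorm.
by move=> k; exact: gnorm_ge0.
Qed.

Lemma entireB (f g : E -> R[i]) : entire f -> entire g -> entire (f - g).
Proof.
move=> ef eg a; have [P [hP [r r0 fP]]] := ef a; have [Q [hQ [s s0 gQ]]] := eg a.
exists (fun m => P m - Q m); split=> [m|].
  have [Pc PA] := hP m; have [Qc QA] := hQ m; split.
    by move=> x; apply: cvgB; [exact: Pc|exact: Qc].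
  have := is_polarD (-1) (polarP (hQ m)) (polarP (hP m)).
  by rewrite scaleN1r addrC => hp; eexists; exact: hp.
exists (Num.min r s); first by rewrite lt_min r0.
move=> e e0; have e2 : 0 < e / 2 by rewrite divr_gt0.
apply: filterS2 (fP _ e2) (gQ _ e2) => n fn gn x; rewrite lt_min => /andP[xr xs].
have -> : \sum_(m < n) (P m - Q m) (x - a) =
    \sum_(m < n) P m (x - a) - \sum_(m < n) Q m (x - a) by rewrite -sumrB.
have -> : (f - g) x - (\sum_(m < n) P m (x - a) - \sum_(m < n) Q m (x - a)) =
    (f x - \sum_(m < n) P m (x - a)) - (g x - \sum_(m < n) Q m (x - a)).
  by rewrite -[(f - g) x]/(f x - g x); ring.
move: (fn _ xr) (gn _ xs) => h1 h2.
by rewrite (splitr e) (le_lt_trans (rnormB _ _))// ltrD.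
Qed.

(** The Taylor coefficients only depend on the restriction to lines through the
    origin, where the local expansion is a power series. *)
Lemma taylor_entire (f : E -> R[i]) : entire f -> exists2 r : R, 0 < r & forall x, rnorm x < r ->
  series (fun k => taylor_coef k f x) @ \oo --> (f x : R[i]).
Proof.
move=> ef; have [P [hP [r r0 fP]]] := entire_line 0 ef; exists r; first exact: r0.
move=> x xr; have := fP _ xr; rewrite add0r.
suff -> : (fun k => taylor_coef k f x) = fun k => P k x by [].
apply/funext => k; have x1 : 0 < rnorm x + 1 by rewrite ltr_wpDl ?rnorm_ge0.
apply: (@line_series_taylor _ _ _ _ (fun k => P k x) (r / (rnorm x + 1))).
  by rewrite divr_gt0.
move=> t; rewrite ltr_pdivlMr// => tr; have txr : rnorm (t *: x) < r.
  by rewrite rnormZ (le_lt_trans _ tr)// ler_wpM2l ?rnorm_ge0// lerDl.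
have := fP _ txr.
rewrite (_ : (fun k => P k (t *: x)) = fun k => P k x * t ^+ k)//.
by apply/funext => m; rewrite (hpolynomialZ _ _ (hP m)) mulrC.
Qed.

(** The difference with the Taylor series vanishes near the origin. *)
Lemma Hb_psum_taylor (f : E -> R[i]) : Hb A f -> psum (fun k => taylor_coef k f) = f.
Proof.
move=> Hf; have gf := Hb_taylor Hf; have [ef _ _] := Hf.
have [r r0 fr] := taylor_entire ef.
apply/funext => x; apply/esym/eqP; rewrite -subr_eq0; apply/eqP.
apply: (entire_eq0 (entireB ef (psum_entire gf)) r0) => {}x xr.
by apply/eqP; rewrite subr_eq0; apply/eqP/esym/psumE => //; exact: fr.
Qed.

Lemma HbP (f : E -> R[i]) : Hb A f <-> exists2 P, gseq P & f = psum P.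
Proof.
split=> [Hf|[P gP ->]]; last exact: Hb_psum.
by exists (fun k => taylor_coef k f); [exact: Hb_taylor|rewrite Hb_psum_taylor].
Qed.

End taylor_series.

Arguments psum_cvg {R A} iA {E P} x gP.

(** * The algebra [Hb] *)

Section Hb_algebra.
Context {R : realType}.
Local Notation banachType := (completeNormedModType R[i]).
Variables (A : polynomial_classes R) (iA : ideal_sequence A).
Variables (C : R) (C1 : 1 <= C) (slA : slice_bounded A C).
Variable E : banachType.
Implicit Types (P Q : nat -> E -> R[i]) (f g : E -> R[i]).

Let HbE f : Hb A f -> exists2 P, gseq A P & f = psum P.
Proof. by move/(HbP iA C1 slA). Qed.

Lemma HbD c f g : Hb A f -> Hb A g -> Hb A (c *: f + g).
Proof.
move=> /HbE[P gP ->] /HbE[Q gQ ->]; rewrite -(psumD iA c gP gQ).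
exact: (Hb_psum iA C1 slA (gseqD iA c gP gQ)).
Qed.

Lemma taylorD c f g k : Hb A f -> Hb A g ->
  taylor_coef k (c *: f + g) = c *: taylor_coef k f + taylor_coef k g.
Proof.
move=> /HbE[P gP ->] /HbE[Q gQ ->]; rewrite -(psumD iA c gP gQ).
by rewrite !(taylor_psum iA)//; exact: gseqD.
Qed.

Lemma Hb_homogeneous n p : gmem A n p -> @Hb R A E p.
Proof.
move=> np; rewrite -[p](psum_single n); apply: (Hb_psum iA C1 slA).
exact: single_gseq.
Qed.

Lemma taylor_homogeneous n p k : gmem A n p ->
  @taylor_coef R E k p = single n p k.
Proof.
move=> np; rewrite -[p in LHS](psum_single n) (taylor_psum iA)//.
exact: single_gseq.
Qed.

Lemma Hb_cst c : Hb A (fun _ : E => c).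
Proof. by apply: (@Hb_homogeneous 0); exists c. Qed.

Lemma Hb0 : Hb A (0 : E -> R[i]).
Proof. exact: (Hb_cst 0). Qed.

Lemma HbZ c f : Hb A f -> Hb A (c *: f).
Proof. by move=> Hf; rewrite -[_ *: _]addr0; apply: HbD => //; exact: Hb0. Qed.

Lemma HbB f g : Hb A f -> Hb A g -> Hb A (f - g).
Proof. by move=> Hf Hg; rewrite addrC -scaleN1r; exact: HbD. Qed.

Lemma taylorZ c f k : Hb A f -> taylor_coef k (c *: f) = c *: taylor_coef k f.
Proof.
move=> Hf; have := taylorD c k Hf Hb0; rewrite addr0 => ->.
have -> : taylor_coef k (0 : E -> R[i]) = 0.
  have := taylorD (-1) k Hb0 Hb0; rewrite scaleN1r addNr => -> .
  by rewrite scaleN1r addNr.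
by rewrite addr0.
Qed.

Lemma Hb_sum n (u : nat -> E -> R[i]) : (forall k, Hb A (u k)) ->
  Hb A (\sum_(k < n) u k).
Proof.
move=> Hu; apply: big_ind => //; first exact: Hb0.
by move=> f g Hf Hg; rewrite -[f]scale1r; exact: HbD.
Qed.

Lemma Hb_dual_power (g : dual E) n : Hb A (fun x => g x ^+ n).
Proof. by apply: (@Hb_homogeneous n); have [] := gmem_dual_power n g iA. Qed.

Lemma Hb_derivable f a x : Hb A f -> derivable f a x.
Proof. by move=> /HbE[P gP ->]; have [] := psum_derive iA C1 slA a x gP. Qed.

Lemma derive_psum P x : gseq A P -> 'D_x (psum P) = psum (gderiv P x).
Proof.
by move=> gP; apply/funext => a; have [] := psum_derive iA C1 slA a x gP.
Qed.

Lemma Hb_derive f x : Hb A f -> Hb A ('D_x f).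
Proof.
move=> /HbE[P gP ->]; rewrite derive_psum//; apply: (Hb_psum iA C1 slA).
exact: (gderiv_gseq iA slA).
Qed.

(** ** Seminorms *)

Lemma Hb_seminormE r f :
  Hb_seminorm A r f = limn (series (fun k => gnorm A k (taylor_coef k f) * r ^+ k)).
Proof.
by congr (limn (series _)); apply/funext => k; rewrite gnorm_taylor.
Qed.

Lemma Hb_seminorm_psum r P : gseq A P ->
  Hb_seminorm A r (psum P) = limn (series (fun k => gnorm A k (P k) * r ^+ k)).
Proof.
move=> gP; rewrite Hb_seminormE; congr (limn (series _)); apply/funext => k.
by rewrite (taylor_psum iA).
Qed.

Lemma Hb_seminorm_sum_le r P n : gseq A P -> 0 < r ->
  \sum_(0 <= k < n) gnorm A k (P k) * r ^+ k <= Hb_seminorm A r (psum P).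
Proof.
move=> gP r0; rewrite Hb_seminorm_psum//; apply: nneg_series_le_lim.
  by move=> k; rewrite mulr_ge0 ?(gseq_ge0 iA)// exprn_ge0// ltW.
exact: gseq_series_cvg.
Qed.

Lemma Hb_seminorm_le r P (K : R) : gseq A P -> 0 < r ->
  (forall n, \sum_(0 <= k < n) gnorm A k (P k) * r ^+ k <= K) ->
  Hb_seminorm A r (psum P) <= K.
Proof.
move=> gP r0 h; rewrite Hb_seminorm_psum//; apply: nneg_lim_series_le => //.
exact: gseq_series_cvg.
Qed.

Lemma Hb_seminorm_ge0 r f : Hb A f -> 0 < r -> 0 <= Hb_seminorm A r f.
Proof.
move=> /HbE[P gP ->] r0; have := Hb_seminorm_sum_le 0 gP r0.
by rewrite big_geq.
Qed.

Lemma Hb_seminormZ r c f : Hb A f -> 0 < r ->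
  Hb_seminorm A r (c *: f) = rnorm c * Hb_seminorm A r f.
Proof.
move=> Hf r0; have Hcf := HbZ c Hf; have gT := Hb_taylor iA Hf.
rewrite !Hb_seminormE.
rewrite (_ : series _ = fun n => rnorm c *
    series (fun k => gnorm A k (taylor_coef k f) * r ^+ k) n); last first.
  apply/funext => n; rewrite /series/= mulr_sumr; apply: eq_bigr => k _.
  rewrite (taylorZ c k Hf) (bs_normZ (gbanach _ _ iA)) ?mulrA//; exact: gT.1.
apply: cvg_lim => //; apply: cvgM; first exact: cvg_cst.
exact: (gseq_series_cvg iA gT r0).
Qed.

Lemma Hb_seminorm_single r n p : gmem A n p -> 0 < r ->
  @Hb_seminorm R A E r p <= gnorm A n p * r ^+ n.
Proof.
move=> np r0; rewrite -[p in leLHS](psum_single n).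
have pr : 0 <= gnorm A n p * r ^+ n.
  by rewrite mulr_ge0 ?(gnorm_ge0 iA)// exprn_ge0// ltW.
apply: (Hb_seminorm_le (single_gseq iA np) r0) => N.
have [nN|Nn] := ltnP n N.
  rewrite big_mkord (bigD1 (Ordinal nN))//= /single eqxx big1 ?addr0//.
  move=> k kn; case: eqP => [kE|_].
    by move: kn; rewrite -(inj_eq val_inj)/= kE eqxx.
  by rewrite (bs_norm0 (gbanach _ _ iA)) mul0r.
rewrite big_nat big1// => k /andP[_ kN]; rewrite /single.
by rewrite ltn_eqF ?(leq_trans kN)// (bs_norm0 (gbanach _ _ iA)) mul0r.
Qed.

Lemma Hb_eval_le r f x : Hb A f -> 0 < r -> rnorm x <= r ->
  rnorm (f x) <= Hb_seminorm A r f.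
Proof.
move=> /HbE[P gP ->] r0 xr; apply: (series_rnorm_le (psum_cvg iA x gP)) => n.
apply: le_trans (Hb_seminorm_sum_le n gP r0); apply: ler_sum => k _.
exact: gseq_eval_le.
Qed.

(** The factor [k.+1] produced by differentiation is absorbed by passing from
    the radius [r] to [r + 1]. *)
Lemma Hb_seminorm_derive r f x : Hb A f -> 0 < r ->
  Hb_seminorm A r ('D_x f) <= C * rnorm x * Hb_seminorm A (r + 1) f.
Proof.
move=> /HbE[P gP ->] r0; have r1 : 0 < r + 1 by rewrite ltr_wpDr.
have Cx : 0 <= C * rnorm x by rewrite mulr_ge0 ?rnorm_ge0// (le_trans _ C1).
rewrite derive_psum//; apply: Hb_seminorm_le => [||n] //.
  exact: (gderiv_gseq iA slA).
apply: (@le_trans _ _ (C * rnorm x *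
    \sum_(0 <= k < n.+1) gnorm A k (P k) * (r + 1) ^+ k)); last first.
  by rewrite ler_wpM2l// Hb_seminorm_sum_le.
rewrite big_nat_recl//= mulrDr mulr_sumr ler_wpDl//.
  by rewrite mulr_ge0// expr0 mulr1 rnorm_ge0.
apply: ler_sum => k _; have [_ h] := gderiv_gnorm iA slA x k gP.
rewrite (le_trans (ler_wpM2r _ h)) ?exprn_ge0 ?(ltW r0)//.
rewrite -[leLHS]mulrA ler_wpM2l// [leLHS]mulrAC [leLHS]mulrC.
by rewrite ler_wpM2l ?(gseq_ge0 iA k.+1 gP)// natS_exp_le// ltW.
Qed.

Lemma Hb_taylor_coef f k : Hb A f -> Hb A (taylor_coef k f).
Proof. by move=> Hf; exact: Hb_homogeneous ((Hb_taylor iA Hf).1 k). Qed.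

Lemma Hb_seminorm_taylor r f k : Hb A f -> 0 < r ->
  Hb_seminorm A r (taylor_coef k f) <= Hb_seminorm A r f.
Proof.
move=> Hf r0; have gT := Hb_taylor iA Hf.
rewrite (le_trans (Hb_seminorm_single (gT.1 k) r0))//.
rewrite -[in leRHS](Hb_psum_taylor iA C1 slA Hf).
have := Hb_seminorm_sum_le k.+1 gT r0; apply: le_trans.
rewrite big_nat_recr//= lerDr sumr_ge0// => j _.
by rewrite mulr_ge0 ?(gseq_ge0 iA j gT)// exprn_ge0// ltW.
Qed.

Lemma Hb_seminorm_mono r s f : Hb A f -> 0 < r -> r <= s ->
  Hb_seminorm A r f <= Hb_seminorm A s f.
Proof.
move=> /HbE[P gP ->] r0 rs; have s0 : 0 < s by rewrite (lt_le_trans r0).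
apply: (Hb_seminorm_le gP r0) => n.
apply: le_trans (Hb_seminorm_sum_le n gP s0); apply: ler_sum => k _.
by rewrite ler_wpM2l ?(gseq_ge0 iA)// lerXn2r// nnegrE ltW.
Qed.

(** ** Bounded linear functionals *)

Definition Hb_bounded (L : (E -> R[i]) -> R[i]) : Prop :=
  exists2 r : R, 0 < r &
  exists2 K : R, 0 <= K & forall f, Hb A f -> rnorm (L f) <= K * Hb_seminorm A r f.

Lemma Hb_boundedB L1 L2 : Hb_bounded L1 -> Hb_bounded L2 ->
  Hb_bounded (fun f => L1 f - L2 f).
Proof.
move=> [r r0 [K K0 h]] [s s0 [D D0 h']]; exists (Num.max r s).
  by rewrite lt_max r0.
exists (K + D) => [|f Hf]; first by rewrite addr_ge0.
rewrite mulrDl (le_trans (rnormB _ _))// lerD//.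
  rewrite (le_trans (h f Hf))// ler_wpM2l// Hb_seminorm_mono//.
  by rewrite le_max lexx.
rewrite (le_trans (h' f Hf))// ler_wpM2l// Hb_seminorm_mono//.
by rewrite le_max lexx orbT.
Qed.

Section functional.
Variables (L : (E -> R[i]) -> R[i]) (linL : linear_on (@Hb R A E) L).

(** The remainders of the Taylor series tend to zero in every seminorm. *)
Lemma Hb_functional_eq0 : Hb_bounded L ->
  (forall n p, gmem A n p -> L p = 0) -> forall f, Hb A f -> L f = 0.
Proof.
move=> [r r0 [K K0 LK]] L0 f /HbE[P gP ->].
pose S := Hb_seminorm A r (psum P).
have b0 k : 0 <= gnorm A k (P k) * r ^+ k.
  by rewrite mulr_ge0 ?(gseq_ge0 iA)// exprn_ge0// ltW.
have tail n : rnorm (L (psum P)) <=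
    K * (S - series (fun k => gnorm A k (P k) * r ^+ k) n).
  pose Q k : E -> R[i] := if (k < n)%N then 0 else P k.
  have gQ : gseq A Q.
    split=> [k|]; rewrite /Q.
      by case: ifP => _; [exact: (bs_mem0 (gbanach _ _ iA))|exact: gP.1].
    apply: rapid_le gP.2 => k; case: ifP => _ //.
    by rewrite (bs_norm0 (gbanach _ _ iA)) (gseq_ge0 iA).
  have HPk k : Hb A (P k) by exact: (Hb_homogeneous (gP.1 k)).
  have PE : psum P = \sum_(k < n) P k + psum Q.
    apply/funext => x; apply: (psumE iA gP); apply/cvgn_rnormP => e e0.
    have /cvgn_rnormP/(_ _ e0) := psum_cvg iA x gQ.
    apply: filter_app; exists n => // m /= nm.
    rewrite -[(\sum_(k < n) P k + psum Q) x]/((\sum_(k < n) P k) x + psum Q x).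
    have QE : \sum_(0 <= k < m) Q k x = \sum_(n <= k < m) P k x.
      rewrite (big_cat_nat (n := n))//= big_mkord big1 ?add0r => [|k _].
        rewrite !big_nat; apply: eq_bigr => k /andP[nk _].
        by rewrite /Q ltnNge nk.
      by rewrite /Q ltn_ord.
    rewrite fct_sumE /series/= QE [X in _ -> rnorm (X - _) < _](big_cat_nat (n := n))//=.
    by rewrite big_mkord opprD addrACA subrr add0r.
  rewrite PE -[X in X + _]scale1r linL; last 2 first.
  - exact: Hb_sum.
  - exact: (Hb_psum iA C1 slA).
  rewrite mul1r (linear_on_sum Hb0 HbD linL) => [|k]; last exact: HPk.
  rewrite big1 ?add0r => [|k _]; last exact: L0 (gP.1 k).
  rewrite (le_trans (LK _ (Hb_psum iA C1 slA gQ)))// ler_wpM2l//.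
  apply: (Hb_seminorm_le gQ r0) => N; rewrite lerBrDr.
  have := Hb_seminorm_sum_le (maxn N n) gP r0; apply: le_trans.
  rewrite [leRHS](big_cat_nat (n := n))//= ?leq_maxr// [leLHS]addrC lerD2l.
  rewrite (@le_trans _ _ (\sum_(0 <= k < maxn N n) gnorm A k (Q k) * r ^+ k))//.
    rewrite (big_cat_nat (n := N) (p := maxn N n))//= ?leq_maxl// lerDl.
    by rewrite sumr_ge0// => k _; rewrite mulr_ge0 ?(gseq_ge0 iA)// exprn_ge0// ltW.
  rewrite (big_cat_nat (n := n))//= ?leq_maxr// big_nat big1 ?add0r.
    rewrite !big_nat; apply: ler_sum => k /andP[nk _].
    by rewrite /Q ltnNge nk.
  by move=> k /andP[_ kn]; rewrite /Q kn (bs_norm0 (gbanach _ _ iA)) mul0r.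
apply/rnorm0_eq0/eqP; rewrite eq_le rnorm_ge0 andbT.
have Scvg : K * (S - series (fun k => gnorm A k (P k) * r ^+ k) n) @[n --> \oo]
    --> K * (S - S).
  apply: cvgM; first exact: cvg_cst.
  apply: cvgB; first exact: cvg_cst.
  by rewrite /S Hb_seminorm_psum//; exact: (gseq_series_cvg iA gP r0).
rewrite -(mulr0 K) -(subrr S).
rewrite -(cvg_lim _ Scvg)//; apply: limr_ge; last exact: nearW.
by apply/cvg_ex; eexists; exact: Scvg.
Qed.

(** [graded_density] handles each component, [Hb_functional_eq0] their sum. *)
Lemma Hb_density : (forall k, (0 < k)%N -> finite_type_dense A k E) ->
  Hb_bounded L -> (forall (g : dual E) k, L (fun x => g x ^+ k) = 0) ->
  forall f, Hb A f -> L f = 0.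
Proof.
move=> dA bL Lpow; apply: (Hb_functional_eq0 bL) => n p np.
have [r r0 [K K0 LK]] := bL.
apply: (@graded_density R A E n L (K * r ^+ n) iA (dA n)) np => //.
- by move=> c u v nu nv; apply: linL; [exact: Hb_homogeneous nu|exact: Hb_homogeneous nv].
- by rewrite mulr_ge0// exprn_ge0// ltW.
- move=> q nq; rewrite (le_trans (LK _ (Hb_homogeneous nq)))// -mulrA ler_wpM2l//.
  by rewrite mulrC Hb_seminorm_single.
Qed.

End functional.

End Hb_algebra.

Arguments Hb_derivable {R A} iA {C} C1 slA {E f} a x.

(** ** Products *)

Section cauchy_product.
Context {R : realType}.

Lemma triangular_sum (a b : nat -> R[i]) n :
  \sum_(m < n) \sum_(i < m.+1) a i * b (m - i)%N =
  \sum_(i < n) \sum_(j < n - i) a i * b j.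
Proof.
elim: n => [|n IHn]; first by rewrite !big_ord0.
rewrite big_ord_recr/= IHn; transitivity
  (\sum_(i < n.+1) \sum_(j < n - i) a i * b j + \sum_(i < n.+1) a i * b (n - i)%N).
  by rewrite [in RHS]big_ord_recr/= subnn big_ord0 addr0.
rewrite -big_split; apply: eq_bigr => i _ /=.
by rewrite subSn -1?ltnS// big_ord_recr.
Qed.

(** The product of the partial sums exceeds the partial sum of the convolution by
    fewer than [n * n] terms [a i * b j] with [i + j >= n], each at most
    [K * L / 8 ^+ n]; the base [8] beats [n * n <= 4 ^+ n]. *)
Lemma cauchy_product (a b : nat -> R[i]) (s t : R[i]) (K L : R) :
  (forall k, rnorm (a k) * 8 ^+ k <= K) -> (forall k, rnorm (b k) * 8 ^+ k <= L) ->
  series a @ \oo --> s -> series b @ \oo --> t ->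
  series (fun n => \sum_(i < n.+1) a i * b (n - i)%N) @ \oo --> s * t.
Proof.
move=> aK bL sa sb.
have K0 : 0 <= K by rewrite (le_trans _ (aK 0%N))// mulr_ge0 ?rnorm_ge0.
have L0 : 0 <= L by rewrite (le_trans _ (bL 0%N))// mulr_ge0 ?rnorm_ge0.
have diff n : rnorm (series (fun n => \sum_(i < n.+1) a i * b (n - i)%N) n -
    series a n * series b n) <= K * L / 2 ^+ n.
  rewrite rnormC /series/= !big_mkord triangular_sum mulr_suml -sumrB.
  have termE (i : 'I_n) : a i * \sum_(j < n) b j - \sum_(j < n - i) a i * b j =
      \sum_(n - i <= j < n) a i * b j.
    rewrite mulr_sumr -!(big_mkord xpredT (fun j => a i * b j)).
    by rewrite (big_cat_nat (n := n - i)%N)//= ?leq_subr// addrAC subrr add0r.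
  rewrite (eq_bigr _ (fun i _ => termE i)) (le_trans (rnorm_sum _ _ _))//.
  apply: (@le_trans _ _ (\sum_(i < n) \sum_(0 <= j < n) (K * L / 8 ^+ n))).
    apply: ler_sum => i _; rewrite (le_trans (rnorm_sum _ _ _))//.
    rewrite [leRHS](big_cat_nat (n := n - i)%N)//= ?leq_subr//.
    apply: ler_wpDl.
      by apply: sumr_ge0 => j _; rewrite divr_ge0 ?mulr_ge0 ?exprn_ge0.
    apply: ler_sum_nat => j /andP[nj jn].
    rewrite ler_pdivlMr ?exprn_gt0// rnormM.
    apply: (@le_trans _ _ ((rnorm (a i) * 8 ^+ i) * (rnorm (b j) * 8 ^+ j))).
      rewrite mulrACA -exprD ler_wpM2l ?mulr_ge0 ?rnorm_ge0//.
      by rewrite ler_weXn2l ?ler1n// -leq_subLR.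
    by rewrite ler_pM ?mulr_ge0 ?rnorm_ge0 ?exprn_ge0.
  rewrite sumr_const card_ord sumr_const_nat subn0 -mulrnA -[leLHS]mulr_natr natrM.
  have q0 : 0 < 2 ^+ n :> R by rewrite exprn_gt0.
  have nq : n%:R <= 2 ^+ n :> R by rewrite -natrX ler_nat ltnW// ltn_expl.
  have -> : 8 ^+ n = 2 ^+ n * 2 ^+ n * 2 ^+ n :> R.
    by rewrite -!exprMn; congr (_ ^+ _); ring.
  have -> : K * L / 2 ^+ n =
      K * L / (2 ^+ n * 2 ^+ n * 2 ^+ n) * (2 ^+ n * 2 ^+ n).
    by field; exact: lt0r_neq0.
  by rewrite ler_wpM2l ?divr_ge0 ?mulr_ge0 ?(ltW q0)// ler_pM.
apply/cvgn_rnormP => e e0; have e2 : 0 < e / 2 by rewrite divr_gt0.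
have /cvgn_rnormP/(_ _ e2) := cvgnM sa sb.
apply: filterS2 (half_exp_lt (K * L) e2) => n h1 h2.
rewrite -(subrKA (series a n * series b n)) (le_lt_trans (rnormD _ _))//.
by rewrite (splitr e) ltrD// (le_lt_trans (diff n)).
Qed.

End cauchy_product.

Section Hb_products.
Context {R : realType}.
Local Notation banachType := (completeNormedModType R[i]).
Variables (A : polynomial_classes R) (iA : ideal_sequence A).
Variables (C : R) (C1 : 1 <= C) (slA : slice_bounded A C).
Variables (M : R) (M1 : 1 <= M) (muA : mul_bounded A M).
Variable E : banachType.
Implicit Types (P Q : nat -> E -> R[i]) (f g : E -> R[i]).

Definition gconv P Q (n : nat) : E -> R[i] := \sum_(i < n.+1) P i * Q (n - i)%N.

Lemma gconv_gseq P Q : gseq A P -> gseq A Q -> gseq A (gconv P Q).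
Proof.
move=> gP gQ; have M0 : 0 < M by rewrite (lt_le_trans _ M1).
have term n (i : 'I_n.+1) : gmem A n (P i * Q (n - i)%N) /\
    gnorm A n (P i * Q (n - i)%N) <=
    M ^+ n * gnorm A i (P i) * gnorm A (n - i) (Q (n - i)%N).
  have /= := muA (gP.1 i) (gQ.1 (n - i)%N).
  by rewrite subnKC// -ltnS.
split=> [n|].
  by apply: (bs_mem_sum (gbanach _ _ iA)) => i _; have [] := term n i.
apply: (@rapid_le _ _ (fun n => M ^+ n *
    \sum_(i < n.+1) gnorm A i (P i) * gnorm A (n - i) (Q (n - i)%N))).
  move=> n; rewrite (le_trans (bs_norm_sum (gbanach E n iA) _ _))//.
    by move=> i _; have [] := term n i.
  rewrite mulr_sumr; apply: ler_sum => i _; have [_ h] := term n i.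
  by rewrite (le_trans h)// mulrA.
apply: rapid_exp => //.
apply: (@rapid_conv _ (fun k => gnorm A k (P k)) (fun k => gnorm A k (Q k))).
- by move=> k; exact: (gseq_ge0 iA).
- by move=> k; exact: (gseq_ge0 iA).
- exact: gP.2.
- exact: gQ.2.
Qed.

Lemma gseq_eval_decay P x : gseq A P ->
  exists K : R, forall k, rnorm (P k x) * 8 ^+ k <= K.
Proof.
move=> gP; pose r := 8 * (rnorm x + 1).
have x1 : 0 < rnorm x + 1 by rewrite ltr_wpDl ?rnorm_ge0.
have r0 : 0 < r by rewrite mulr_gt0.
have [K hK] := gP.2 _ r0; exists K => k; apply: le_trans (hK k).
rewrite /r exprMn [leRHS]mulrCA [leLHS]mulrC ler_wpM2l ?exprn_ge0//.
by apply: (gseq_eval_le iA k gP); rewrite lerDl.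
Qed.

Lemma psum_gconv P Q : gseq A P -> gseq A Q ->
  psum (gconv P Q) = psum P * psum Q.
Proof.
move=> gP gQ; apply/funext => x; apply: (psumE iA); first exact: gconv_gseq.
have [K PK] := gseq_eval_decay x gP; have [L QL] := gseq_eval_decay x gQ.
have := cauchy_product PK QL (psum_cvg iA x gP) (psum_cvg iA x gQ).
rewrite (_ : (fun n => _) = fun k => gconv P Q k x)//.
by apply/funext => n; rewrite /gconv fct_sumE.
Qed.

Lemma Hb_mul f g : Hb A f -> Hb A g -> Hb A (f * g).
Proof.
move=> /(HbP iA C1 slA)[P gP ->] /(HbP iA C1 slA)[Q gQ ->].
by rewrite -psum_gconv//; apply: (Hb_psum iA C1 slA); exact: gconv_gseq.
Qed.

Lemma Hb_exp f n : Hb A f -> Hb A (fun x => f x ^+ n).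
Proof.
move=> Hf; elim: n => [|n IHn].
  rewrite (_ : (fun x => _) = fun=> 1); first exact: (Hb_cst iA C1 slA).
  by apply/funext => x; rewrite expr0.
rewrite (_ : (fun x => _) = f * (fun x => f x ^+ n)); first exact: Hb_mul.
by apply/funext => x; rewrite exprS.
Qed.

(** ** Rules of differentiation *)

Lemma deriveD_Hb c f g x : Hb A f -> Hb A g ->
  'D_x (c *: f + g) = c *: 'D_x f + 'D_x g.
Proof.
move=> /(HbP iA C1 slA)[P gP ->] /(HbP iA C1 slA)[Q gQ ->].
apply: (etrans (congr1 (fun h => 'D_x h) (esym (psumD iA c gP gQ)))).
apply: (etrans (derive_psum iA C1 slA x (gseqD iA c gP gQ))).
apply: etrans (congr2 (fun u v => c *: u + v)
  (esym (derive_psum iA C1 slA x gP)) (esym (derive_psum iA C1 slA x gQ))).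
apply: etrans (psumD iA c (gderiv_gseq iA slA x gP) (gderiv_gseq iA slA x gQ)).
congr psum; apply/funext => k; rewrite /gderiv polar_sliceD.
- by rewrite scalerDr !scalerA mulrC.
- exact: (gmem_hpolynomial iA (gP.1 k.+1)).
- exact: (gmem_hpolynomial iA (gQ.1 k.+1)).
Qed.

Lemma derive_linear_dir c f x y : Hb A f ->
  'D_(c *: x + y) f = c *: 'D_x f + 'D_y f.
Proof.
move=> /(HbP iA C1 slA)[P gP ->]; apply: (etrans (derive_psum iA C1 slA _ gP)).
apply: etrans (congr2 (fun u v => c *: u + v)
  (esym (derive_psum iA C1 slA x gP)) (esym (derive_psum iA C1 slA y gP))).
apply: etrans (psumD iA c (gderiv_gseq iA slA x gP) (gderiv_gseq iA slA y gP)).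
congr psum; apply/funext => k; rewrite /gderiv polar_slice_linear.
  by rewrite scalerDr !scalerA mulrC.
exact: (gmem_hpolynomial iA (gP.1 k.+1)).
Qed.

Lemma derive_cst_Hb (c : R[i]) (x : E) : 'D_x (fun _ : E => c) = 0.
Proof. by apply/funext => a; exact: derive_cst. Qed.

Lemma deriveM_Hb f g x : Hb A f -> Hb A g ->
  'D_x (f * g) = f * 'D_x g + g * 'D_x f.
Proof.
move=> Hf Hg; apply/funext => a.
by apply: deriveM; exact: (Hb_derivable iA C1 slA).
Qed.

Lemma derive_exp_Hb f n x : Hb A f ->
  'D_x (fun z => f z ^+ n.+1) = n.+1%:R *: ((fun z => f z ^+ n) * 'D_x f).
Proof.
move=> Hf; elim: n => [|n IHn].
  rewrite scale1r; have -> : (fun z => f z ^+ 1) = f by apply/funext => z; rewrite expr1.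
  by apply/funext => z; rewrite -[RHS]/(f z ^+ 0 * 'D_x f z) expr0 mul1r.
have -> : (fun z => f z ^+ n.+2) = f * (fun z => f z ^+ n.+1).
  by apply/funext => z; rewrite exprS.
apply: (etrans (deriveM_Hb x Hf (Hb_exp n.+1 Hf))).
apply: (etrans (congr1 (fun h => f * h + (fun z => f z ^+ n.+1) * 'D_x f) IHn)).
apply/funext => z.
rewrite -[LHS]/(f z * (n.+1%:R * (f z ^+ n * 'D_x f z)) + f z ^+ n.+1 * 'D_x f z).
rewrite -[RHS]/(n.+2%:R * (f z ^+ n.+1 * 'D_x f z)).
by rewrite -[n.+2%:R]natr1 exprS; ring.
Qed.

Lemma derive_dual (g : dual E) x : 'D_x g = fun=> g x.
Proof.
apply/funext => a; apply: cvg_lim; first exact: norm_hausdorff.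
apply/cvg_rnormP => e e0; exists 1 => //= h _ h0.
by rewrite /= linearP addrK scalerA mulVf// scale1r subrr rnorm0.
Qed.

(** ** The derivative at the origin *)

Lemma derive0_taylor f x : 'D_x f 0 = taylor_coef 1 f x.
Proof. by rewrite /taylor_coef/= invr1 mul1r. Qed.

Lemma hpolynomial1_linear p : @hpolynomial R E 1 p -> linear p.
Proof.
move=> /polarP[mP _ pE] c x y.
have cE z : (fun=> z) = fcons z (fun=> 0 : E) :> ('I_1 -> E).
  by apply/funext => i; rewrite (ord1 i) fcons0.
by rewrite !pE !cE form_linear0.
Qed.

Lemma taylor1_linear f : Hb A f -> linear (taylor_coef 1 f).
Proof.
move=> Hf; apply: hpolynomial1_linear.
exact: (gmem_hpolynomial iA ((Hb_taylor iA Hf).1 1%N)).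
Qed.

Lemma taylor1_le f x (r : R) : Hb A f -> 0 < r ->
  rnorm (taylor_coef 1 f x) <= r^-1 * Hb_seminorm A r f * rnorm x.
Proof.
move=> Hf r0; have gT := Hb_taylor iA Hf.
rewrite (le_trans (geval x iA (gT.1 1%N)))// expr1 ler_wpM2r ?rnorm_ge0//.
rewrite ler_pdivlMl// -{2}(Hb_psum_taylor iA C1 slA Hf).
have := Hb_seminorm_sum_le iA 2 gT r0; apply: le_trans.
rewrite !big_nat_recl//= big_geq// addr0 expr1 mulrC lerDr.
by rewrite mulr_ge0 ?rnorm_ge0// expr0.
Qed.

End Hb_products.

(** * From an isomorphism of algebras to an isomorphism of duals *)

Section mkdual.
Context {R : realType} {V : normedModType R[i]}.

(** The functional [f], when it is linear and continuous. *)
Definition mkdual (f : V -> R[i]) : dual V := insubd (0 : dual V) f.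

Lemma mkdualE f (K : R) : linear f -> (forall x, rnorm (f x) <= K * rnorm x) ->
  mkdual f = f :> (V -> R[i]).
Proof. by move=> fl fK; apply: (insubdK 0); exact: dual_of_bounded fl fK. Qed.

End mkdual.

Section Hb_maps.
Context {R : realType}.
Local Notation banachType := (completeNormedModType R[i]).
Implicit Types (A B : polynomial_classes R).

Definition Hb_map_bounded A (E : banachType) B (F : banachType)
    (phi : (E -> R[i]) -> (F -> R[i])) : Prop :=
  forall r : R, 0 < r -> exists2 s : R, 0 < s & exists2 K : R, 0 <= K &
    forall f, Hb A f -> Hb_seminorm B r (phi f) <= K * Hb_seminorm A s f.

(** An isomorphism of topological algebras, with continuity expressed by
    inequalities between seminorms. *)
Record Hb_iso A (E : banachType) B (F : banachType)
    (phi : (E -> R[i]) -> (F -> R[i])) (psi : (F -> R[i]) -> (E -> R[i])) :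
    Prop := HbIso {
  iso_Hb : forall f, Hb A f -> Hb B (phi f) ;
  iso_HbV : forall g, Hb B g -> Hb A (psi g) ;
  isoK : forall f, Hb A f -> psi (phi f) = f ;
  isoVK : forall g, Hb B g -> phi (psi g) = g ;
  iso_lin : forall a f g, Hb A f -> Hb A g -> phi (a *: f + g) = a *: phi f + phi g ;
  iso_linV : forall a f g, Hb B f -> Hb B g -> psi (a *: f + g) = a *: psi f + psi g ;
  iso_mul : forall f g, Hb A f -> Hb A g -> phi (f * g) = phi f * phi g ;
  iso_mulV : forall f g, Hb B f -> Hb B g -> psi (f * g) = psi f * psi g ;
  iso_bounded : Hb_map_bounded A B phi ;
  iso_boundedV : Hb_map_bounded B A psi }.

Lemma Hb_iso_sym A (E : banachType) B (F : banachType) phi psi :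
  @Hb_iso A E B F phi psi -> Hb_iso B A psi phi.
Proof. by case. Qed.

Section continuity.
Variables (A B : polynomial_classes R) (E F : banachType).
Variables (iA : ideal_sequence A) (iB : ideal_sequence B).
Variables (CA CB : R) (CA1 : 1 <= CA) (CB1 : 1 <= CB).
Variables (slA : slice_bounded A CA) (slB : slice_bounded B CB).
Variable phi : (E -> R[i]) -> (F -> R[i]).
Hypothesis phiHb : forall f, Hb A f -> Hb B (phi f).
Hypothesis phi_lin : forall a f g, Hb A f -> Hb A g ->
  phi (a *: f + g) = a *: phi f + phi g.

Lemma Hb_map0 : phi 0 = 0.
Proof.
have H0 := Hb0 iA CA1 slA E.
by have := phi_lin (-1) H0 H0; rewrite !scaleN1r !addNr => ->.
Qed.

Lemma Hb_mapZ a f : Hb A f -> phi (a *: f) = a *: phi f.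
Proof.
move=> Hf; have := phi_lin a Hf (Hb0 iA CA1 slA E).
by rewrite Hb_map0 !addr0.
Qed.

Lemma Hb_mapB f g : Hb A f -> Hb A g -> phi (f - g) = phi f - phi g.
Proof.
move=> Hf Hg; rewrite addrC -scaleN1r phi_lin//.
by rewrite scaleN1r addrC.
Qed.

(** Continuity at the origin bounds the seminorms on a ball; homogeneity
    does the rest. *)
Lemma Hb_continuous_bounded :
  (phi @ Hb_nbhs A (0 : E -> R[i]) --> Hb_nbhs B (phi 0)) -> Hb_map_bounded A B phi.
Proof.
move=> phic r r0.
have [] : (phi @ Hb_nbhs A (0 : E -> R[i]))
    [set g | Hb B g /\ Hb_seminorm B r (g - phi 0) < 1].
  by apply: phic; exists (r, 1).
move=> [s d] /= [s0 d0] sub; exists s => //; exists d^-1.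
  by rewrite invr_ge0 ltW.
move=> f Hf; have p0 := Hb_seminorm_ge0 iA CA1 slA Hf s0.
apply/ler_addgt0Pr => e e0; pose t := Hb_seminorm A s f + d * e.
have t0 : 0 < t by rewrite ltr_wpDl// mulr_gt0.
pose c : R[i] := (d / t)%:C.
have cE : rnorm c = d / t by rewrite rnorm_real// divr_ge0 ?ltW.
have Hcf := HbZ iA CA1 slA c Hf.
have /sub[_] : [set g | Hb A g /\ Hb_seminorm A s (g - 0) < d] (c *: f).
  split; first exact: Hcf.
  rewrite subr0 (Hb_seminormZ iA CA1 slA)// cE mulrAC ltr_pdivrMr//.
  by rewrite ltr_pM2l// /t ltrDl mulr_gt0.
rewrite Hb_map0 subr0 Hb_mapZ// (Hb_seminormZ iB CB1 slB)//; last exact: phiHb.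
rewrite cE mulrAC ltr_pdivrMr// mul1r -ltr_pdivlMl// => /ltW/le_trans; apply.
by rewrite /t mulrDr mulKf// lt0r_neq0.
Qed.

End continuity.

Lemma Hb_isomorphic_iso A (E : banachType) B (F : banachType) :
  multiplicative_sequence A -> multiplicative_sequence B ->
  Hb_isomorphic A E B F -> exists phi psi, @Hb_iso A E B F phi psi.
Proof.
move=> mA mB [phi [psi [[phiP psiP] lin mul phic psic]]].
have [iA cA _] := mA; have [iB cB _] := mB.
have [CA CA1 slA] := coherent_slice iA cA.
have [CB CB1 slB] := coherent_slice iB cB.
have [MA MA1 muA] := multiplicative_mul mA.
have phiH f (Hf : Hb A f) : Hb B (phi f) := (phiP f Hf).1.
have psiH g (Hg : Hb B g) : Hb A (psi g) := (psiP g Hg).1.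
have psi_lin a f g : Hb B f -> Hb B g -> psi (a *: f + g) = a *: psi f + psi g.
  move=> Hf Hg; have Hf' := psiH f Hf; have Hg' := psiH g Hg.
  have [_ <-] := phiP _ (HbD iA CA1 slA a Hf' Hg').
  by rewrite lin// (psiP f Hf).2 (psiP g Hg).2.
have psi_mul f g : Hb B f -> Hb B g -> psi (f * g) = psi f * psi g.
  move=> Hf Hg; have Hf' := psiH f Hf; have Hg' := psiH g Hg.
  have [_ <-] := phiP _ (Hb_mul iA CA1 slA MA1 muA Hf' Hg').
  by rewrite mul// (psiP f Hf).2 (psiP g Hg).2.
exists phi, psi; split => //.
- by move=> f Hf; have [] := phiP f Hf.
- by move=> g Hg; have [] := psiP g Hg.
- apply: (Hb_continuous_bounded iA iB CA1 CB1 slA slB phiH lin).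
  by apply: phic; exact: (Hb0 iA CA1 slA).
- apply: (Hb_continuous_bounded iB iA CB1 CA1 slB slA psiH psi_lin).
  by apply: psic; exact: (Hb0 iB CB1 slB).
Qed.

End Hb_maps.

Lemma dual_lin_sub (R : realType) (V : normedModType R[i]) (c : R[i])
    (p q r s : dual V) x :
  (c *: p + q) x - (c *: r + s) x = c * (p x - r x) + (q x - s x).
Proof. by rewrite !dualD !dualZ /GRing.scale/=; ring. Qed.

Section cotangent.
Context {R : realType}.
Local Notation banachType := (completeNormedModType R[i]).
Variables (A B : polynomial_classes R) (E F : banachType).
Variables (iA : ideal_sequence A) (iB : ideal_sequence B).
Variables (CA CB : R) (CA1 : 1 <= CA) (CB1 : 1 <= CB).
Variables (slA : slice_bounded A CA) (slB : slice_bounded B CB).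
Variables (MA MB : R) (MA1 : 1 <= MA) (MB1 : 1 <= MB).
Variables (muA : mul_bounded A MA) (muB : mul_bounded B MB).
Variables (phi : (E -> R[i]) -> (F -> R[i])) (psi : (F -> R[i]) -> (E -> R[i])).
Hypothesis iso : Hb_iso A B phi psi.

Let phiH := iso_Hb iso.
Let psiH := iso_HbV iso.
Let phi_lin := iso_lin iso.
Let psi_lin := iso_linV iso.

(** A multiplicative bijection preserves the unit, being onto. *)
Lemma iso1 : phi (fun=> 1) = fun=> 1.
Proof.
have H1 := Hb_cst iA CA1 slA E 1; have K1 := Hb_cst iB CB1 slB F 1.
have := iso_mul iso (psiH K1) H1; rewrite (isoVK iso K1).
rewrite (_ : psi _ * _ = psi (fun=> 1)); last by apply/funext => x; exact: mulr1.
rewrite (isoVK iso K1) => h; rewrite [RHS]h.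
by apply/funext => x; rewrite -[RHS]/(1 * phi (fun=> 1) x) mul1r.
Qed.

Lemma iso_cst (c : R[i]) : phi (fun=> c) = fun=> c.
Proof.
have cE (V : banachType) : (fun _ : V => c) = c *: (fun=> 1).
  by apply/funext => x; exact/esym/mulr1.
rewrite cE (Hb_mapZ iA CA1 slA phi_lin) ?iso1 -?cE//; exact: (Hb_cst iA CA1 slA).
Qed.

Lemma iso_exp f n : Hb A f -> phi (fun x => f x ^+ n) = fun y => phi f y ^+ n.
Proof.
move=> Hf; elim: n => [|n IHn].
  rewrite (_ : (fun x => _) = fun=> 1) ?iso1; first by apply/funext.
  by apply/funext.
rewrite (_ : (fun x => _) = f * (fun x => f x ^+ n)); last first.
  by apply/funext => x; rewrite exprS.
rewrite (iso_mul iso Hf (Hb_exp iA CA1 slA MA1 muA n Hf)) IHn.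
by apply/funext => y; rewrite exprS.
Qed.

(** The point derivation in the direction [x] at the character
    [f |-> phi f 0]. *)
Definition chi_derive (f : E -> R[i]) (x : E) : R[i] := phi ('D_x f) 0.

Lemma chi_derive_linear f : Hb A f -> linear (chi_derive f).
Proof.
move=> Hf c x y; rewrite /chi_derive.
apply: (etrans (congr1 (fun h => phi h 0) (derive_linear_dir iA CA1 slA c x y Hf))).
have Hx := Hb_derive iA CA1 slA x Hf; have Hy := Hb_derive iA CA1 slA y Hf.
exact: (congr1 (fun h => h 0) (phi_lin c Hx Hy)).
Qed.

Lemma chi_deriveD c f g x : Hb A f -> Hb A g ->
  chi_derive (c *: f + g) x = c * chi_derive f x + chi_derive g x.
Proof.
move=> Hf Hg; rewrite /chi_derive.
apply: (etrans (congr1 (fun h => phi h 0) (deriveD_Hb iA CA1 slA c x Hf Hg))).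
have Hx := Hb_derive iA CA1 slA x Hf; have Hy := Hb_derive iA CA1 slA x Hg.
exact: (congr1 (fun h => h 0) (phi_lin c Hx Hy)).
Qed.

Lemma chi_derive_le : exists2 s : R, 0 < s & exists2 K : R, 0 <= K &
  forall f, Hb A f -> forall x, rnorm (chi_derive f x) <= K * Hb_seminorm A s f * rnorm x.
Proof.
have [s s0 [K K0 phiK]] := iso_bounded iso ltr01.
have CA0 : 0 <= CA by rewrite (le_trans _ CA1).
exists (s + 1); first by rewrite ltr_wpDr.
exists (K * CA); first by rewrite mulr_ge0.
move=> f Hf x; have Hx := Hb_derive iA CA1 slA x Hf.
have z0 : rnorm (0 : F) <= 1 by rewrite rnorm0.
apply: (le_trans (Hb_eval_le iB CB1 slB (phiH Hx) ltr01 z0)).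
apply: (le_trans (phiK _ Hx)).
apply: (le_trans (ler_wpM2l K0 (Hb_seminorm_derive iA CA1 slA x Hf s0))).
by rewrite le_eqVlt; apply/orP; left; apply/eqP; ring.
Qed.

Definition cotangent (f : E -> R[i]) : dual E := mkdual (chi_derive f).

Lemma cotangentE f x : Hb A f -> cotangent f x = chi_derive f x.
Proof.
move=> Hf; have [s s0 [K K0 h]] := chi_derive_le.
by rewrite /cotangent (mkdualE (chi_derive_linear Hf) (h f Hf)).
Qed.

Lemma cotangentD c f g : Hb A f -> Hb A g ->
  cotangent (c *: f + g) = c *: cotangent f + cotangent g.
Proof.
move=> Hf Hg; apply/dualP => x.
rewrite cotangentE; last exact: (HbD iA CA1 slA).
apply: (etrans (chi_deriveD c x Hf Hg)).
exact: (congr2 (fun u v => c * u + v)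
  (esym (cotangentE x Hf)) (esym (cotangentE x Hg))).
Qed.

Lemma cotangent_le : exists2 s : R, 0 < s & exists2 K : R, 0 <= K &
  forall f, Hb A f -> rnorm (cotangent f) <= K * Hb_seminorm A s f.
Proof.
have [s s0 [K K0 h]] := chi_derive_le; exists s => //; exists K => // f Hf.
apply: rnorm_dual_le => [|x].
  by rewrite mulr_ge0// (Hb_seminorm_ge0 iA CA1 slA).
by rewrite cotangentE// h.
Qed.

Lemma chi_derive_cst c : chi_derive (fun=> c) = 0.
Proof.
apply/funext => x; rewrite /chi_derive.
apply: (etrans (congr1 (fun h => phi h 0) (derive_cst_Hb c x))).
exact: (congr1 (fun h => h 0) (Hb_map0 iA CA1 slA phi_lin)).
Qed.

Lemma chi_derive_exp f n x : Hb A f -> chi_derive (fun z => f z ^+ n.+1) x =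
  n.+1%:R * phi f 0 ^+ n * chi_derive f x.
Proof.
move=> Hf; rewrite /chi_derive.
apply: (etrans (congr1 (fun h => phi h 0) (derive_exp_Hb iA CA1 slA MA1 muA n x Hf))).
have Hx := Hb_derive iA CA1 slA x Hf.
have Hn := Hb_exp iA CA1 slA MA1 muA n Hf.
have Hp := Hb_mul iA CA1 slA MA1 muA Hn Hx.
apply: (etrans (congr1 (fun h => h 0) (Hb_mapZ iA CA1 slA phi_lin n.+1%:R Hp))).
rewrite -[LHS]/(n.+1%:R * phi ((fun z => f z ^+ n) * 'D_x f) 0) -mulrA.
congr (_ * _); apply: (etrans (congr1 (fun h => h 0) (iso_mul iso Hn Hx))).
by rewrite (iso_exp n Hf).
Qed.

Lemma chi_derive_dual (g : dual E) x : chi_derive g x = g x.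
Proof.
rewrite /chi_derive (derive_dual g x).
exact: (congr1 (fun h => h 0) (iso_cst (g x))).
Qed.

Lemma Hb_dual (g : dual E) : Hb A g.
Proof.
rewrite (_ : (g : E -> R[i]) = fun x => g x ^+ 1); last first.
  by apply/funext => x; rewrite expr1.
exact: (Hb_dual_power iA CA1 slA).
Qed.

Definition lin_image (f : E -> R[i]) : dual F := mkdual (taylor_coef 1 (phi f)).

Lemma lin_imageE f y : Hb A f -> lin_image f y = taylor_coef 1 (phi f) y.
Proof.
move=> Hf; have Hpf := phiH Hf.
rewrite /lin_image (mkdualE (taylor1_linear iB Hpf) (K := 1^-1 * Hb_seminorm B 1 (phi f)))//.
by move=> z; exact: (taylor1_le iB CB1 slB).
Qed.

Lemma lin_imageD c f g : Hb A f -> Hb A g ->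
  lin_image (c *: f + g) = c *: lin_image f + lin_image g.
Proof.
move=> Hf Hg; apply/dualP => y; rewrite lin_imageE; last exact: (HbD iA CA1 slA).
rewrite (phi_lin c Hf Hg) (taylorD iB CB1 slB c 1 (phiH Hf) (phiH Hg)).
exact: (congr2 (fun u v => c * u + v)
  (esym (lin_imageE y Hf)) (esym (lin_imageE y Hg))).
Qed.

Lemma lin_image_le : exists2 s : R, 0 < s & exists2 K : R, 0 <= K &
  forall f, Hb A f -> rnorm (lin_image f) <= K * Hb_seminorm A s f.
Proof.
have [s s0 [K K0 phiK]] := iso_bounded iso ltr01.
exists s => //; exists K => // f Hf.
apply: rnorm_dual_le => [|y].
  by rewrite mulr_ge0// (Hb_seminorm_ge0 iA CA1 slA).
rewrite lin_imageE// (le_trans (taylor1_le iB CB1 slB y (phiH Hf) ltr01))//.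
by rewrite invr1 mul1r ler_wpM2r ?rnorm_ge0// phiK.
Qed.

Lemma dual_seminorm (g : dual E) (s : R) : 0 < s ->
  Hb_seminorm A s g <= rnorm g * s.
Proof.
move=> s0; have [h1 h2] := gmem_dual_power 1 g iA.
have gE : (g : E -> R[i]) = fun x => g x ^+ 1.
  by apply/funext => x; rewrite expr1.
rewrite [in leLHS]gE (le_trans (Hb_seminorm_single iA h1 s0))//.
by rewrite expr1 ler_wpM2r ?(ltW s0)//; move: h2; rewrite expr1.
Qed.

Lemma lin_image_bounded y : Hb_bounded A (fun f => lin_image f y).
Proof.
have [s s0 [K K0 hK]] := lin_image_le; exists s => //.
exists (K * rnorm y) => [|f Hf]; first by rewrite mulr_ge0 ?rnorm_ge0.
by rewrite mulrAC (le_trans (le_rnorm_dual _ _))// ler_wpM2r ?rnorm_ge0// hK.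
Qed.

Lemma lin_image_cotangent_bounded y :
  Hb_bounded A (fun f => lin_image (cotangent f) y).
Proof.
have [s s0 [K K0 hK]] := lin_image_le; have [t t0 [D D0 hD]] := cotangent_le.
exists t => //; exists (K * s * D * rnorm y) => [|f Hf].
  by rewrite !mulr_ge0 ?rnorm_ge0// ltW.
rewrite mulrAC (le_trans (le_rnorm_dual _ _))// ler_wpM2r ?rnorm_ge0//.
have Hc := Hb_dual (cotangent f).
rewrite (le_trans (hK _ Hc))// -!mulrA ler_wpM2l//.
rewrite (le_trans (dual_seminorm (cotangent f) s0))//.
by rewrite mulrC ler_wpM2l ?(ltW s0)// hD.
Qed.

(** Both sides are point derivations at the character [f |-> phi f 0], and they
    agree on the dual: there [cotangent] is the identity. On [g ^+ k.+1] both
    give [k.+1 * (phi g 0) ^+ k] times the value at [g]. *)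
Lemma lin_image_cotangent f : (forall k, (0 < k)%N -> finite_type_dense A k E) ->
  Hb A f -> lin_image (cotangent f) = lin_image f.
Proof.
move=> dA Hf; apply/dualP => y; apply/eqP; rewrite -subr_eq0; apply/eqP.
pose L f := lin_image (cotangent f) y - lin_image f y.
apply: (@Hb_density R A iA CA CA1 slA E L _ dA) => //.
- move=> c u v Hu Hv.
  have e1 := etrans (congr1 (fun g : dual E => lin_image g) (cotangentD c Hu Hv))
    (lin_imageD c (Hb_dual _) (Hb_dual _)).
  apply: (etrans (congr2 (fun p q : dual F => p y - q y) e1 (lin_imageD c Hu Hv))).
  exact: dual_lin_sub.
- exact: (Hb_boundedB iA CA1 slA (lin_image_cotangent_bounded y) (lin_image_bounded y)).
- move=> g [|k].
  rewrite (_ : (fun x => g x ^+ 0) = fun=> 1); last first.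
    by apply/funext => x; rewrite expr0.
  have H1 := Hb_cst iA CA1 slA E 1.
  have c1 : cotangent (fun=> 1) = 0.
    apply/dualP => x; apply: (etrans (cotangentE x H1)).
    exact: (congr1 (fun h => h x) (chi_derive_cst 1)).
  have t0 (c : R[i]) : taylor_coef 1 (fun _ : F => c) y = 0.
    have cm : gmem B 0 (fun _ : F => c) by exists c.
    exact: (congr1 (fun h => h y) (taylor_homogeneous iB 1 cm)).
  have e1 : lin_image (cotangent (fun=> 1)) y = 0.
    apply: (etrans (congr1 (fun g : dual E => lin_image g y) c1)).
    apply: (etrans (lin_imageE y (Hb_dual 0))).
    exact: (etrans (congr1 (fun h => taylor_coef 1 h y) (iso_cst 0)) (t0 0)).
  have e2 := etrans (lin_imageE y H1)
    (etrans (congr1 (fun h => taylor_coef 1 h y) iso1) (t0 1)).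
  by apply: (etrans (congr2 (fun u v => u - v) e1 e2)); exact: subrr.
  have Hg := Hb_dual g.
  have Hk : Hb A (fun x => g x ^+ k.+1) by exact: (Hb_dual_power iA CA1 slA).
  pose c : R[i] := k.+1%:R * phi g 0 ^+ k.
  have cE : cotangent (fun x => g x ^+ k.+1) = c *: g.
    apply/dualP => x; apply: (etrans (cotangentE x Hk)).
    apply: (etrans (chi_derive_exp k x Hg)).
    exact: (congr1 (fun u => c * u) (chi_derive_dual g x)).
  have e1 : lin_image (cotangent (fun x => g x ^+ k.+1)) y =
      c * taylor_coef 1 (phi g) y.
    apply: (etrans (congr1 (fun g : dual E => lin_image g y) cE)).
    apply: (etrans (lin_imageE y (Hb_dual (c *: g)))).
    apply: (etrans (congr1 (fun h => taylor_coef 1 h y)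
      (Hb_mapZ iA CA1 slA phi_lin c Hg))).
    exact: (congr1 (fun h => h y) (taylorZ iB CB1 slB c 1 (phiH Hg))).
  have e2 : lin_image (fun x => g x ^+ k.+1) y = c * taylor_coef 1 (phi g) y.
    apply: (etrans (lin_imageE y Hk)).
    apply: (etrans (congr1 (fun h => taylor_coef 1 h y) (iso_exp k.+1 Hg))).
    apply: (etrans (esym (derive0_taylor _ y))).
    apply: (etrans (congr1 (fun h => h 0)
      (derive_exp_Hb iB CB1 slB MB1 muB k y (phiH Hg)))).
    apply: etrans (congr1 (fun u => c * u) (derive0_taylor (phi g) y)).
    exact: mulrA.
  by apply: (etrans (congr2 (fun u v => u - v) e1 e2)); exact: subrr.
Qed.

End cotangent.

Section dual_isomorphism.
Context {R : realType}.
Local Notation banachType := (completeNormedModType R[i]).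
Variables (A B : polynomial_classes R) (E F : banachType).
Variables (iA : ideal_sequence A) (iB : ideal_sequence B).
Variables (CA CB : R) (CA1 : 1 <= CA) (CB1 : 1 <= CB).
Variables (slA : slice_bounded A CA) (slB : slice_bounded B CB).
Variables (MA MB : R) (MA1 : 1 <= MA) (MB1 : 1 <= MB).
Variables (muA : mul_bounded A MA) (muB : mul_bounded B MB).
Variables (phi : (E -> R[i]) -> (F -> R[i])) (psi : (F -> R[i]) -> (E -> R[i])).
Hypothesis iso : Hb_iso A B phi psi.

Let isoV := Hb_iso_sym iso.
Let psiH := iso_HbV iso.

(** At the origin of [F] the derivation [h |-> chi_derive phi (psi h) x] only sees
    the linear part of [h], because a product of functions vanishing at the
    origin is killed. *)
Lemma chi_derive_taylor1 h x : (forall k, (0 < k)%N -> finite_type_dense B k F) ->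
  Hb B h -> chi_derive phi (psi h) x = chi_derive phi (psi (taylor_coef 1 h)) x.
Proof.
move=> dB Hh; apply/eqP; rewrite -subr_eq0; apply/eqP.
pose D h := chi_derive phi (psi h) x.
pose L h := D h - D (taylor_coef 1 h).
have Dlin c u v : Hb B u -> Hb B v -> D (c *: u + v) = c * D u + D v.
  move=> Hu Hv; apply: (etrans (congr1 (fun h => chi_derive phi h x) (iso_linV iso c Hu Hv))).
  exact: (chi_deriveD iA CA1 slA iso c x (psiH Hu) (psiH Hv)).
have Ht (u : F -> R[i]) : Hb B u -> Hb B (taylor_coef 1 u) by exact: (Hb_taylor_coef iB CB1 slB).
have D0 : D 0 = 0.
  apply: (etrans (congr1 (fun h => chi_derive phi h x)
    (Hb_map0 iB CB1 slB (iso_linV iso)))).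
  exact: (congr1 (fun h => h x) (chi_derive_cst iA CA1 slA iso 0)).
apply: (@Hb_density R B iB CB CB1 slB F L _ dB) => //.
- move=> c u v Hu Hv.
  have e1 := etrans (congr1 D (taylorD iB CB1 slB c 1 Hu Hv)) (Dlin c _ _ (Ht _ Hu) (Ht _ Hv)).
  apply: (etrans (congr2 (fun p q => p - q) (Dlin c u v Hu Hv) e1)).
  have linB (p q r s : R[i]) : c * p + q - (c * r + s) = c * (p - r) + (q - s) by ring.
  exact: linB.
- have Dle : exists2 s : R, 0 < s & exists2 K : R, 0 <= K &
      forall u, Hb B u -> rnorm (D u) <= K * Hb_seminorm B s u.
    have [s s0 [K K0 hK]] := chi_derive_le iA iB CA1 CB1 slA slB iso.
    have [t t0 [J J0 hJ]] := iso_boundedV iso s0.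
    exists t => //; exists (K * J * rnorm x); first by rewrite !mulr_ge0 ?rnorm_ge0.
    move=> u Hu; rewrite (le_trans (hK _ (psiH Hu) x))//.
    rewrite [leRHS]mulrAC ler_wpM2r ?rnorm_ge0// -mulrA ler_wpM2l//.
    exact: hJ.
  have [s s0 [K K0 hK]] := Dle.
  have bD : Hb_bounded B D by exists s; [exact: s0|exists K; [exact: K0|exact: hK]].
  have bD' : Hb_bounded B (fun u => D (taylor_coef 1 u)).
    exists s; first exact: s0.
    exists K => [|u Hu]; first exact: K0.
    apply: (le_trans (hK _ (Ht _ Hu))); apply: ler_wpM2l; first exact: K0.
    exact: (Hb_seminorm_taylor iB CB1 slB 1 Hu s0).
  exact: (Hb_boundedB iB CB1 slB bD bD').
- move=> g [|k].
  rewrite (_ : (fun x => g x ^+ 0) = fun=> 1); last first.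
    by apply/funext => z; rewrite expr0.
  have c0 : gmem B 0 (fun _ : F => 1) by exists 1.
  have e1 : D (fun=> 1) = 0.
    apply: (etrans (congr1 (fun h => chi_derive phi h x)
      (iso1 iB iA CB1 CA1 slB slA isoV))).
    exact: (congr1 (fun h => h x) (chi_derive_cst iA CA1 slA iso 1)).
  have e2 := etrans (congr1 D (taylor_homogeneous iB 1 c0)) D0.
  by apply: (etrans (congr2 (fun u v => u - v) e1 e2)); exact: subrr.
  have [gk _] := gmem_dual_power k.+1 g iB.
  have Hg : Hb B g := Hb_dual iB CB1 slB g.
  case: k gk => [|k] gk.
    have e1 := congr1 D (taylor_homogeneous iB 1 gk).
    by apply: (etrans (congr2 (fun u v => u - v) (erefl (D _)) e1)); exact: subrr.
  have e2 := etrans (congr1 D (taylor_homogeneous iB 1 gk)) D0.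
  have e1 : D (fun z => g z ^+ k.+2) = 0.
    apply: (etrans (congr1 (fun h => chi_derive phi h x)
      (iso_exp iB iA CB1 CA1 slB slA MB1 muB isoV k.+2 Hg))).
    apply: (etrans (chi_derive_exp iA iB CA1 CB1 slA slB MA1 muA iso k.+1 x (psiH Hg))).
    have -> : phi (psi g) 0 = 0.
      by rewrite (isoVK iso Hg); exact: linear0.
    by rewrite exprS !mul0r mulr0 mul0r.
  by apply: (etrans (congr2 (fun u v => u - v) e1 e2)); exact: subrr.
Qed.

Definition dual_map (g : dual E) : dual F := lin_image phi g.
Definition dual_mapV (g : dual F) : dual E := cotangent phi (psi g).

Let HdE (g : dual E) : Hb A g := Hb_dual iA CA1 slA g.
Let HdF (g : dual F) : Hb B g := Hb_dual iB CB1 slB g.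

Lemma dual_map_linear : linear dual_map.
Proof.
by move=> c g h; exact: (lin_imageD iA iB CA1 CB1 slA slB iso c (HdE g) (HdE h)).
Qed.

Lemma dual_mapV_linear : linear dual_mapV.
Proof.
move=> c g h; apply: (etrans (congr1 (cotangent phi) (iso_linV iso c (HdF g) (HdF h)))).
exact: (cotangentD iA iB CA1 CB1 slA slB iso c (psiH (HdF g)) (psiH (HdF h))).
Qed.

Lemma dual_map_bounded : exists K : R, forall g, rnorm (dual_map g) <= K * rnorm g.
Proof.
have [s s0 [K K0 hK]] := lin_image_le iA iB CA1 CB1 slA slB iso.
exists (K * s) => g; rewrite (le_trans (hK _ (HdE g)))// -mulrA ler_wpM2l//.
by rewrite [leRHS]mulrC (dual_seminorm iA).
Qed.

Lemma dual_mapV_bounded : exists K : R, forall g, rnorm (dual_mapV g) <= K * rnorm g.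
Proof.
have [s s0 [K K0 hK]] := cotangent_le iA iB CA1 CB1 slA slB iso.
have [t t0 [J J0 hJ]] := iso_boundedV iso s0.
exists (K * J * t) => g; rewrite (le_trans (hK _ (psiH (HdF g))))// -!mulrA.
rewrite ler_wpM2l// (le_trans (hJ _ (HdF g)))// ler_wpM2l//.
by rewrite [leRHS]mulrC (dual_seminorm iB).
Qed.

Lemma taylor1_dual (g : dual F) y : taylor_coef 1 g y = g y.
Proof.
have [gk _] := gmem_dual_power 1 g iB.
have gE : (fun x => g x ^+ 1) = g by apply/funext => z; rewrite expr1.
by move: gk; rewrite gE => gk; exact: (congr1 (fun h => h y) (taylor_homogeneous iB 1 gk)).
Qed.

Lemma dual_mapVK : (forall k, (0 < k)%N -> finite_type_dense A k E) ->
  cancel dual_mapV dual_map.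
Proof.
move=> dA g; rewrite /dual_map /dual_mapV.
have Hg := psiH (HdF g).
apply: (etrans (lin_image_cotangent iA iB CA1 CB1 slA slB MA1 MB1 muA muB iso dA Hg)).
apply/dualP => y; apply: (etrans (lin_imageE iB CB1 slB iso y Hg)).
by rewrite (isoVK iso (HdF g)); exact: taylor1_dual.
Qed.

Lemma dual_mapK : (forall k, (0 < k)%N -> finite_type_dense B k F) ->
  cancel dual_map dual_mapV.
Proof.
move=> dB g; apply/dualP => x; have Hg := HdE g; have Hpg := iso_Hb iso Hg.
apply: (etrans (cotangentE iA iB CA1 CB1 slA slB iso x (psiH (HdF (dual_map g))))).
have lE : dual_map g = taylor_coef 1 (phi g) :> (F -> R[i]).
  by apply/funext => y; exact: (lin_imageE iB CB1 slB iso y Hg).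
apply: (etrans (congr1 (fun h => chi_derive phi (psi h) x) lE)).
apply: (etrans (esym (chi_derive_taylor1 x dB Hpg))).
apply: (etrans (congr1 (fun h => chi_derive phi h x) (isoK iso Hg))).
exact: (chi_derive_dual iA iB CA1 CB1 slA slB iso g x).
Qed.

Lemma Hb_iso_dual_isomorphic :
  (forall k, (0 < k)%N -> finite_type_dense A k E) ->
  (forall k, (0 < k)%N -> finite_type_dense B k F) ->
  isomorphic (dual E) (dual F).
Proof.
move=> dA dB; have [K hK] := dual_map_bounded; have [J hJ] := dual_mapV_bounded.
exists (mklinear dual_map_linear), (mklinear dual_mapV_linear); split.
- exact: dual_mapK.
- exact: dual_mapVK.
- exact: (@bounded_linear _ _ _ (mklinear dual_map_linear) K).
- exact: (@bounded_linear _ _ _ (mklinear dual_mapV_linear) J).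
Qed.

End dual_isomorphism.

(** * The Aron-Berner extension *)

Section iterated_extension.
Context {R : realType} {E : normedModType R[i]}.
Local Notation bidual := (dual (dual E)).

Definition form_bounded k (A : ('I_k -> E) -> R[i]) (K : R) : Prop :=
  forall x, rnorm (A x) <= K * \prod_(i < k) rnorm (x i).

(** The nesting is the one of [is_aron_berner]: the innermost functional extends
    the last variable, while the first variables still range over [E]. *)
Fixpoint ab_form k : (('I_k -> E) -> R[i]) -> ('I_k -> bidual) -> R[i] :=
  match k with
  | 0 => fun A _ => A (fun=> 0)
  | m.+1 => fun A z => z ord0
      (mkdual (fun a => ab_form (fun x : 'I_m -> E => A (fcons a x)) (z \o lift ord0)))
  end.

Lemma form_bounded_cons k (A : ('I_k.+1 -> E) -> R[i]) K a :
  form_bounded A K -> form_bounded (fun x => A (fcons a x)) (K * rnorm a).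
Proof.
move=> AK x; rewrite (le_trans (AK _))// big_ord_recl fcons0 mulrA.
by under eq_bigr do rewrite fconsS.
Qed.

Lemma form_boundedD k (A B : ('I_k -> E) -> R[i]) (K L : R) c :
  form_bounded A K -> form_bounded B L ->
  form_bounded (fun x => c * A x + B x) (rnorm c * K + L).
Proof.
move=> AK BL x; rewrite (le_trans (rnormD _ _))// mulrDl lerD// rnormM -mulrA.
by rewrite ler_wpM2l ?rnorm_ge0.
Qed.

Lemma multilinearD k (A B : ('I_k -> E) -> R[i]) c :
  multilinear A -> multilinear B -> multilinear (fun x => c * A x + B x).
Proof.
move=> mA mB x i a u v /=; rewrite (mA x i) (mB x i) /GRing.scale/=.
by ring.
Qed.

Lemma prod_rnorm_ge0 k (V : normedModType R[i]) (x : 'I_k -> V) :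
  0 <= \prod_(i < k) rnorm (x i).
Proof. by apply: prodr_ge0 => i _; exact: rnorm_ge0. Qed.

Definition ab_form_contractive k : Prop :=
  forall (A : ('I_k -> E) -> R[i]) (K : R), 0 <= K -> multilinear A ->
  form_bounded A K ->
  forall z, rnorm (ab_form A z) <= K * \prod_(i < k) rnorm (z i).

Definition ab_form_additive k : Prop :=
  forall (A B : ('I_k -> E) -> R[i]) (K L : R) (c : R[i]), 0 <= K -> 0 <= L ->
  multilinear A -> multilinear B -> form_bounded A K -> form_bounded B L ->
  forall z, ab_form (fun x => c * A x + B x) z = c * ab_form A z + ab_form B z.

(** The inner function of the recursion is a functional as soon as the
    extension of forms with one variable less is bounded and additive. *)
Lemma ab_form_inner_aux k (A : ('I_k.+1 -> E) -> R[i]) (K : R) (z : 'I_k -> bidual) :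
  ab_form_contractive k -> ab_form_additive k ->
  0 <= K -> multilinear A -> form_bounded A K ->
  mkdual (fun a => ab_form (fun x : 'I_k -> E => A (fcons a x)) z) =
  (fun a => ab_form (fun x : 'I_k -> E => A (fcons a x)) z) :> (E -> R[i]).
Proof.
move=> hb hl K0 mA AK.
have Ka (a : E) : 0 <= K * rnorm a by rewrite mulr_ge0 ?rnorm_ge0.
have fl : linear (fun a => ab_form (fun x : 'I_k -> E => A (fcons a x)) z).
  move=> c u v.
  have -> : (fun x : 'I_k -> E => A (fcons (c *: u + v) x)) =
      fun x => c * A (fcons u x) + A (fcons v x).
    by apply/funext => x; rewrite (form_linear0 x mA).
  exact: (hl _ _ _ _ c (Ka u) (Ka v) (form_cons u mA) (form_cons v mA)
    (form_bounded_cons u AK) (form_bounded_cons v AK)).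
apply: (mkdualE fl (K := K * \prod_(i < k) rnorm (z i))) => b.
rewrite mulrAC.
exact: (hb _ _ (Ka b) (form_cons b mA) (form_bounded_cons b AK)).
Qed.

(** Both properties are proved together, as each of them with one variable less
    is what makes the inner function of the recursion a functional. *)
Lemma ab_form_bound_linear k : ab_form_contractive k /\ ab_form_additive k.
Proof.
elim: k => [|k [IHb IHl]].
  split=> [A K K0 mA AK z|//] /=; rewrite (le_trans (AK _))//.
  by rewrite !big_ord0.
have Ka K (a : E) : 0 <= K -> 0 <= K * rnorm a.
  by move=> K0; rewrite mulr_ge0 ?rnorm_ge0.
split=> [A K K0 mA AK z|A B K L c K0 L0 mA mB AK BL z] /=.
  rewrite (le_trans (le_rnorm_dual _ _))// big_ord_recl mulrCA.
  rewrite ler_wpM2l ?rnorm_ge0//.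
  apply: rnorm_dual_le => [|a]; first by rewrite mulr_ge0// prod_rnorm_ge0.
  rewrite (ab_form_inner_aux _ IHb IHl K0 mA AK) mulrAC.
  exact: (IHb _ _ (Ka _ a K0) (form_cons a mA) (form_bounded_cons a AK)).
rewrite -[c * _]/(c *: _) -linearP; congr (z ord0 _); apply/dualP => a.
have KL0 : 0 <= rnorm c * K + L by rewrite addr_ge0// mulr_ge0// rnorm_ge0.
have innerE A' K' (K0' : 0 <= K') (mA' : multilinear A') (AK' : form_bounded A' K') :=
  congr1 (fun f => f a) (ab_form_inner_aux (z \o lift ord0) IHb IHl K0' mA' AK').
apply: (etrans (innerE _ _ KL0 (multilinearD c mA mB) (form_boundedD c AK BL))).
apply: etrans (congr2 (fun u v => c * u + v) (esym (innerE _ _ K0 mA AK))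
  (esym (innerE _ _ L0 mB BL))).
exact: (IHl _ _ _ _ c (Ka _ a K0) (Ka _ a L0) (form_cons a mA) (form_cons a mB)
  (form_bounded_cons a AK) (form_bounded_cons a BL)).
Qed.

Lemma ab_form_inner k (A : ('I_k.+1 -> E) -> R[i]) (K : R) (z : 'I_k -> bidual) a :
  0 <= K -> multilinear A -> form_bounded A K ->
  mkdual (fun a => ab_form (fun x : 'I_k -> E => A (fcons a x)) z) a =
  ab_form (fun x : 'I_k -> E => A (fcons a x)) z.
Proof.
have [hb hl] := ab_form_bound_linear k.
by move=> K0 mA AK; rewrite (ab_form_inner_aux z hb hl K0 mA AK).
Qed.

Lemma weak_star_eval (g : dual E) :
  continuous (fun w : weak_star (dual E) => (w : bidual) g).
Proof.
move=> w.
have := @initial_continuous _ _ (@dual_fun R (dual E) : bidual -> {ptws dual E -> R[i]}) w.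
move=> h; have := (@pointwise_cvgP _ _ _ (dual_fun (w : bidual)) _).1 h.
apply; apply: fmap_filter; exact: (@nbhs_filter (weak_star (dual E)) w).
Qed.

(** Weak-star continuity in the first variable is evaluation at a functional; in
    a later one, the first vector being in the image of [E], it is that of the
    extension of the form with its first variable frozen. *)
Lemma ab_form_spec k (A : ('I_k -> E) -> R[i]) (K : R) :
  0 <= K -> multilinear A -> form_bounded A K -> is_aron_berner A (ab_form A).
Proof.
elim: k A K => [|k IHk] A K K0 mA AK.
  split=> [z []//|x /=|z []//].
  by congr A; apply/funext => -[].
have slice a := IHk _ (K * rnorm a) (mulr_ge0 K0 (rnorm_ge0 a))
  (form_cons a mA) (form_bounded_cons a AK).
have inner z a := ab_form_inner z a K0 mA AK.
have zE (z : 'I_k.+1 -> bidual) w : dfwith z ord0 w \o lift ord0 = z \o lift ord0.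
  by apply/funext => j; rewrite /= dfwithout// neq_lift.
have zS (z : 'I_k.+1 -> bidual) j w :
    dfwith z (lift ord0 j) w \o lift ord0 = dfwith (z \o lift ord0) j w.
  by rewrite -[z in LHS]fcons_eta dfwith_fconsS; apply/funext => l; rewrite /= fconsS.
have z0 (z : 'I_k.+1 -> bidual) j w : dfwith z (lift ord0 j) w ord0 = z ord0.
  by rewrite dfwithout// eq_sym neq_lift.
split.
- move=> z i c u v; case: (unliftP ord0 i) => [j ->|->] /=.
    rewrite !z0 !zS -linearP; congr (z ord0 _); apply/dualP => a.
    apply: (etrans (inner _ a)).
    apply: etrans (congr2 (fun p q => c * p + q) (esym (inner _ a)) (esym (inner _ a))).
    by have [m _ _] := slice a; exact: m.
  by rewrite !zE !dfwithin.
- move=> x /=; rewrite inner; have [_ r _] := slice (x ord0).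
  rewrite -[RHS](congr1 A (fcons_eta x)) -r; congr ab_form.
- move=> z i zr; case: (unliftP ord0 i) zr => [j ->|->] zr /=.
    have [a _ aE] := zr ord0 isT.
    have -> : (fun w : weak_star (dual E) => dfwith z (lift ord0 j) (w : bidual) ord0
        (mkdual (fun a => ab_form (fun x : 'I_k -> E => A (fcons a x))
           (dfwith z (lift ord0 j) (w : bidual) \o lift ord0)))) =
      fun w : weak_star (dual E) => ab_form (fun x => A (fcons a x)) (dfwith (z \o lift ord0) j (w : bidual)).
      by apply/funext => w; rewrite z0 -aE zS -inner.
    have [_ _ c] := slice a; apply: c => l lj; apply: zr.
    by rewrite /= /bump !leq0n.
  rewrite (_ : (fun w : weak_star (dual E) => _) = fun w : weak_star (dual E) =>
    (w : bidual) (mkdual (fun a => ab_form (fun x : 'I_k -> E => A (fcons a x)) (z \o lift ord0)))).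
    exact: weak_star_eval.
  by apply/funext => w; rewrite zE dfwithin.
Qed.

End iterated_extension.

(** ** Weak-star density and uniqueness *)

Section uniqueness.
Context {R : realType} {E : normedModType R[i]}.
Local Notation bidual := (dual (dual E)).

(** A functional vanishing on the common kernel of [s] is a combination of the
    elements of [s]. *)
Lemma dual_span (s : seq (dual E)) (g : dual E) (u : bidual) :
  (forall x, (forall h, h \in s -> h x = 0) -> g x = 0) ->
  (forall h, h \in s -> u h = 0) -> u g = 0.
Proof.
elim: s g => [|d s IHs] g gs us.
  rewrite (_ : g = 0) ?linear0//; apply/dualP => x.
  by rewrite gs.
have us' h : h \in s -> u h = 0 by move=> hs; rewrite us// inE hs orbT.
have ud : u d = 0 by rewrite us// inE eqxx.
have [ds|/existsNP[n /not_implyP[ns dn]]] :=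
    pselect (forall x, (forall h, h \in s -> h x = 0) -> d x = 0).
  apply: IHs => // x xs; apply: gs => h; rewrite inE => /predU1P[->|/xs//].
  exact: ds.
have dn0 : d n != 0 by exact/eqP.
pose c := g n / d n.
have -> : g = c *: d + (- c *: d + g) by rewrite scaleNr addrA subrr add0r.
have uL : u (c *: d + (- c *: d + g)) = c * u d + u (- c *: d + g).
  exact: dual_linear.
rewrite uL ud mulr0 add0r; apply: IHs => // x xs.
have kL (k : dual E) (t : R[i]) : k (t *: n + x) = t * k n + k x.
  exact: dual_linear.
have -> : (- c *: d + g) x = g (- (d x / d n) *: n + x).
  by rewrite kL -[LHS]/(- c * d x + g x) /c; field.
apply: gs => h; rewrite inE kL => /predU1P[->|hs].
  by rewrite mulNr divfK// addNr.
by rewrite (xs h hs) (ns h hs) mulr0 addr0.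
Qed.

(** A functional added to the list either separates a point [n] of the common
    kernel, along which the solution can be corrected, or is a combination of the
    previous ones, and then the solution already fits. *)
Lemma bidual_interpolation (w : bidual) (s : seq (dual E)) :
  exists x : E, forall h, h \in s -> h x = w h.
Proof.
elim: s => [|d s [x xs]]; first by exists 0.
have [ds|/existsNP[n /not_implyP[ns dn]]] :=
    pselect (forall x, (forall h, h \in s -> h x = 0) -> d x = 0).
  exists x => h; rewrite inE => /predU1P[->|/xs//].
  apply/esym/eqP; rewrite -subr_eq0; apply/eqP.
  apply: (@dual_span s d (w - bidual_embedding x)) => // k ks.
  by rewrite dualB -xs//= subrr.
have dn0 : d n != 0 by exact/eqP.
exists (((w d - d x) / d n) *: n + x) => h; rewrite inE.
have kL (k : dual E) (t : R[i]) : k (t *: n + x) = t * k n + k x.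
  exact: dual_linear.
rewrite kL => /predU1P[->|hs]; first by rewrite divfK// subrK.
by rewrite (ns h hs) mulr0 add0r (xs h hs).
Qed.

(** The bidual vectors of [E] agreeing with [w] on finitely many functionals
    form a filter converging to [w]. *)
Lemma weak_star_dense (w : weak_star (dual E)) (f g : weak_star (dual E) -> R[i]) :
  continuous f -> continuous g ->
  (forall x, f (bidual_embedding x) = g (bidual_embedding x)) -> f w = g w.
Proof.
move=> fc gc fg.
pose D (s : seq (dual E)) : set (weak_star (dual E)) :=
  [set v | exists2 x, v = bidual_embedding x & forall h, h \in s -> (v : bidual) h = (w : bidual) h].
pose F := filter_from [set: seq (dual E)] D.
have FF : ProperFilter F.
  apply: filter_from_proper; first apply: filter_from_filter.
  - by exists [::].
  - move=> s t _ _; exists (s ++ t) => // v [x vx xs].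
    by split; exists x => // h hs; apply: xs; rewrite mem_cat hs ?orbT.
  - move=> s _; have [x xs] := bidual_interpolation w s.
    by exists (bidual_embedding x : weak_star (dual E)); exists x.
have Fw : F --> w.
  move=> U /= [_ [[V Vop <-] Vw sVU]].
  have cv : (@dual_fun R (dual E) : bidual -> {ptws dual E -> R[i]}) @ F -->
      ((w : bidual) : {ptws dual E -> R[i]}).
    apply/pointwise_cvgP => h W /nbhs_singleton Wh.
    exists [:: h] => // v [x vx xs]; rewrite /= xs ?inE//.
  have : nbhs ((w : bidual) : {ptws dual E -> R[i]}) V by apply: open_nbhs_nbhs.
  by move=> /cv h; exact: (@filterS _ F _ _ U sVU h).
have fF : f @ F --> f w := cvg_comp _ _ Fw (fc w).
have gF : g @ F --> g w := cvg_comp _ _ Fw (gc w).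
have fgF : f @ F --> g w.
  apply: cvg_trans gF; apply: near_eq_cvg; exists [::] => // v [x -> _].
  by rewrite fg.
by apply: (cvg_unique _ fF fgF); exact: norm_hausdorff.
Qed.

Lemma weak_star_cvgP (f : weak_star (dual E) -> R[i]) (w : weak_star (dual E)) :
  {for w, continuous f} <->
  (forall e : R, 0 < e -> \forall v \near w, rnorm (f v - f w) < e).
Proof. exact: (@cvg_rnormP _ _ _ _ (@nbhs_filter (weak_star (dual E)) w)). Qed.

Lemma dfwith_self (k : nat) (z : 'I_k -> bidual) i : dfwith z i (z i) = z.
Proof.
apply/funext => j; have [->|ij] := eqVneq i j; first by rewrite dfwithin.
by rewrite dfwithout.
Qed.

(** Descending induction on the number of first variables restricted to [E]:
    releasing the last of them is a weak-star continuous operation. *)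
Lemma is_aron_berner_unique k (A : ('I_k -> E) -> R[i])
    (B1 B2 : ('I_k -> bidual) -> R[i]) :
  is_aron_berner A B1 -> is_aron_berner A B2 -> B1 = B2.
Proof.
move=> [_ r1 c1] [_ r2 c2]; apply/funext => z.
(* [m] variables range over the bidual, the first [k - m] ones over [E] *)
have agree m : (m <= k)%N -> forall z : 'I_k -> bidual,
    (forall j : 'I_k, (j < k - m)%N -> range bidual_embedding (z j)) -> B1 z = B2 z.
  elim: m => [|m IHm] mk {}z zr.
    have /choice[x xz] : forall j, exists x, bidual_embedding x = z j.
      by move=> j; have [|x _ xE] := zr j; [rewrite subn0|exists x].
    have -> : z = bidual_embedding \o x by apply/funext => j; rewrite /= xz.
    by rewrite r1 r2.
  have ik : (k - m.+1 < k)%N by rewrite ltn_subrL (leq_trans _ mk).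
  pose i := Ordinal ik; rewrite -(dfwith_self z i).
  apply: (@weak_star_dense (z i) (fun w : weak_star (dual E) => B1 (dfwith z i w))
    (fun w : weak_star (dual E) => B2 (dfwith z i w))).
  - exact: c1.
  - exact: c2.
  - move=> x; apply: IHm => [|j]; first exact: ltnW.
    rewrite -(subnSK mk) ltnS leq_eqVlt => /predU1P[ji|ji].
      have -> : j = i by exact: val_inj.
      by rewrite dfwithin; exists x.
    rewrite dfwithout; first exact: zr.
    by apply/eqP => ij; move: ji; rewrite -ij ltnn.
by apply: (agree k) => // j; rewrite subnn.
Qed.

Lemma aron_bernerE k (P : E -> R[i]) B : is_aron_berner (@polar R E k P) B ->
  aron_berner k P = fun z => B (fun=> z).
Proof.
move=> hB; apply/funext => z; rewrite /aron_berner; case: xgetP => [B' _ hB'|/(_ B)//].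
by rewrite (is_aron_berner_unique hB' hB).
Qed.

Lemma is_aron_bernerD k (A A' : ('I_k -> E) -> R[i])
    (B B' : ('I_k -> bidual) -> R[i]) (c : R[i]) :
  is_aron_berner A B -> is_aron_berner A' B' ->
  is_aron_berner (fun x => c * A x + A' x) (fun z => c * B z + B' z).
Proof.
move=> [mB rB cB] [mB' rB' cB']; split.
- exact: multilinearD.
- by move=> x; rewrite rB rB'.
- move=> z i zi w; apply/weak_star_cvgP => e e0.
  have c1 : 0 < rnorm c + 1 by rewrite ltr_wpDl ?rnorm_ge0.
  have e1 : 0 < e / 2 / (rnorm c + 1) by rewrite !divr_gt0.
  have e2 : 0 < e / 2 by rewrite divr_gt0.
  have /weak_star_cvgP/(_ _ e1) := cB z i zi w.
  have /weak_star_cvgP/(_ _ e2) := cB' z i zi w.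
  apply: (@filterS2 _ _ (@nbhs_filter (weak_star (dual E)) w)) => v h' h.
  rewrite opprD addrACA -mulrBr (le_lt_trans (rnormD _ _))// [ltRHS]splitr.
  apply: ler_ltD => //; rewrite rnormM mulrC.
  apply: (@le_trans _ _ (e / 2 / (rnorm c + 1) * (rnorm c + 1))).
    by rewrite ler_pM ?rnorm_ge0// ?(ltW h)// lerDl.
  by rewrite divfK// lt0r_neq0.
Qed.

Lemma is_aron_berner_power k (g : dual E) :
  is_aron_berner (fun x : 'I_k -> E => \prod_(i < k) g (x i))
    (fun z : 'I_k -> bidual => \prod_(i < k) z i g).
Proof.
split.
- by have [] := dual_power_polar k (bidual_embedding g).
- by [].
- move=> z i _ w.
  have zE (v : weak_star (dual E)) : \prod_(j < k) dfwith z i (v : bidual) j g =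
      (v : bidual) g * \prod_(j < k | j != i) z j g.
    rewrite (bigD1 i)//= dfwithin; congr (_ * _); apply: eq_bigr => j ji.
    by rewrite dfwithout// eq_sym.
  set c := \prod_(j < k | j != i) z j g in zE.
  apply/weak_star_cvgP => e e0.
  have c1 : 0 < rnorm c + 1 by rewrite ltr_wpDl ?rnorm_ge0.
  have e1 : 0 < e / (rnorm c + 1) by rewrite divr_gt0.
  have /weak_star_cvgP/(_ _ e1) := @weak_star_eval R E g w.
  apply: (@filterS _ _ (@nbhs_filter (weak_star (dual E)) w)) => v h; rewrite !zE -mulrBl rnormM.
  apply: (@le_lt_trans _ _ (rnorm ((v : bidual) g - (w : bidual) g) * (rnorm c + 1))).
    by rewrite ler_wpM2l ?rnorm_ge0// lerDl.
  by rewrite -ltr_pdivlMr.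
Qed.

End uniqueness.

Section aron_berner_ideals.
Context {R : realType}.
Local Notation banachType := (completeNormedModType R[i]).
Variables (A : polynomial_classes R) (iA : ideal_sequence A).
Variables (C : R) (C1 : 1 <= C) (slA : slice_bounded A C).

(** Freezing the variables one at a time is slicing, and coherence bounds each
    slice. *)
Lemma polar_bounded (E : banachType) k (P : E -> R[i]) : gmem A k P ->
  form_bounded (@polar R E k P) (C ^+ k * gnorm A k P).
Proof.
elim: k P => [|k IHk] P kP x.
  have [_ _ PE] := polarP (gmem_hpolynomial iA kP).
  rewrite big_ord0 !mulr1 expr0 mul1r (_ : x = fun=> 0); last first.
    by apply/funext => -[].
  by rewrite -PE.
have hP := gmem_hpolynomial iA kP; have [h1 h2] := slA (x ord0) kP.
rewrite -[in leLHS](fcons_eta x).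
have := IHk _ h1 (x \o lift ord0); rewrite polar_sliceP// => /le_trans; apply.
rewrite big_ord_recl mulrA ler_wpM2r ?prod_rnorm_ge0// exprSr -!mulrA.
by rewrite ler_wpM2l ?exprn_ge0 ?(le_trans _ C1)// mulrA.
Qed.

Lemma aron_berner_exists (E : banachType) k (P : E -> R[i]) : gmem A k P ->
  exists B, is_aron_berner (@polar R E k P) B.
Proof.
move=> kP; have [mP _ _] := polarP (gmem_hpolynomial iA kP).
exists (ab_form (polar P)); apply: ab_form_spec mP (polar_bounded kP).
rewrite mulr_ge0 ?(gnorm_ge0 iA)// exprn_ge0// (le_trans _ C1)//.
Qed.

Lemma aron_berner_restrict (E : banachType) k (P : E -> R[i]) x : gmem A k P ->
  aron_berner k P (bidual_embedding x) = P x.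
Proof.
move=> kP; have [B hB] := aron_berner_exists kP; rewrite (aron_bernerE hB).
have [_ _ ->] := polarP (gmem_hpolynomial iA kP).
by have [_ <- _] := hB.
Qed.

Lemma aron_bernerD (E : banachType) k (P Q : E -> R[i]) c : gmem A k P -> gmem A k Q ->
  aron_berner k (c *: P + Q) = c *: aron_berner k P + aron_berner k Q.
Proof.
move=> kP kQ; have [B hB] := aron_berner_exists kP; have [B' hB'] := aron_berner_exists kQ.
rewrite (aron_bernerE hB) (aron_bernerE hB').
have hD := is_aron_bernerD c hB hB'.
move: hD; rewrite -(polarD c (gmem_hpolynomial iA kP) (gmem_hpolynomial iA kQ)).
by move=> /aron_bernerE ->.
Qed.

Lemma aron_berner_power (E : banachType) k (g : dual E) :
  aron_berner k (fun x => g x ^+ k) = fun z => z g ^+ k.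
Proof.
rewrite (@aron_bernerE _ _ _ _ (fun z => \prod_(i < k) z i g)).
  by apply/funext => z; rewrite prodr_const card_ord.
by rewrite (polarE (dual_power_polar k g)); exact: is_aron_berner_power.
Qed.

(** Density descends from a bidual [E''] to a space [F] whose canonical
    embedding into [F''] factors through [E'']: extend a polynomial to [F''],
    pull it back to [E''], approximate there and restrict to [F]. *)
Lemma finite_type_dense_bidual (E F : banachType) (abA : AB_closed A)
    (U : {linear F -> dual (dual E)}) (V : {linear dual (dual E) -> dual (dual F)}) k :
  (0 < k)%N -> continuous U -> continuous V ->
  (forall y, V (U y) = bidual_embedding y) ->
  finite_type_dense A k (dual (dual E)) -> finite_type_dense A k F.
Proof.
case: k => // k _ Uc Vc VU dE P kP e e0; have [alpha a0 abP] := abA.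
have [abm _] := abP _ k.+1 isT P kP.
have [h1 _] := ideal_comp (iA (ltn0Sn k)) Vc abm.
have U0 := opnorm_ge0 Uc.
have Uk : 0 < opnorm U ^+ k.+1 + 1 by rewrite ltr_wpDl ?exprn_ge0.
have [|Q [fQ mQ PQ]] := dE _ h1 (e / (opnorm U ^+ k.+1 + 1)).
  by rewrite divr_gt0.
have [q1 q2] := ideal_comp (iA (ltn0Sn k)) Uc mQ.
exists (Q \o U); split=> //.
  have [n [c [g QE]]] := fQ.
  have gl i : linear (fun y => g i (U y)) by move=> a x y; rewrite !linearP.
  have gb i y : rnorm (g i (U y)) <= rnorm (g i) * opnorm U * rnorm y.
    rewrite (le_trans (le_rnorm_dual _ _))// -mulrA ler_wpM2l ?rnorm_ge0//.
    exact: le_opnorm.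
  exists n, c, (fun i => mkdual (fun y => g i (U y))); apply/funext => y.
  rewrite /= QE; apply: eq_bigr => i _.
  by rewrite (mkdualE (gl i) (gb i)).
have dm : pmem A k.+1 (dual (dual E)) ((aron_berner k.+1 P \o V) - Q).
  exact: (bs_memB (ideal_banach (iA (ltn0Sn k)) (dual (dual E)))).
have [_ d2] := ideal_comp (iA (ltn0Sn k)) Uc dm.
have -> : P - (Q \o U) = ((aron_berner k.+1 P \o V) - Q) \o U.
  apply/funext => y.
  rewrite -[LHS]/(P y - Q (U y)) -[RHS]/(aron_berner k.+1 P (V (U y)) - Q (U y)).
  by rewrite VU (@aron_berner_restrict F k.+1 P y kP).
rewrite (le_lt_trans d2)//.
have n0 := bs_norm_ge0 (ideal_banach (iA (ltn0Sn k)) (dual (dual E))) dm.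
apply: (@le_lt_trans _ _ (pnorm A k.+1 (dual (dual E)) ((aron_berner k.+1 P \o V) - Q) *
    (opnorm U ^+ k.+1 + 1))).
  by rewrite ler_wpM2l// lerDl.
by rewrite -ltr_pdivlMr.
Qed.

End aron_berner_ideals.

(** * Transposition *)

Section transposition.
Context {R : realType}.

Lemma transpose_exists (V W : normedModType R[i]) (T : {linear V -> W}) :
  continuous T -> exists2 Tt : {linear dual W -> dual V}, continuous Tt &
  forall w v, Tt w v = w (T v).
Proof.
move=> Tc; pose f (w : dual W) : dual V := mkdual (fun v => w (T v)).
have wl (w : dual W) : linear (fun v => w (T v)) by move=> a x y; rewrite !linearP.
have wb (w : dual W) v : rnorm (w (T v)) <= rnorm w * opnorm T * rnorm v.
  rewrite (le_trans (le_rnorm_dual _ _))// -mulrA ler_wpM2l ?rnorm_ge0//.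
  exact: le_opnorm.
have fE w v : f w v = w (T v) by rewrite /f (mkdualE (wl w) (wb w)).
have fl : linear f.
  move=> a u v; apply/dualP => x; apply: (etrans (fE _ _)).
  exact: (congr2 (fun p q => a * p + q) (esym (fE u x)) (esym (fE v x))).
exists (mklinear fl) => //; apply: (@bounded_linear _ _ _ (mklinear fl) (opnorm T)) => w.
apply: rnorm_dual_le => [|v].
  by rewrite mulr_ge0 ?rnorm_ge0// opnorm_ge0.
by rewrite /= fE [opnorm T * _]mulrC wb.
Qed.

Lemma bidual_embedding_linear (V : normedModType R[i]) :
  linear (@bidual_embedding R V).
Proof. by move=> a u v; apply/dualP => g; exact: linearP. Qed.

Lemma bidual_embedding_continuous (V : normedModType R[i]) :
  continuous (mklinear (@bidual_embedding_linear V)).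
Proof.
apply: (@bounded_linear _ _ _ (mklinear (@bidual_embedding_linear V)) 1) => x.
rewrite mul1r; apply: rnorm_dual_le => [|g]; first exact: rnorm_ge0.
by rewrite [leRHS]mulrC; exact: (le_rnorm_dual g x).
Qed.

Lemma continuous_complinear (V W X : normedModType R[i]) (S : {linear W -> X})
    (T : {linear V -> W}) : continuous S -> continuous T ->
  continuous ([the {linear V -> X} of S \o T]).
Proof. by move=> Sc Tc x; apply: continuous_comp; [exact: Tc|exact: Sc]. Qed.

(** The restriction to [F] of the transpose of a map [E' -> F']. *)
Lemma predual_exists (E F : normedModType R[i]) (S : {linear dual E -> dual F}) :
  continuous S -> exists2 U : {linear F -> dual (dual E)}, continuous U &
  forall y g, U y g = S g y.
Proof.
move=> Sc; have [St Stc StE] := transpose_exists Sc.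
exists [the {linear F -> dual (dual E)} of St \o mklinear (@bidual_embedding_linear F)].
  by apply: continuous_complinear => //; exact: bidual_embedding_continuous.
by move=> y g /=; rewrite StE.
Qed.

Lemma finite_type_dense_retract (A : polynomial_classes R)
    (E F : completeNormedModType R[i]) (S : {linear dual E -> dual F})
    (T : {linear dual F -> dual E}) : multiplicative_sequence A -> AB_closed A ->
  continuous S -> continuous T -> cancel T S ->
  (forall k, (0 < k)%N -> finite_type_dense A k (dual (dual E))) ->
  forall k, (0 < k)%N -> finite_type_dense A k F.
Proof.
move=> [iA cA _] abA Sc Tc TS dE k k0.
have [C C1 slA] := coherent_slice iA cA.
have [U Uc UE] := predual_exists Sc; have [V Vc VE] := transpose_exists Tc.
apply: (finite_type_dense_bidual iA C1 slA abA k0 Uc Vc _ (dE k k0)) => y.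
by apply/dualP => g; rewrite VE UE TS.
Qed.

End transposition.

(** * From an isomorphism of duals to an isomorphism of algebras *)

Section transport.
Context {R : realType}.
Local Notation banachType := (completeNormedModType R[i]).
Variables (A : polynomial_classes R) (iA : ideal_sequence A).
Variables (C : R) (C1 : 1 <= C) (slA : slice_bounded A C).
Variables (M : R) (M1 : 1 <= M) (muA : mul_bounded A M).
Variables (alpha : R) (alpha0 : 0 < alpha).
Hypothesis abA : forall (E : banachType) k, (0 < k)%N -> forall P : E -> R[i],
  pmem A k E P -> pmem A k (dual (dual E)) (aron_berner k P) /\
  pnorm A k (dual (dual E)) (aron_berner k P) <= alpha ^+ k * pnorm A k E P.
Variables (E F : banachType) (S : {linear dual E -> dual F}).
Variables (U : {linear F -> dual (dual E)}) (Uc : continuous U).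
Hypothesis UE : forall y g, U y g = S g y.
Hypothesis dE : forall k, (0 < k)%N -> finite_type_dense A k E.

(** The effect on degree [k] of the algebra map induced by [S], that is of
    [g ^+ k |-> (S g) ^+ k]; passing through the bidual makes it bounded for the
    ideal norms. *)
Definition transport k (P : E -> R[i]) : F -> R[i] :=
  if k is 0 then fun=> P 0 else aron_berner k P \o U.

Let c : R := alpha * opnorm U + 1.

Let c0 : 0 < c.
Proof. by rewrite ltr_wpDl// mulr_ge0 ?(ltW alpha0)// opnorm_ge0. Qed.

Lemma transport_gmem k P : gmem A k P -> gmem A k (transport k P) /\
  gnorm A k (transport k P) <= c ^+ k * gnorm A k P.
Proof.
case: k => [[d ->]|k kP]; first by rewrite expr0 mul1r; split; [exists d|].
have [h1 h2] := abA (ltn0Sn k) kP.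
have [h3 h4] := ideal_comp (iA (ltn0Sn k)) Uc h1; split=> //.
have n0 : 0 <= pnorm A k.+1 E P := gnorm_ge0 iA (kP : gmem A k.+1 P).
have U0 := opnorm_ge0 Uc.
rewrite (le_trans h4)// (le_trans (ler_wpM2r _ h2)) ?exprn_ge0//.
rewrite mulrAC -exprMn ler_wpM2r// lerXn2r ?nnegrE ?(ltW c0)//.
  by rewrite mulr_ge0// ltW.
by rewrite lerDl.
Qed.

Lemma transportD k P Q d : gmem A k P -> gmem A k Q ->
  transport k (d *: P + Q) = d *: transport k P + transport k Q.
Proof.
case: k => [//|k] kP kQ; rewrite /transport (aron_bernerD iA C1 slA d kP kQ).
by [].
Qed.

Lemma transport_power k (g : dual E) :
  transport k (fun x => g x ^+ k) = fun y => S g y ^+ k.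
Proof.
case: k => [|k]; first by apply/funext => y; rewrite /= !expr0.
by rewrite /transport aron_berner_power; apply/funext => y; rewrite /= UE.
Qed.

Lemma transport_eval_le k P y : gmem A k P ->
  rnorm (transport k P y) <= c ^+ k * rnorm y ^+ k * gnorm A k P.
Proof.
move=> kP; have [h1 h2] := transport_gmem kP.
rewrite (le_trans (geval y iA h1))// mulrAC ler_wpM2r// exprn_ge0//.
exact: rnorm_ge0.
Qed.

Lemma transport_linear k y : linear_on (@gmem R A E k) (fun P => transport k P y).
Proof. by move=> d P Q kP kQ; rewrite transportD. Qed.

(** For every [t] the power [(g + t h) ^+ n] is sent to [(S g + t S h) ^+ n].
    Both are polynomial in [t], with the products [g ^+ (n - j) * h ^+ j] and
    their expected images as coefficients. *)
Lemma transport_mul_powers k l (g h : dual E) y :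
  transport (k + l) ((fun x => g x ^+ k) * (fun x => h x ^+ l)) y =
  S g y ^+ k * S h y ^+ l.
Proof.
set n := (k + l)%N.
pose Q j : E -> R[i] := (fun x => g x ^+ (n - j)) * (fun x => h x ^+ j).
have nQ (j : 'I_n.+1) : gmem A n (Q j).
  have [g1 _] := gmem_dual_power (n - j) g iA.
  have [h1 _] := gmem_dual_power j h iA.
  have [] := muA g1 h1; rewrite subnK// -ltnS ltn_ord//.
have bs := gbanach E n iA.
pose L P := transport n P y.
have linL : linear_on (@gmem R A E n) L by exact: transport_linear.
pose p := \poly_(j < n.+1)
  ('C(n, j)%:R * (L (Q j) - S g y ^+ (n - j) * S h y ^+ j)).
have p0 : p = 0.
  apply: poly_fun0 => t; rewrite horner_poly.
  have e1 : L (fun x => (t *: h + g) x ^+ n) =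
      \sum_(j < n.+1) 'C(n, j)%:R * L (Q j) * t ^+ j.
    have -> : (fun x => (t *: h + g) x ^+ n) =
        \sum_(j < n.+1) ('C(n, j)%:R * t ^+ j) *: Q j.
      apply/funext => x; rewrite fct_sumE -[(t *: h + g) x]/(t * h x + g x).
      rewrite addrC exprDn; apply: eq_bigr => j _.
      rewrite -[RHS]/('C(n, j)%:R * t ^+ j * (g x ^+ (n - j) * h x ^+ j)).
      by rewrite exprMn -mulr_natl; ring.
    rewrite (linear_on_sum (bs_mem0 bs) (@bs_memDZ _ _ _ _ bs) linL).
      apply: eq_bigr => j _.
      by rewrite (linear_onZ (bs_mem0 bs) linL _ (nQ j)) mulrAC.
    by move=> j; apply: (bs_memZ bs); exact: nQ.
  have e2 : L (fun x => (t *: h + g) x ^+ n) =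
      \sum_(j < n.+1) 'C(n, j)%:R * (S g y ^+ (n - j) * S h y ^+ j) * t ^+ j.
    have SE : S (t *: h + g) y = t * S h y + S g y.
      exact: (congr1 (fun k : dual F => k y) (linearP S t h g)).
    rewrite /L transport_power SE addrC exprDn; apply: eq_bigr => j _.
    by rewrite exprMn -mulr_natl; ring.
  rewrite -[RHS](subrr (L (fun x => (t *: h + g) x ^+ n))) {1}e1 e2 -sumrB.
  by apply: eq_bigr => j _; ring.
have ln : (l < n.+1)%N by rewrite ltnS leq_addl.
have := coef_poly n.+1
  (fun j => 'C(n, j)%:R * (L (Q j) - S g y ^+ (n - j) * S h y ^+ j)) l.
rewrite -/p p0 coef0 ln => /esym/eqP.
rewrite mulf_eq0 pnatr_eq0 -[X in X || _]negbK -lt0n bin_gt0 leq_addl/= subr_eq0.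
by rewrite /Q /L /n addnK => /eqP.
Qed.

(** Both sides are bounded and bilinear, so the density of the powers is used in
    one argument at a time. *)
Lemma transport_mul k l P Q : gmem A k P -> gmem A l Q ->
  transport (k + l) (P * Q) = transport k P * transport l Q.
Proof.
move=> kP lQ; apply/funext => y; apply/eqP; rewrite -subr_eq0; apply/eqP.
pose b P Q := transport (k + l) (P * Q) y - transport k P y * transport l Q y.
have M0 : 0 <= M by rewrite (le_trans _ M1).
have bl (u v : E -> R[i]) d (w : E -> R[i]) : (d *: u + v) * w = d *: (u * w) + v * w.
  by apply/funext => x; rewrite -[LHS]/((d * u x + v x) * w x) mulrDl -mulrA.
have br (u v : E -> R[i]) d (w : E -> R[i]) : w * (d *: u + v) = d *: (w * u) + w * v.
  by apply/funext => x; rewrite -[LHS]/(w x * (d * u x + v x)) mulrDr mulrCA.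
pose K1 := c ^+ (k + l) * rnorm y ^+ (k + l) * M ^+ (k + l).
pose K2 := (c ^+ k * rnorm y ^+ k) * (c ^+ l * rnorm y ^+ l).
have cy n : 0 <= c ^+ n * rnorm y ^+ n.
  by rewrite mulr_ge0 ?exprn_ge0 ?rnorm_ge0// ltW.
have K0 : 0 <= K1 + K2.
  apply: addr_ge0; first exact: mulr_ge0 (cy _) (exprn_ge0 _ M0).
  exact: mulr_ge0 (cy _) (cy _).
have bdd P' Q' : gmem A k P' -> gmem A l Q' ->
    rnorm (b P' Q') <= (K1 + K2) * (gnorm A k P' * gnorm A l Q').
  move=> kP' lQ'; have [m1 m2] := muA kP' lQ'.
  rewrite /b (le_trans (rnormB _ _))// mulrDl lerD//.
    rewrite (le_trans (transport_eval_le y m1))// /K1 -[leRHS]mulrA.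
    by rewrite ler_wpM2l ?cy// mulrA.
  have -> : K2 * (gnorm A k P' * gnorm A l Q') =
      (c ^+ k * rnorm y ^+ k * gnorm A k P') * (c ^+ l * rnorm y ^+ l * gnorm A l Q').
    by rewrite /K2; ring.
  by rewrite rnormM ler_pM ?rnorm_ge0// transport_eval_le.
have mem (P' Q' : E -> R[i]) : gmem A k P' -> gmem A l Q' -> gmem A (k + l) (P' * Q').
  by move=> kP' lQ'; have [] := muA kP' lQ'.
have pow (g : dual E) Q' : gmem A l Q' -> b (fun x => g x ^+ k) Q' = 0.
  have [gk _] := gmem_dual_power k g iA.
  apply: (@graded_density R A E l (b (fun x => g x ^+ k))
    ((K1 + K2) * gnorm A k (fun x => g x ^+ k)) iA (dE (k := l))).
  - move=> d u v lu lv; rewrite /b br.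
    have e1 := @transport_linear _ y d _ _ (mem _ _ gk lu) (mem _ _ gk lv).
    have e2 := @transport_linear _ y d _ _ lu lv.
    apply: (etrans (congr2 (fun p q => p - transport k (fun x => g x ^+ k) y * q) e1 e2)).
    by ring.
  - by rewrite mulr_ge0// (gnorm_ge0 iA).
  - by move=> q lq; rewrite -mulrA; exact: bdd.
  - move=> h; rewrite /b transport_mul_powers !transport_power.
    exact: subrr.
apply: (@graded_density R A E k (fun P' => b P' Q) ((K1 + K2) * gnorm A l Q) iA (dE (k := k))) => //.
- move=> d u v lu lv; rewrite /b bl.
  have e1 := @transport_linear _ y d _ _ (mem _ _ lu lQ) (mem _ _ lv lQ).
  have e2 := @transport_linear _ y d _ _ lu lv.
  apply: (etrans (congr2 (fun p q => p - q * transport l Q y) e1 e2)).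
  by ring.
- by rewrite mulr_ge0// (gnorm_ge0 iA).
- by move=> q lq; rewrite -mulrA [gnorm A l Q * _]mulrC; exact: bdd.
- by move=> g; exact: pow.
Qed.

Definition Hb_transport (f : E -> R[i]) : F -> R[i] :=
  psum (fun k => transport k (taylor_coef k f)).

Lemma transport_gseq (P : nat -> E -> R[i]) : gseq A P ->
  gseq A (fun k => transport k (P k)).
Proof.
move=> gP; split=> [k|]; first by have [] := transport_gmem (gP.1 k).
apply: (@rapid_le _ _ (fun k => c ^+ k * gnorm A k (P k))).
  by move=> k; have [] := transport_gmem (gP.1 k).
by apply: rapid_exp => //; exact: gP.2.
Qed.

Lemma Hb_transport_psum (P : nat -> E -> R[i]) : gseq A P ->
  Hb_transport (psum P) = psum (fun k => transport k (P k)).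
Proof.
move=> gP; rewrite /Hb_transport; congr psum; apply/funext => k.
by rewrite (taylor_psum iA k gP).
Qed.

Lemma Hb_transport_Hb f : Hb A f -> Hb A (Hb_transport f).
Proof.
by move=> Hf; exact: (Hb_psum iA C1 slA (transport_gseq (Hb_taylor iA Hf))).
Qed.

Lemma Hb_transportD d f g : Hb A f -> Hb A g ->
  Hb_transport (d *: f + g) = d *: Hb_transport f + Hb_transport g.
Proof.
move=> Hf Hg; have gf := Hb_taylor iA Hf; have gg := Hb_taylor iA Hg.
apply: etrans (psumD iA d (transport_gseq gf) (transport_gseq gg)).
rewrite /Hb_transport; congr psum; apply/funext => k.
rewrite (taylorD iA C1 slA d k Hf Hg).
exact: (transportD d (gf.1 k) (gg.1 k)).
Qed.

Lemma transport_sum n k (u : 'I_n -> E -> R[i]) : (forall i, gmem A k (u i)) ->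
  transport k (\sum_(i < n) u i) = \sum_(i < n) transport k (u i).
Proof.
move=> ku; have bs := gbanach E k iA; apply/funext => y.
have h := linear_on_sum (bs_mem0 bs) (@bs_memDZ _ _ _ _ bs) (@transport_linear k y) ku.
by apply: (etrans h); rewrite fct_sumE.
Qed.

Lemma Hb_transportM f g : Hb A f -> Hb A g ->
  Hb_transport (f * g) = Hb_transport f * Hb_transport g.
Proof.
move=> /(HbP iA C1 slA)[P gP ->] /(HbP iA C1 slA)[Q gQ ->].
have gPQ := gconv_gseq iA M1 muA gP gQ.
apply: (etrans (congr1 Hb_transport (esym (psum_gconv iA M1 muA gP gQ)))).
apply: (etrans (Hb_transport_psum gPQ)).
apply: etrans (congr2 (fun u v => u * v) (esym (Hb_transport_psum gP))
  (esym (Hb_transport_psum gQ))).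
apply: etrans (psum_gconv iA M1 muA (transport_gseq gP) (transport_gseq gQ)).
congr psum; apply/funext => n; rewrite /gconv.
have nPQ (i : 'I_n.+1) : gmem A n (P i * Q (n - i)%N).
  have [] := muA (gP.1 i) (gQ.1 (n - i)%N).
  by rewrite subnKC// -ltnS.
rewrite transport_sum//; apply: eq_bigr => i _.
have := transport_mul (gP.1 i) (gQ.1 (n - i)%N).
by rewrite subnKC// -ltnS.
Qed.

Lemma Hb_transport_seminorm r f : Hb A f -> 0 < r ->
  Hb_seminorm A r (Hb_transport f) <= Hb_seminorm A (c * r) f.
Proof.
move=> Hf r0; have gf := Hb_taylor iA Hf.
have cr : 0 < c * r by rewrite mulr_gt0.
apply: (Hb_seminorm_le iA (transport_gseq gf) r0) => n.
rewrite -[X in Hb_seminorm _ _ X](Hb_psum_taylor iA C1 slA Hf).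
apply: le_trans (Hb_seminorm_sum_le iA n gf cr); apply: ler_sum => k _.
have [_ h] := transport_gmem (gf.1 k).
rewrite exprMn [leRHS]mulrA; apply: ler_wpM2r; first by rewrite exprn_ge0// ltW.
by rewrite [leRHS]mulrC.
Qed.

Lemma Hb_transport_cvg f : Hb A f ->
  Hb_transport @ Hb_nbhs A f --> Hb_nbhs A (Hb_transport f).
Proof.
move=> Hf N [[r e] /= [r0 e0] sub].
exists (c * r, e) => /=; first by rewrite mulr_gt0.
move=> g [Hg ge]; apply: sub; split; first exact: Hb_transport_Hb.
have HB := HbB iA C1 slA Hg Hf.
rewrite -[Hb_transport g - _](Hb_mapB Hb_transportD Hg Hf).
exact: le_lt_trans (Hb_transport_seminorm HB r0) ge.
Qed.

End transport.

Section equivalence.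
Context {R : realType}.
Local Notation banachType := (completeNormedModType R[i]).

Section inverse.
Variables (A : polynomial_classes R) (iA : ideal_sequence A).
Variables (C : R) (C1 : 1 <= C) (slA : slice_bounded A C).
Variables (alpha : R) (alpha0 : 0 < alpha).
Hypothesis abA : forall (E : banachType) k, (0 < k)%N -> forall P : E -> R[i],
  pmem A k E P -> pmem A k (dual (dual E)) (aron_berner k P) /\
  pnorm A k (dual (dual E)) (aron_berner k P) <= alpha ^+ k * pnorm A k E P.
Variables (E F : banachType).
Variables (S : {linear dual E -> dual F}) (T : {linear dual F -> dual E}).
Variables (U : {linear F -> dual (dual E)}) (V : {linear E -> dual (dual F)}).
Hypotheses (Uc : continuous U) (Vc : continuous V).
Hypotheses (UE : forall y g, U y g = S g y) (VE : forall x g, V x g = T g x).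
Hypothesis ST : cancel S T.
Hypothesis dE : forall k, (0 < k)%N -> finite_type_dense A k E.

Lemma transportK k P : gmem A k P -> transport V k (transport U k P) = P.
Proof.
move=> kP; apply/funext => x; apply/eqP; rewrite -subr_eq0; apply/eqP.
have tm Q (kQ : gmem A k Q) := transport_gmem iA alpha0 abA Uc kQ.
pose c := alpha * opnorm U + 1; pose d := alpha * opnorm V + 1.
have c0 : 0 <= c by rewrite addr_ge0// mulr_ge0 ?(ltW alpha0) ?opnorm_ge0.
have d0 : 0 <= d by rewrite addr_ge0// mulr_ge0 ?(ltW alpha0) ?opnorm_ge0.
pose K := d ^+ k * rnorm x ^+ k * c ^+ k + rnorm x ^+ k.
have x0 := rnorm_ge0 x.
have K0 : 0 <= K.
  by rewrite addr_ge0 ?exprn_ge0// mulr_ge0 ?exprn_ge0// mulr_ge0 ?exprn_ge0.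
apply: (@graded_density R A E k (fun Q => transport V k (transport U k Q) x - Q x)
  K iA (dE (k := k))) => //.
- move=> a u v ku kv.
  have e1 : transport V k (transport U k (a *: u + v)) x =
      a * transport V k (transport U k u) x + transport V k (transport U k v) x.
    rewrite (transportD iA C1 slA U a ku kv).
    have := transportD iA C1 slA V a (tm _ ku).1 (tm _ kv).1.
    exact: (congr1 (fun h => h x)).
  apply: (etrans (congr1 (fun p => p - (a * u x + v x)) e1)).
  by ring.
- move=> Q kQ; have [t1 t2] := tm Q kQ.
  rewrite /K mulrDl (le_trans (rnormB _ _))// lerD//.
    rewrite (le_trans (transport_eval_le iA alpha0 abA Vc x t1))//.
    rewrite -/d -[leRHS]mulrA; apply: ler_wpM2l => //.
    by rewrite mulr_ge0 ?exprn_ge0.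
  by rewrite mulrC; exact: (geval x iA kQ).
- move=> g; rewrite (transport_power UE k g) (transport_power VE k (S g)) ST.
  exact: subrr.
Qed.

Lemma Hb_transportK f : Hb A f -> Hb_transport V (Hb_transport U f) = f.
Proof.
move=> Hf; have gf := Hb_taylor iA Hf.
have gt := transport_gseq iA alpha0 abA Uc gf.
apply: (etrans (Hb_transport_psum iA V gt)).
apply: etrans (Hb_psum_taylor iA C1 slA Hf).
by congr psum; apply/funext => k; exact: transportK (gf.1 k).
Qed.

End inverse.

Lemma dual_isomorphic_Hb (A : polynomial_classes R) (E F : banachType) :
  multiplicative_sequence A -> AB_closed A ->
  (forall k, (0 < k)%N -> finite_type_dense A k E) ->
  (forall k, (0 < k)%N -> finite_type_dense A k F) ->
  isomorphic (dual E) (dual F) -> Hb_isomorphic A E A F.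
Proof.
move=> mA [alpha alpha0 abA] dE dF [S [T [ST TS Sc Tc]]].
have [iA cA _] := mA; have [C C1 slA] := coherent_slice iA cA.
have [M M1 muA] := multiplicative_mul mA.
have [U Uc UE] := predual_exists Sc; have [V Vc VE] := predual_exists Tc.
exists (Hb_transport U), (Hb_transport V); split.
- split=> [f Hf|g Hg]; split.
  + exact: (Hb_transport_Hb iA C1 slA alpha0 abA Uc Hf).
  + exact: (Hb_transportK iA C1 slA alpha0 abA Uc Vc UE VE ST dE Hf).
  + exact: (Hb_transport_Hb iA C1 slA alpha0 abA Vc Hg).
  + exact: (Hb_transportK iA C1 slA alpha0 abA Vc Uc VE UE TS dF Hg).
- move=> a f g Hf Hg; exact: (Hb_transportD iA C1 slA alpha0 abA Uc a Hf Hg).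
- move=> f g Hf Hg.
  exact: (Hb_transportM iA C1 slA M1 muA alpha0 abA Uc UE dE Hf Hg).
- move=> f Hf; exact: (Hb_transport_cvg iA C1 slA alpha0 abA Uc Hf).
- move=> g Hg; exact: (Hb_transport_cvg iA C1 slA alpha0 abA Vc Hg).
Qed.

Lemma finite_type_dense_of_bidual (A : polynomial_classes R) (E : banachType) :
  multiplicative_sequence A -> AB_closed A ->
  (forall k, (0 < k)%N -> finite_type_dense A k (dual (dual E))) ->
  forall k, (0 < k)%N -> finite_type_dense A k E.
Proof.
move=> mA abA dE k k0.
pose I : {linear dual E -> dual E} := idfun.
have Ic : continuous I by move=> x; exact: cvg_id.
by apply: (finite_type_dense_retract mA abA Ic Ic _ dE k0).
Qed.

(** The isomorphism of algebras makes [F'] a retract of [E'], which carries the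
    density in [E''] over to [F]. *)
Lemma Hb_isomorphic_dual (A B : polynomial_classes R) (E F : banachType) :
  multiplicative_sequence A -> multiplicative_sequence B -> AB_closed B ->
  (forall k, (0 < k)%N -> finite_type_dense A k E) ->
  (forall k, (0 < k)%N -> finite_type_dense B k (dual (dual E))) ->
  Hb_isomorphic A E B F -> isomorphic (dual E) (dual F).
Proof.
move=> mA mB abB dA dB /(Hb_isomorphic_iso mA mB)[phi [psi iso]].
have [iA cA _] := mA; have [iB cB _] := mB.
have [CA CA1 slA] := coherent_slice iA cA.
have [CB CB1 slB] := coherent_slice iB cB.
have [MA MA1 muA] := multiplicative_mul mA.
have [MB MB1 muB] := multiplicative_mul mB.
apply: (Hb_iso_dual_isomorphic iA iB CA1 CB1 slA slB MA1 MB1 muA muB iso dA).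
have [K hK] := dual_map_bounded iA iB CA1 CB1 slA slB iso.
have [J hJ] := dual_mapV_bounded iA iB CA1 CB1 slA slB iso.
pose S := mklinear (dual_map_linear iA iB CA1 CB1 slA slB iso).
pose T := mklinear (dual_mapV_linear iA iB CA1 CB1 slA slB iso).
have Sc : continuous S := @bounded_linear _ _ _ S K hK.
have Tc : continuous T := @bounded_linear _ _ _ T J hJ.
apply: (finite_type_dense_retract mB abB Sc Tc _ dB).
exact: (dual_mapVK iA iB CA1 CB1 slA slB MA1 MB1 muA muB iso dA).
Qed.

End equivalence.

Local Open Scope complex_scope.

Theorem theorem4p2 (R : realType) (E F : completeNormedModType R[i]) :
  (forall A : polynomial_classes R,
     multiplicative_sequence A -> AB_closed A ->
     (forall k, (0 < k)%N -> finite_type_dense A k (dual (dual E))) ->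
     (Hb_isomorphic A E A F <-> isomorphic (dual E) (dual F))) /\
  (forall A B : polynomial_classes R,
     multiplicative_sequence A -> multiplicative_sequence B -> AB_closed B ->
     (forall k, (0 < k)%N -> finite_type_dense A k E) ->
     (forall k, (0 < k)%N -> finite_type_dense B k (dual (dual E))) ->
     Hb_isomorphic A E B F -> isomorphic (dual E) (dual F)).
Proof.
split=> [A mA abA dE|A B mA mB abB dA dB]; last exact: Hb_isomorphic_dual.
have dE' := finite_type_dense_of_bidual mA abA dE.
split=> [|EF]; first exact: Hb_isomorphic_dual.
apply: dual_isomorphic_Hb => //; have [S [T [ST TS Sc Tc]]] := EF.
exact: (finite_type_dense_retract mA abA Sc Tc TS dE).
Qed.
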